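(* Let $p$ be an odd prime, and let $n$ be a (strictly positive) power of $p$. Define double cochain complexes $E_0^{*,*}$ and $E_0'^{*,*}$ by $$E_0^{i,j}=\mathrm{Hom}_{\Sigma_p}(W_i,D'(n,0)^j),\qquad E_0'^{i,j}=\mathrm{Hom}_{\Sigma_p}(W_i,D'(n,1)^j).$$ The corresponding type II spectral sequences collapse at $E_2$, and give rise to no extension problems. The $E_2$-pages are as follows, where $i'$ ranges over the integers $i'\ge0$: $$E_2^{i,j}\cong\begin{cases}\mathbb Z_{(p)}/(pn)&\text{for }i=j=0,\\\mathbb Z_{(p)}/(p)&\text{for }j=0,\ i=(2i'+2)(p-1),\\&\quad\text{or }j=-p,\ i=(2i'+1)(p-1),\\0&\text{otherwise;}\end{cases}$$ $$E_2'^{i,j}\cong\begin{cases}\mathbb Z_{(p)}/(n)&\text{for }i=0,\ j=1,\\\mathbb Z_{(p)}/(p)&\text{for }j=0,\ i=(2i'+2)(p-1),\\&\quad\text{or }j=p,\ i=(2i'+1)(p-1),\\0&\text{otherwise.}\end{cases}$$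
   Context: $\mathbb Z_{(p)}$ is the ring of integers localized at $p$, and $\Sigma_p$ is the symmetric group on $p$ letters. $W_*$ is the cellular chain complex with $\mathbb Z_{(p)}$ coefficients of a contractible free $\Sigma_p$-CW-complex, and $\mathrm{Hom}_{\Sigma_p}=\mathrm{Hom}_{\mathbb Z_{(p)}\Sigma_p}$. $C(n,k)^*$ is the cochain complex with $C(n,k)^{k-1}=C(n,k)^k=\mathbb Z$, all other groups zero, and differential $C(n,k)^{k-1}\to C(n,k)^k$ multiplication by $n$. $D'(n,k)^*=(C(n,k)^* )^{\otimes p}\otimes\mathbb Z_{(p)}$, a complex of $\mathbb Z_{(p)}\Sigma_p$-modules where $\Sigma_p$ permutes the $p$ tensor factors with the Koszul sign (interchanging adjacent homogeneous factors $c,c'$ introduces $(-1)^{\deg c\deg c'}$). The double complexes have differentials $d$ raising $i$ (from $W_*$) and $d'$ raising $j$ (from $D'(n,k)^*$); the type II spectral sequence is the one with $d_0=d$, with $d_r:E_r^{i,j}\to E_r^{i-r+1,j+r}$. *)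

(* Defs.v *)
From HB Require Import structures.
From mathcomp Require Import all_boot all_order all_fingroup all_algebra.
From mathcomp Require Import generic_quotient ring.
From mathcomp Require Import boolp classical_sets functions cardinality fsbigop.

Set Implicit Arguments.
Unset Strict Implicit.
Unset Printing Implicit Defensive.

Import Order.TTheory GRing.Theory Num.Theory.
Local Open Scope quotient_scope.
Local Open Scope classical_set_scope.
Local Open Scope ring_scope.

Section Modules.
Variable R : comNzRingType.

Definition lisom (U V : lmodType R) : Prop :=
  exists f : {linear U -> V}, bijective f.

Record submodule (V : lmodType R) := Submodule {
  smset :> V -> Prop;
  smset0 : smset 0;
  smset_lin : forall (a : R) u v, smset u -> smset v -> smset (a *: u + v)
}.

Section Submodule.
Variables (V : lmodType R) (S : submodule V).

Lemma smsetZ a u : S u -> S (a *: u).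
Proof. by move=> Su; rewrite -[_ *: _]addr0; apply: smset_lin => //; exact: smset0. Qed.
Lemma smsetD u v : S u -> S v -> S (u + v).
Proof. by move=> Su Sv; rewrite -[u]scale1r; apply: smset_lin. Qed.
Lemma smsetN u : S u -> S (- u).
Proof. by rewrite -scaleN1r; apply: smsetZ. Qed.
Lemma smsetB u v : S u -> S v -> S (u - v).
Proof. by move=> Su Sv; apply: smsetD => //; apply: smsetN. Qed.

Definition smmem : {pred V} := fun x => `[< S x >].
Lemma smmemP x : reflect (S x) (x \in smmem).
Proof. exact: asboolP. Qed.
Lemma smmem_closed : submod_closed smmem.
Proof.
split=> [|a u v /smmemP Su /smmemP Sv]; apply/smmemP; first exact: smset0.
exact: smset_lin.
Qed.
HB.instance Definition _ := GRing.isSubmodClosed.Build R V smmem smmem_closed.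

Definition submod := {x : V | x \in smmem}.
HB.instance Definition _ :=
  [isSub of submod for @sval V (fun x => x \in smmem)].
HB.instance Definition _ := [Choice of submod by <:].
HB.instance Definition _ := [SubChoice_isSubLmodule of submod by <:].

Definition smval (x : submod) : V := val x.
Lemma smvalP (x : submod) : S (smval x).
Proof. exact/smmemP/(valP x). Qed.
Definition insm (x : V) (Sx : S x) : submod := exist _ x (introT (smmemP x) Sx).

(* [Quotient.quot] only has an additive structure in the library. *)
Definition qmod := Quotient.quot smmem.
HB.instance Definition _ := GRing.Zmodule.on qmod.

Definition qclass (x : V) : qmod := \pi_(Quotient.quot smmem) x.

Lemma qclass_eq x y : qclass x = qclass y <-> S (x - y).
Proof.
split=> [/eqP|xy]; first by rewrite -Quotient.idealrBE => /smmemP.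
by apply/eqP; rewrite -Quotient.idealrBE; apply/smmemP.
Qed.
Lemma qclass_repr (u : qmod) : qclass (repr u) = u.
Proof. exact: reprK. Qed.
Lemma qclassD x y : qclass (x + y) = qclass x + qclass y.
Proof. exact: raddfD. Qed.

Definition qscale (a : R) (u : qmod) : qmod := qclass (a *: repr u).
Lemma qscale_class a x : qscale a (qclass x) = qclass (a *: x).
Proof.
by apply/qclass_eq; rewrite -scalerBr; apply/smsetZ/qclass_eq/qclass_repr.
Qed.
Lemma qscaleA a b u : qscale a (qscale b u) = qscale (a * b) u.
Proof. by rewrite -[u]qclass_repr !qscale_class scalerA. Qed.
Lemma qscale1 : left_id 1 qscale.
Proof. by move=> u; rewrite -[u]qclass_repr qscale_class scale1r. Qed.
Lemma qscaleDr : right_distributive qscale +%R.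
Proof.
move=> a u v; rewrite -[u]qclass_repr -[v]qclass_repr -qclassD !qscale_class.
by rewrite -qclassD scalerDr.
Qed.
Lemma qscaleDl u : {morph qscale^~ u : a b / a + b}.
Proof.
by move=> a b; rewrite -[u]qclass_repr !qscale_class -qclassD scalerDl.
Qed.
HB.instance Definition _ :=
  GRing.Zmodule_isLmodule.Build R qmod qscaleA qscale1 qscaleDr qscaleDl.

Lemma qclass_linear : linear qclass.
Proof. by move=> a u v; rewrite qclassD -qscale_class. Qed.
HB.instance Definition _ := GRing.isLinear.Build R V qmod *:%R qclass qclass_linear.
End Submodule.

(* The subquotient Z / (Z `&` B). *)
Section Subquotient.
Variables (V : lmodType R) (Z B : submodule V).

Definition subq_rel : submodule (submod Z).
Proof.
apply: (@Submodule _ [set x : submod Z | B (smval x)]) => /= [|a u v Bu Bv].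
  exact: smset0.
exact: smset_lin.
Defined.

Definition subq : lmodType R := qmod subq_rel.

Definition represents (q : subq) (z : V) : Prop :=
  exists Zz : Z z, q = qclass subq_rel (insm Zz).
End Subquotient.

Section SubquotientMap.
Variables (V : lmodType R) (f : {linear V -> V}) (Z B Z' B' : submodule V).
Hypothesis fZ : forall x, Z x -> Z' (f x).
Hypothesis fB : forall x, Z x -> B x -> B' (f x).

Definition subq_map_fun (q : subq Z B) : subq Z' B' :=
  qclass (subq_rel Z' B') (insm (fZ (smvalP (repr q)))).

Lemma subq_map_class (z : submod Z) :
  subq_map_fun (qclass (subq_rel Z B) z) =
  qclass (subq_rel Z' B') (insm (fZ (smvalP z))).
Proof.
apply/qclass_eq => /=; rewrite /smval /= -raddfB.
have /qclass_eq := qclass_repr (qclass (subq_rel Z B) z).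
by apply: fB; apply: smsetB; apply: smvalP.
Qed.

Lemma subq_map_linear : linear subq_map_fun.
Proof.
move=> a u v; rewrite -[u]qclass_repr -[v]qclass_repr -linearP !subq_map_class.
rewrite -linearP; congr qclass; apply: val_inj.
by rewrite /= /smval /= linearP.
Qed.
HB.instance Definition _ :=
  GRing.isLinear.Build R (subq Z B) (subq Z' B') *:%R subq_map_fun subq_map_linear.

Definition subq_map : {linear subq Z B -> subq Z' B'} := subq_map_fun.
End SubquotientMap.

Section DirectSum.
Variables (I : Type) (M : I -> lmodType R).
Definition dprod := forall i, M i.
HB.instance Definition _ := Choice.copy dprod (forall i, M i : choiceType).

Let zero : dprod := fun=> 0.
Let opp (x : dprod) : dprod := fun i => - x i.
Let add (x y : dprod) : dprod := fun i => x i + y i.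
Let scale (a : R) (x : dprod) : dprod := fun i => a *: x i.
Let addA : associative add.
Proof. by move=> x y z; apply: functional_extensionality_dep => i; exact: addrA. Qed.
Let addC : commutative add.
Proof. by move=> x y; apply: functional_extensionality_dep => i; exact: addrC. Qed.
Let add0 : left_id zero add.
Proof. by move=> x; apply: functional_extensionality_dep => i; exact: add0r. Qed.
Let addN : left_inverse zero opp add.
Proof. by move=> x; apply: functional_extensionality_dep => i; exact: addNr. Qed.
HB.instance Definition _ := GRing.isZmodule.Build dprod addA addC add0 addN.
Let scaleA a b v : scale a (scale b v) = scale (a * b) v.
Proof. by apply: functional_extensionality_dep => i; exact: scalerA. Qed.
Let scale1 : left_id 1 scale.
Proof. by move=> x; apply: functional_extensionality_dep => i; exact: scale1r. Qed.
Let scaleDr : right_distributive scale +%R.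
Proof. by move=> a x y; apply: functional_extensionality_dep => i; exact: scalerDr. Qed.
Let scaleDl v : {morph scale^~ v : a b / a + b}.
Proof. by move=> a b; apply: functional_extensionality_dep => i; exact: scalerDl. Qed.
HB.instance Definition _ :=
  GRing.Zmodule_isLmodule.Build R dprod scaleA scale1 scaleDr scaleDl.

Definition fin_supp : submodule dprod.
Proof.
apply: (@Submodule _ [set x : dprod | finite_set [set i | x i <> 0]]) => /=.
  by apply: (sub_finite_set _ (@finite_set0 I)) => i /=; apply.
move=> a u v fu fv.
apply: (sub_finite_set _ (_ : finite_set ([set i | u i <> 0] `|` [set i | v i <> 0]))).
  move=> i /=; case: (pselect (u i = 0)) => [u0|]; last by left.
  case: (pselect (v i = 0)) => [v0|]; last by right.
  by case; rewrite -[LHS]/(a *: u i + v i) u0 v0 scaler0 addr0.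
by rewrite finite_setU; split.
Defined.

Definition dsum : lmodType R := submod fin_supp.
Definition coord (x : dsum) (i : I) : M i := smval x i.
End DirectSum.

End Modules.

Section GModules.
Variables (R : comNzRingType) (gT : finGroupType).

(* Products in [{perm T}] are read from left to right, (s * t) x = t (s x), so
   [gact_mul] makes [gact] a left action for the usual composition. *)
Record gmod := GMod {
  gcar :> lmodType R;
  gact : gT -> {linear gcar -> gcar};
  gact_one : forall v, gact 1%g v = v;
  gact_mul : forall g h v, gact (g * h)%g v = gact h (gact g v)
}.

Lemma triv_gmod_subproof (g h : gT) (v : R^o) : idfun v = idfun (idfun v).
Proof. by []. Qed.
Definition triv_gmod : gmod :=
  @GMod R^o (fun=> idfun) (fun=> erefl) triv_gmod_subproof.

(* Free over the group ring R[G], on a possibly infinite basis b: the g . b x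
   form a basis over R. *)
Definition gfree (V : gmod) : Prop :=
  exists (X : choiceType) (b : X -> V), forall v : V,
  exists! c : gT * X -> R, finite_set [set k | c k <> 0] /\
    v = \sum_(k \in [set: gT * X]) c k *: gact V k.1 (b k.2).

Section Hom.
Variables U V : gmod.

Definition ghom_sub : submodule (U -> V).
Proof.
apply: (@Submodule _ _ [set f : U -> V | linear f /\
  forall g u, f (gact U g u) = gact V g (f u)]) => /= [|a f f' [lf ef] [lf' ef']].
  have z u : (0 : U -> V) u = 0 by [].
  by split=> [a u v|g u]; rewrite !z ?scaler0 ?addr0 // linear0.
split=> [b u v|g u]; rewrite -[LHS]/(a *: f _ + f' _).
  rewrite lf lf' -[RHS]/(b *: (a *: f u + f' u) + (a *: f v + f' v)).
  rewrite !scalerDr !scalerA [a * b]mulrC -!addrA; congr (_ + _).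
  by rewrite addrCA.
by rewrite ef ef' -[RHS]/(gact V g (a *: f u + f' u)) linearP.
Defined.

Definition ghom : lmodType R := submod ghom_sub.
Definition ghom_fun (f : ghom) : U -> V := smval f.

Lemma ghom_fun_linear (f : ghom) : linear (ghom_fun f).
Proof. by have [] := smvalP f. Qed.
HB.instance Definition _ (f : ghom) :=
  GRing.isLinear.Build R U V *:%R (ghom_fun f) (ghom_fun_linear f).
Lemma ghom_act (f : ghom) g u : ghom_fun f (gact U g u) = gact V g (ghom_fun f u).
Proof. by have [] := smvalP f. Qed.
Lemma ghomP (f f' : ghom) : ghom_fun f =1 ghom_fun f' -> f = f'.
Proof. by move=> ff'; apply/val_inj/funext. Qed.
End Hom.

Lemma ghom_comp_subproof (U V W : gmod) (f : ghom V W) (f' : ghom U V) :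
  ghom_sub U W (ghom_fun f \o ghom_fun f').
Proof. by split=> [a u v|g u] /=; rewrite ?linearP // !ghom_act. Qed.
Definition ghom_comp U V W (f : ghom V W) (f' : ghom U V) : ghom U W :=
  insm (ghom_comp_subproof f f').

Lemma ghom_compE U V W (f : ghom V W) (f' : ghom U V) u :
  ghom_fun (ghom_comp f f') u = ghom_fun f (ghom_fun f' u).
Proof. by []. Qed.

(* A cochain complex of R[G]-modules; [gd j] is the differential with target in
   degree j, which avoids casts. *)
Record gcochain := GCochain {
  gobj :> int -> gmod;
  gd : forall j, ghom (gobj (j - 1)) (gobj j);
  gdd : forall j x, ghom_fun (gd j) (ghom_fun (gd (j - 1)) x) = 0
}.

(* The data and properties of the cellular chain complex (coefficients R) of a
   contractible free G-CW-complex: a complex of free R[G]-modules in nonnegative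
   degrees, augmented to the trivial module and exact. *)
Record gresolution := GResolution {
  robj :> nat -> gmod;
  rd : forall i, ghom (robj i.+1) (robj i);
  raug : ghom (robj 0) triv_gmod;
  rfree : forall i, gfree (robj i);
  raug_surj : forall a, exists w, ghom_fun raug w = a;
  rexact0 : forall w, ghom_fun raug w = 0 <-> exists w', w = ghom_fun (rd 0) w';
  rexact : forall i w,
    ghom_fun (rd i) w = 0 <-> exists w', w = ghom_fun (rd i.+1) w'
}.
End GModules.

(* A double cochain complex in the half plane i >= 0; [bd] raises i and [bd']
   raises j, [bd' i j] having its target in bidegree (i, j). *)
Record bicomplex (R : comNzRingType) := Bicomplex {
  bobj :> nat -> int -> lmodType R;
  bd : forall i j, {linear bobj i j -> bobj i.+1 j};
  bd' : forall i j, {linear bobj i (j - 1) -> bobj i j};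
  bdd : forall i j x, bd i.+1 j (bd i j x) = 0;
  bdd' : forall i j x, bd' i j (bd' i (j - 1) x) = 0;
  bdC : forall i j x, bd i j (bd' i j x) = bd' i.+1 j (bd i (j - 1) x)
}.

Section HomBicomplex.
Variables (R : comNzRingType) (gT : finGroupType).

Section Functoriality.
Variables U V W : gmod R gT.
Definition ghom_pre_fun (g : ghom U V) (f : ghom V W) : ghom U W := ghom_comp f g.
Lemma ghom_pre_linear (g : ghom U V) : linear (ghom_pre_fun g).
Proof. by move=> a f f'; apply: ghomP. Qed.
HB.instance Definition _ (g : ghom U V) :=
  GRing.isLinear.Build R (ghom V W) (ghom U W) *:%R
    (ghom_pre_fun g) (ghom_pre_linear g).
Definition ghom_pre (g : ghom U V) : {linear ghom V W -> ghom U W} :=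
  ghom_pre_fun g.

Lemma ghom_post_linear (g : ghom V W) :
  linear (@ghom_comp R gT U V W g).
Proof.
by move=> a f f'; apply: ghomP => u; exact: (linearP (ghom_fun g)).
Qed.
HB.instance Definition _ (g : ghom V W) :=
  GRing.isLinear.Build R (ghom U V) (ghom U W) *:%R
    (@ghom_comp R gT U V W g) (ghom_post_linear g).
Definition ghom_post (g : ghom V W) : {linear ghom U V -> ghom U W} :=
  @ghom_comp R gT U V W g.
End Functoriality.

Variables (W : gresolution R gT) (D : gcochain R gT).

Lemma hom_bdd i j (f : ghom (W i) (D j)) :
  ghom_pre (D j) (rd W i.+1) (ghom_pre (D j) (rd W i) f) = 0.
Proof.
apply: ghomP => w; rewrite !ghom_compE.
have -> : ghom_fun (rd W i) (ghom_fun (rd W i.+1) w) = 0.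
  by case: i f w => [|i] f w; apply/rexact; exists w.
exact: linear0.
Qed.

Lemma hom_bdd' i j (f : ghom (W i) (D (j - 1 - 1))) :
  ghom_post (W i) (gd D j) (ghom_post (W i) (gd D (j - 1)) f) = 0.
Proof. by apply: ghomP => w; exact: gdd. Qed.

Lemma hom_bdC i j (f : ghom (W i) (D (j - 1))) :
  ghom_pre (D j) (rd W i) (ghom_post (W i) (gd D j) f) =
  ghom_post (W i.+1) (gd D j) (ghom_pre (D (j - 1)) (rd W i) f).
Proof. exact: ghomP. Qed.

Definition hom_bicomplex : bicomplex R :=
  @Bicomplex R (fun i j => ghom (W i) (D j))
    (fun i j => ghom_pre (D j) (rd W i)) (fun i j => ghom_post (W i) (gd D j))
    hom_bdd hom_bdd' hom_bdC.
End HomBicomplex.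

(* The spectral sequence of the filtration of the total complex by j, for which
   d_0 is induced by d.  The total complex is handled as one module with a differential, in which the cochains
   of total degree m and the filtration steps are submodules. *)
Section SpectralSequence.
Variables (R : comNzRingType) (E : bicomplex R).

Definition tot : lmodType R := dsum (fun ij : nat * int => E ij.1 ij.2).

Definition totd_fun_h (x : tot) (ij : nat * int) : E ij.1 ij.2 :=
  let: (i, j) := ij in
  match i return E i j with
  | 0 => 0
  | i'.+1 => bd E i' j (coord x (i', j))
  end.
Definition totd_fun_v (x : tot) (ij : nat * int) : E ij.1 ij.2 :=
  let: (i, j) := ij in (-1) ^+ i *: bd' E i j (coord x (i, j - 1)).

Lemma totd_fin (x : tot) :
  fin_supp (fun ij : nat * int => E ij.1 ij.2)
    (fun ij => totd_fun_h x ij + totd_fun_v x ij).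
Proof.
have fx : finite_set [set ij | coord x ij <> 0] := smvalP x.
have fh := finite_image (fun ij : nat * int => (ij.1.+1, ij.2)) fx.
have fv := finite_image (fun ij : nat * int => (ij.1, ij.2 + 1)) fx.
rewrite /fin_supp /=.
apply: (sub_finite_set _ (_ : finite_set
  ([set (ij.1.+1, ij.2) | ij in [set ij | coord x ij <> 0]] `|`
   [set (ij.1, ij.2 + 1) | ij in [set ij | coord x ij <> 0]]))); last first.
  by rewrite finite_setU; split.
move=> [i j] /= nz.
case: (pselect (coord x (i, j - 1) = 0)) => [v0|v0]; last first.
  by right; exists (i, j - 1) => //=; rewrite subrK.
case: i v0 nz => [|i] v0 nz; first by case: nz; rewrite v0 !linear0 ?addr0.
case: (pselect (coord x (i, j) = 0)) => [h0|h0]; last by left; exists (i, j).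
by case: nz; rewrite v0 h0 !linear0 ?addr0.
Qed.

Definition totd_fun (x : tot) : tot := insm (totd_fin x).
Lemma totd_linear : linear totd_fun.
Proof.
move=> a x y; apply: val_inj; apply: functional_extensionality_dep => -[i j].
rewrite -[RHS]/(a *: (totd_fun_h x (i, j) + totd_fun_v x (i, j)) +
  (totd_fun_h y (i, j) + totd_fun_v y (i, j))).
rewrite scalerDr addrACA -[LHS]/(totd_fun_h (a *: x + y) (i, j) +
  totd_fun_v (a *: x + y) (i, j)); congr (_ + _).
  case: i => [|i] /=; first by rewrite scaler0 addr0.
  by rewrite -linearP.
rewrite /=.
have -> : coord (a *: x + y) (i, j - 1) =
  a *: coord x (i, j - 1) + coord y (i, j - 1) by [].
by rewrite linearP scalerDr !scalerA [a * _]mulrC.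
Qed.
HB.instance Definition _ := GRing.isLinear.Build R tot tot *:%R totd_fun totd_linear.
(* The differential d + (-1)^i d' of the total complex. *)
Definition totd : {linear tot -> tot} := totd_fun.

Definition totdeg (m : int) : submodule tot.
Proof.
apply: (@Submodule _ tot
  [set x : tot | forall i j, (i%:Z + j != m) -> coord x (i, j) = 0]) => //=.
move=> a u v u0 v0 i j ijm; rewrite -[LHS]/(a *: coord u (i, j) + coord v (i, j)).
by rewrite u0 // v0 // scaler0 addr0.
Defined.

Definition totfil (s : int) : submodule tot.
Proof.
apply: (@Submodule _ tot
  [set x : tot | forall i j, j < s -> coord x (i, j) = 0]) => //=.
move=> a u v u0 v0 i j js; rewrite -[LHS]/(a *: coord u (i, j) + coord v (i, j)).
by rewrite u0 // v0 // scaler0 addr0.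
Defined.

(* Z_r^{s,m} = {x in F^s Tot^m | Dx in F^{s+r}} *)
Definition zcycles (r s m : int) : submodule tot.
Proof.
apply: (@Submodule _ tot
  [set x : tot | [/\ totdeg m x, totfil s x & totfil (s + r) (totd x)]]).
  by split; rewrite ?linear0; apply: smset0.
by move=> a u v [? ? ?] [? ? ?]; split; rewrite ?linearP; apply: smset_lin.
Defined.

(* B_r^{s,m} = Z_{r-1}^{s+1,m} + D Z_{r-1}^{s-r+1,m-1} *)
Definition zbounds (r s m : int) : submodule tot.
Proof.
apply: (@Submodule _ tot [set x : tot | exists u v,
  [/\ zcycles (r - 1) (s + 1) m u, zcycles (r - 1) (s - r + 1) (m - 1) v
    & x = u + totd v]]).
  by exists 0, 0; split; [exact: smset0|exact: smset0|rewrite linear0 addr0].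
move=> a _ _ [u [v [zu zv ->]]] [u' [v' [zu' zv' ->]]].
exists (a *: u + u'), (a *: v + v'); split; [exact: smset_lin..|].
by rewrite linearP scalerDr addrACA.
Defined.

(* i + j is the total degree and j the filtration degree *)
Definition page (r : nat) (i j : int) : lmodType R :=
  subq (zcycles r%:Z j (i + j)) (zbounds r%:Z j (i + j)).

Lemma totdK x : totd (totd x) = 0.
Proof.
apply: val_inj; apply: functional_extensionality_dep => -[i j].
rewrite -[LHS]/(totd_fun_h (totd x) (i, j) + totd_fun_v (totd x) (i, j)) -[RHS]/0.
have dE i' j' : coord (totd x) (i', j') = totd_fun_h x (i', j') + totd_fun_v x (i', j').
  by [].
rewrite /totd_fun_v !dE linearD scalerDr /= linearZ /= bdd' !scaler0 addr0.
case: i => [|i]; first by rewrite !linear0 ?addr0.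
rewrite /= !dE linearD linearZ /= bdC exprS mulN1r scaleNr.
case: i => [|i]; first by rewrite linear0 add0r subrr.
by rewrite /= bdd add0r subrr.
Qed.

Lemma totd_deg m x : totdeg m x -> totdeg (m + 1) (totd x).
Proof.
move=> xm i j ijm.
rewrite -[LHS]/(totd_fun_h x (i, j) + totd_fun_v x (i, j)) /=.
rewrite xm; last first.
  by apply: contra ijm => /eqP <-; rewrite addrA subrK.
rewrite !linear0 ?addr0.
case: i ijm => [//|i] ijm.
rewrite xm ?linear0 //; apply: contra ijm => /eqP <-.
by rewrite intS -addrA addrC.
Qed.

Lemma dpage_degE (r : nat) (i j : int) :
  i - r%:Z + 1 + (j + r%:Z) = i + j + 1.
Proof. by rewrite [j + _]addrC addrACA subrK [1 + j]addrC addrA. Qed.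

Lemma dpage_cycle (r : nat) (i j : int) x :
  zcycles r%:Z j (i + j) x ->
  zcycles r%:Z (j + r%:Z) (i - r%:Z + 1 + (j + r%:Z)) (totd x).
Proof.
case=> xm xj xr; split=> //; last by rewrite totdK; exact: smset0.
by rewrite dpage_degE; exact: totd_deg.
Qed.

Lemma dpage_bound (r : nat) (i j : int) x :
  zcycles r%:Z j (i + j) x -> zbounds r%:Z j (i + j) x ->
  zbounds r%:Z (j + r%:Z) (i - r%:Z + 1 + (j + r%:Z)) (totd x).
Proof.
move=> _ [u [v [zu zv ->]]].
exists 0, u; split; first exact: smset0.
  by rewrite dpage_degE !addrK.
by rewrite linearD totdK addr0 add0r.
Qed.

Definition dpage (r : nat) (i j : int) :
    {linear page r i j -> page r (i - r%:Z + 1) (j + r%:Z)} :=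
  subq_map (@dpage_cycle r i j) (@dpage_bound r i j).

Definition collapses_at (r0 : nat) : Prop :=
  forall (r : nat) (i j : int) (x : page r i j), (r0 <= r)%N -> dpage r i j x = 0.

Definition cocycles (m : int) : submodule tot.
Proof.
apply: (@Submodule _ tot [set x : tot | totdeg m x /\ totd x = 0]).
  by split; [exact: smset0|rewrite linear0].
move=> a u v [um u0] [vm v0]; split; first exact: smset_lin.
by rewrite linearP u0 v0 scaler0 addr0.
Defined.

Definition coboundaries (m : int) : submodule tot.
Proof.
apply: (@Submodule _ tot [set x : tot | exists2 y, totdeg (m - 1) y & x = totd y]).
  by exists 0; [exact: smset0|rewrite linear0].
move=> a _ _ [y ym ->] [y' ym' ->].
by exists (a *: y + y'); [exact: smset_lin|rewrite linearP].
Defined.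

Definition totcoh (m : int) : lmodType R := subq (cocycles m) (coboundaries m).

(* For a spectral sequence collapsing at E_r: in each total degree m the
   filtration of H^m splits, i.e. H^m is isomorphic to the direct sum of the
   E_r^{i,j} with i + j = m, in such a way that e in E_r^{m-j,j} corresponds to
   the class of a cocycle in F^j which represents e. *)
Definition no_extension_problems (r : nat) : Prop :=
  forall m : int, exists phi : {linear dsum (fun j : int => page r (m - j) j) -> totcoh m},
    bijective phi /\
    forall j (e : dsum (fun j : int => page r (m - j) j)),
      (forall k, k != j -> coord e k = 0) ->
      exists z : tot,
        [/\ totfil j z, represents (coord e j) z & represents (phi e) z].
End SpectralSequence.

(* A finite complex of free Z-modules with a homogeneous basis; [zdif a b] is the
   coefficient of b in the differential of a. *)
Record zcomplex := ZComplex {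
  zbas : finType;
  zdeg : zbas -> int;
  zdif : zbas -> zbas -> int;
  zdif_deg : forall a b, zdif a b != 0 -> zdeg b = zdeg a + 1;
  zdifK : forall a c, \sum_b zdif a b * zdif b c = 0
}.

Section Cnk.
Variables (n : nat) (k : int).
(* [false] and [true] are the generators in degrees k - 1 and k. *)
Definition Cnk_deg (b : bool) : int := if b then k else k - 1.
Definition Cnk_dif (a b : bool) : int := if ~~ a && b then n%:Z else 0.
Lemma Cnk_dif_deg a b : Cnk_dif a b != 0 -> Cnk_deg b = Cnk_deg a + 1.
Proof. by case: a b => -[] // _; rewrite /Cnk_deg subrK. Qed.
Lemma Cnk_difK a c : \sum_b Cnk_dif a b * Cnk_dif b c = 0.
Proof.
by apply: big1 => b _; case: a b c => -[] [] //=; rewrite ?mul0r ?mulr0.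
Qed.
Definition Cnk : zcomplex := ZComplex Cnk_dif_deg Cnk_difK.
End Cnk.

(* The tensor power of a complex: a basis element f stands for
   f 0 (x) ... (x) f (p - 1). *)
Section TensorPower.
Variables (p : nat) (C : zcomplex).
Local Notation T := {ffun 'I_p -> zbas C}.

Definition tdeg (f : T) : int := \sum_i zdeg (f i).

Definition degsign (x : zbas C) : int := (-1) ^+ `|zdeg x|%N.

Definition upd (f : T) (i : 'I_p) (b : zbas C) : T :=
  [ffun l => if l == i then b else f l].

(* the sign of moving the differential past the first i factors *)
Definition tsign (f : T) (i : 'I_p) : int := \prod_(l : 'I_p | (l < i)%N) degsign (f l).

Definition tdif (f g : T) : int :=
  \sum_i \sum_b tsign f i * zdif (f i) b * (g == upd f i b)%:R.

(* the factor in position i is moved to position s i *)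
Definition tact_bas (s : 'S_p) (f : T) : T := [ffun i => f (s^-1%g i)].

(* the Koszul sign: one factor (-1)^(deg c deg c') for each pair of factors whose
   order is reversed by s *)
Definition koszul (s : 'S_p) (f : T) : int :=
  \prod_(ab : 'I_p * 'I_p | (ab.1 < ab.2)%N && (s ab.2 < s ab.1)%N)
    (-1) ^+ (`|zdeg (f ab.1)| * `|zdeg (f ab.2)|)%N.

Definition tact (s : 'S_p) (f g : T) : int :=
  koszul s f * (g == tact_bas s f)%:R.

Lemma sum_tdif f (F : T -> int) :
  \sum_g tdif f g * F g =
  \sum_i \sum_b tsign f i * zdif (f i) b * F (upd f i b).
Proof.
under eq_bigr do rewrite mulr_suml.
rewrite exchange_big; apply: eq_bigr => i _.
under eq_bigr do rewrite mulr_suml.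
rewrite exchange_big; apply: eq_bigr => b _.
rewrite (bigD1 (upd f i b)) //= eqxx mulr1 big1 ?addr0 // => g /negPf ->.
by rewrite mulr0 mul0r.
Qed.

Lemma sum_tact s f (F : T -> int) :
  \sum_g tact s f g * F g = koszul s f * F (tact_bas s f).
Proof.
rewrite (bigD1 (tact_bas s f)) //= /tact eqxx mulr1 big1 ?addr0 // => g /negPf ->.
by rewrite mulr0 mul0r.
Qed.

Lemma upd_same f i b : upd f i b i = b.
Proof. by rewrite ffunE eqxx. Qed.
Lemma upd_other f i b l : l != i -> upd f i b l = f l.
Proof. by rewrite ffunE => /negPf ->. Qed.

Lemma tdeg_upd f i b : tdeg (upd f i b) = tdeg f - zdeg (f i) + zdeg b.
Proof.
rewrite /tdeg (bigD1 i) //= [in RHS](bigD1 i) //= upd_same [RHS]addrC.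
congr (_ + _); rewrite [zdeg (f i) + _]addrC addrK.
by apply: eq_bigr => l li; rewrite upd_other.
Qed.

Lemma tdif_deg f g : tdif f g != 0 -> tdeg g = tdeg f + 1.
Proof.
move=> nz; apply/eqP; apply: contraNT nz => dg.
rewrite /tdif big1 // => i _; rewrite big1 // => b _.
have [->|] := eqVneq (zdif (f i) b) 0; first by rewrite mulr0 mul0r.
move=> /zdif_deg db; case: eqP => [gE|]; last by rewrite mulr0.
by case/eqP: dg; rewrite gE tdeg_upd db addrA subrK.
Qed.

Lemma degsignK x : degsign x * degsign x = 1.
Proof. by rewrite /degsign -expr2 sqrr_sign. Qed.

Lemma degsign_dif a b : zdif a b != 0 -> degsign b = - degsign a.
Proof.
have sgz_sign (m : int) : (-1) ^+ `|m|%N = (-1) ^ m :> int.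
  by case: m => m //; rewrite NegzE abszN /= -[RHS]exprVn invrN invr1.
by move=> /zdif_deg; rewrite /degsign !sgz_sign => ->; rewrite exprzDr ?unitrN1 // expr1z mulrN1.
Qed.

Lemma tsign_upd_ge (f : T) (i : 'I_p) b (l : 'I_p) : (l <= i)%N -> tsign (upd f i b) l = tsign f l.
Proof.
move=> li; apply: eq_bigr => k kl; rewrite upd_other //.
by rewrite -val_eqE neq_ltn (leq_trans kl li).
Qed.

Lemma tsign_upd_lt (f : T) (i : 'I_p) b (l : 'I_p) : (i < l)%N -> zdif (f i) b != 0 ->
  tsign (upd f i b) l = - tsign f l.
Proof.
move=> il db; rewrite /tsign (bigD1 i) //= [in RHS](bigD1 i) //= upd_same.
rewrite (degsign_dif db) mulNr; congr (- (_ * _)).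
by apply: eq_bigr => k /andP[_ ki]; rewrite upd_other.
Qed.

Lemma updC f i j b c : i != j -> upd (upd f i b) j c = upd (upd f j c) i b.
Proof.
move=> ij; apply/ffunP => l; rewrite !ffunE.
by case: eqP => // ->; case: eqP => // ji; rewrite ji eqxx in ij.
Qed.

Lemma upd_upd f i b c : upd (upd f i b) i c = upd f i c.
Proof. by apply/ffunP => l; rewrite !ffunE; case: eqP. Qed.

Lemma tdifK f h : \sum_g tdif f g * tdif g h = 0.
Proof.
rewrite (sum_tdif f (fun g => tdif g h)).
pose t i j := \sum_b \sum_c tsign f i * zdif (f i) b *
  (tsign (upd f i b) j * zdif (upd f i b j) c * (h == upd (upd f i b) j c)%:R).
have -> : \sum_i \sum_b tsign f i * zdif (f i) b * tdif (upd f i b) h =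
          \sum_i \sum_j t i j.
  apply: eq_bigr => i _; rewrite /t [RHS]exchange_big; apply: eq_bigr => b _.
  rewrite mulr_sumr; apply: eq_bigr => j _.
  by rewrite mulr_sumr.
have tii i : t i i = 0.
  rewrite /t exchange_big big1 // => c _ /=.
  rewrite (eq_bigr (fun b => (zdif (f i) b * zdif b c) *
    (tsign f i * tsign f i * (h == upd f i c)%:R))) => [|b _].
    by rewrite -mulr_suml zdifK mul0r.
  by rewrite upd_same upd_upd tsign_upd_ge //; ring.
have tij (i j : 'I_p) : (i < j)%N -> t i j + t j i = 0.
  move=> ij; have nij : i != j by rewrite -val_eqE neq_ltn ij.
  rewrite /t [X in _ + X]exchange_big /= -big_split big1 // => b _ /=.
  rewrite -big_split big1 // => c _ /=.
  rewrite [upd _ _ _ j]upd_other 1?[j == i]eq_sym // [upd _ _ _ i]upd_other //.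
  rewrite [tsign (upd f j c) i]tsign_upd_ge 1?ltnW // (updC _ _ _ nij).
  have [->|db] := eqVneq (zdif (f i) b) 0.
    by rewrite !(mulr0, mul0r) addr0.
  by rewrite (tsign_upd_lt ij db); ring.
have swap : \sum_i \sum_j t i j = \sum_i \sum_j t j i by rewrite exchange_big.
suff : (\sum_i \sum_j t i j) + (\sum_i \sum_j t i j) = 0.
  by move=> /eqP; rewrite -mulr2n mulrn_eq0 => /eqP.
rewrite [X in _ + X]swap -big_split big1 // => i _ /=.
rewrite -big_split big1 // => j _ /=.
have [ij|ji|/val_inj ->] := ltngtP i j; [exact: tij| |by rewrite tii addr0].
by rewrite addrC tij.
Qed.

Definition tpow : zcomplex := ZComplex tdif_deg tdifK.

Lemma tact_bas_one f : tact_bas 1%g f = f.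
Proof. by apply/ffunP => i; rewrite ffunE invg1 perm1. Qed.
Lemma tact_bas_mul s t f : tact_bas (s * t)%g f = tact_bas t (tact_bas s f).
Proof. by apply/ffunP => i; rewrite !ffunE invMg permM. Qed.
Lemma tdeg_tact s f : tdeg (tact_bas s f) = tdeg f.
Proof.
rewrite /tdeg [RHS](reindex_inj (@perm_inj _ s^-1%g)).
by apply: eq_bigr => i _; rewrite ffunE.
Qed.
Lemma tact_deg s f g : tact s f g != 0 -> tdeg g = tdeg f.
Proof.
rewrite /tact; have [->|_] := eqVneq g (tact_bas s f); first by rewrite tdeg_tact.
by rewrite mulr0 eqxx.
Qed.

Local Notation ksg x y := ((-1) ^+ (`|zdeg x| * `|zdeg y|)%N : int).
Local Notation kinv s a b := ((a < b)%N && (s b < s a)%N).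

Lemma koszulE s f :
  koszul s f = \prod_(a : 'I_p) \prod_(b : 'I_p) (if kinv s a b then ksg (f a) (f b) else 1).
Proof. by rewrite /koszul pair_big big_mkcond. Qed.

Lemma koszul_one f : koszul 1%g f = 1.
Proof.
rewrite koszulE big1 // => a _; rewrite big1 // => b _; rewrite !perm1.
by case: ltngtP.
Qed.

Lemma koszul_mul s t f :
  koszul (s * t)%g f = koszul s f * koszul t (tact_bas s f).
Proof.
have -> : koszul t (tact_bas s f) =
    \prod_(a : 'I_p) \prod_(b : 'I_p) (if kinv t (s a) (s b) then ksg (f a) (f b) else 1).
  rewrite koszulE (reindex_inj (@perm_inj _ s)); apply: eq_bigr => a _.
  rewrite (reindex_inj (@perm_inj _ s)); apply: eq_bigr => b _.
  by rewrite !ffunE !permK.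
pose F (a b : 'I_p) := if kinv t (s a) (s b) then ksg (f a) (f b) else 1.
have -> : \prod_(a : 'I_p) \prod_(b : 'I_p) F a b =
    \prod_(a : 'I_p) \prod_(b : 'I_p) (if (a < b)%N then F a b * F b a else 1).
  have -> : \prod_(a : 'I_p) \prod_(b : 'I_p) F a b = (\prod_(a : 'I_p) \prod_(b : 'I_p) (if (a < b)%N then F a b else 1))
      * (\prod_(a : 'I_p) \prod_(b : 'I_p) (if (b < a)%N then F a b else 1)).
    rewrite -big_split; apply: eq_bigr => a _; rewrite -big_split.
    apply: eq_bigr => b _ /=; case: ltngtP => [||/val_inj ->].
    - by rewrite mulr1.
    - by rewrite mul1r.
    by rewrite /F ltnn mulr1.
  rewrite [X in _ * X]exchange_big -big_split; apply: eq_bigr => a _.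
  rewrite -big_split; apply: eq_bigr => b _ /=.
  by case: ifP; rewrite ?mulr1.
rewrite !koszulE -big_split; apply: eq_bigr => a _.
rewrite -big_split; apply: eq_bigr => b _; rewrite /F /= !permM.
rewrite [(`|zdeg (f b)| * _)%N]mulnC.
case: (ltnP a b) => ab; rewrite ?mulr1 //=.
have k1 : ksg (f a) (f b) * ksg (f a) (f b) = 1 by rewrite -expr2 sqrr_sign.
case: (ltngtP (s a) (s b)) => [||/val_inj/perm_inj abE]; [| |by rewrite abE ltnn in ab];
  move=> _ /=; case: (ltngtP (t (s a)) (t (s b))) => [||/val_inj/perm_inj/perm_inj abE];
  try (by rewrite abE ltnn in ab); by rewrite ?mulr1 ?mul1r ?k1.
Qed.

Lemma ksgC (x y : zbas C) : ksg x y = ksg y x.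
Proof. by rewrite mulnC. Qed.

Lemma ksg_dif (a b c : zbas C) : zdif a b != 0 -> ksg b c = ksg a c * degsign c.
Proof.
move=> /degsign_dif; rewrite /degsign => ab; rewrite !exprM ab.
by rewrite -[X in X ^+ _ = _]mulN1r [LHS]exprMn mulrC.
Qed.

Lemma koszul_upd (s : 'S_p) (f : T) (i : 'I_p) b : zdif (f i) b != 0 ->
  tsign f i * koszul s (upd f i b) =
  koszul s f * tsign (tact_bas s f) (s i).
Proof.
move=> db.
pose G (l : 'I_p) := degsign (f l).
have -> : tsign (tact_bas s f) (s i) =
    \prod_(l : 'I_p) (if (s l < s i)%N then G l else 1).
  rewrite /tsign (reindex_inj (@perm_inj _ s)) [LHS]big_mkcond.
  by apply: eq_bigr => l _; rewrite ffunE permK.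
have -> : koszul s (upd f i b) = koszul s f *
    ((\prod_(l : 'I_p) (if kinv s i l then G l else 1)) *
     (\prod_(l : 'I_p) (if kinv s l i then G l else 1))).
  have -> : \prod_(l : 'I_p) (if kinv s i l then G l else 1) =
     \prod_(a : 'I_p) \prod_(l : 'I_p) (if (a == i) && kinv s a l then G l else 1).
    rewrite [RHS](bigD1 i) //= [X in _ = _ * X]big1 ?mulr1 ?eqxx //.
    by move=> a /negPf ->; rewrite big1.
  have -> : \prod_(l : 'I_p) (if kinv s l i then G l else 1) =
     \prod_(l : 'I_p) \prod_(a : 'I_p) (if (a == i) && kinv s l a then G l else 1).
    apply: eq_bigr => l _; rewrite [RHS](bigD1 i) //= eqxx.
    by rewrite [X in _ = _ * X]big1 ?mulr1 // => a /negPf ->.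
  rewrite !koszulE -!big_split; apply: eq_bigr => x _.
  rewrite -!big_split; apply: eq_bigr => y _ /=.
  case: (ltnP x y) => xy; rewrite ?andbF /= ?mulr1 //.
  case: (s y < s x)%N; rewrite ?andbF /= ?mulr1 // !andbT.
  have [xi|nxi] := eqVneq x i.
    subst x; have nyi : y != i by rewrite -val_eqE neq_ltn xy orbT.
    by rewrite upd_same upd_other // (negPf nyi) mulr1 (ksg_dif _ db).
  have [yi|nyi] := eqVneq y i.
    subst y; rewrite upd_same upd_other // mul1r.
    by rewrite ksgC (ksg_dif _ db) ksgC.
  by rewrite !upd_other // !mulr1.
rewrite mulrCA; congr (_ * _); rewrite /tsign big_mkcond -!big_split.
apply: eq_bigr => l _ /=; rewrite -/(G l).
have GG : G l * G l = 1 by exact: degsignK.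
case: (ltngtP l i) => [li|il|/val_inj ->] /=; last by rewrite !mulr1 ltnn.
  have : val (s l) != val (s i).
    by apply/eqP => /val_inj /perm_inj lE; rewrite lE ltnn in li.
  by case: ltngtP => //= _ _; rewrite ?mul1r ?mulr1 ?GG.
by rewrite mul1r mulr1.
Qed.

Lemma tact_bas_upd s f i b :
  tact_bas s (upd f i b) = upd (tact_bas s f) (s i) b.
Proof.
apply/ffunP => l; rewrite !ffunE; congr (if _ then _ else _).
by rewrite -(inj_eq (@perm_inj _ s)) permKV.
Qed.

Lemma tdif_tact s f h :
  \sum_g tdif f g * tact s g h = \sum_g tact s f g * tdif g h.
Proof.
rewrite (sum_tdif f (fun g => tact s g h)) (sum_tact s f (fun g => tdif g h)).
rewrite /tdif mulr_sumr [RHS](reindex_inj (@perm_inj _ s)).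
apply: eq_bigr => i _; rewrite mulr_sumr; apply: eq_bigr => b _.
rewrite /tact tact_bas_upd [tact_bas s f (s i)]ffunE permK.
have [->|db] := eqVneq (zdif (f i) b) 0; first by rewrite !(mulr0, mul0r).
have := koszul_upd s db; set k := koszul s _; set k' := koszul s _ => e.
rewrite mulrA [_ * k]mulrAC e; ring.
Qed.

Lemma tact_mul s t f h :
  \sum_g tact s f g * tact t g h = tact (s * t)%g f h.
Proof.
rewrite (sum_tact s f (fun g => tact t g h)) /tact koszul_mul tact_bas_mul.
by rewrite mulrA.
Qed.

Lemma tact_one f h : tact 1%g f h = (h == f)%:R.
Proof. by rewrite /tact koszul_one tact_bas_one mul1r. Qed.
End TensorPower.

Section BaseChange.
Variables (R : comNzRingType) (C : zcomplex).

(* C^j (x) R, by coordinates in the basis of C^j *)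
Definition base_change (j : int) : lmodType R :=
  {ffun {b : zbas C | zdeg b == j} -> R^o}.

(* the linear map given on basis elements by b |-> sum_c A b c c *)
Definition bmap_fun (A : zbas C -> zbas C -> int) j k (x : base_change j) :
    base_change k :=
  [ffun c => \sum_b (A (val b) (val c))%:~R * x b].
Lemma bmap_linear A j k : linear (@bmap_fun A j k).
Proof.
move=> a x y; apply/ffunP => c; rewrite !ffunE [X in _ = X + _]mulr_sumr -big_split.
by apply: eq_bigr => b _; rewrite !ffunE mulrDr mulrCA.
Qed.
HB.instance Definition _ A j k :=
  GRing.isLinear.Build R (base_change j) (base_change k) *:%R
    (@bmap_fun A j k) (@bmap_linear A j k).
Definition bmap A j k : {linear base_change j -> base_change k} := @bmap_fun A j k.

Lemma bmap_comp A B j k l (x : base_change j) :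
  (forall b c, zdeg b = j -> A b c != 0 -> zdeg c = k) ->
  bmap B k l (bmap A j k x) =
  bmap (fun b d => \sum_c A b c * B c d) j l x.
Proof.
move=> Adeg; apply/ffunP => d; rewrite !ffunE.
under eq_bigr do rewrite ffunE mulr_sumr.
rewrite exchange_big; apply: eq_bigr => b _ /=.
rewrite rmorph_sum mulr_suml /=.
rewrite [RHS](bigID (fun c => zdeg c == k)) /= [X in _ = _ + X]big1 ?addr0; last first.
  move=> c ck; have [->|Abc] := eqVneq (A (val b) c) 0.
    by rewrite mul0r mul0r.
  by rewrite (Adeg (val b) c (eqP (valP b)) Abc) eqxx in ck.
rewrite [RHS](reindex_omap (val : {c : zbas C | zdeg c == k} -> zbas C) insub) /=.
  apply: eq_big => [c|c _]; first by rewrite valK eqxx andbT (valP c).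
  by rewrite rmorphM /= mulrA [X in X * _]mulrC.
by move=> c ck; rewrite insubT.
Qed.
End BaseChange.

(* The tensor power (C^* )^{(x) p} (x) R with the permutation action of 'S_p. *)
Section TensorPowerComplex.
Variables (R : comNzRingType) (p : nat) (C : zcomplex).
Local Notation D := (base_change R (tpow p C)).
Local Notation act s j := (bmap R (C := tpow p C) (@tact p C s) j j).

Lemma act_deg (s : 'S_p) j (b c : zbas (tpow p C)) :
  zdeg b = j -> tact s b c != 0 -> zdeg c = j.
Proof. by move=> <-; exact: tact_deg. Qed.

Lemma act_one j (x : D j) : act 1%g j x = x.
Proof.
apply/ffunP => c; rewrite ffunE (bigD1 c) //= tact_one eqxx mul1r.
rewrite big1 ?addr0 // => b bc; rewrite tact_one.
by rewrite (inj_eq val_inj) eq_sym (negPf bc) mul0r.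
Qed.

Lemma act_mul (s t : 'S_p) j (x : D j) : act (s * t)%g j x = act t j (act s j x).
Proof.
rewrite bmap_comp; last exact: act_deg.
apply/ffunP => c; rewrite !ffunE; apply: eq_bigr => b _.
by rewrite -tact_mul.
Qed.

Definition tpow_gmod (j : int) : gmod R 'S_p :=
  @GMod R 'S_p (D j) (fun s => act s j) (@act_one j) (fun s t => @act_mul s t j).

Lemma tpow_d_subproof (j : int) :
  ghom_sub (tpow_gmod (j - 1)) (tpow_gmod j)
    (bmap R (C := tpow p C) (@tdif p C) (j - 1) j).
Proof.
split=> [|s x]; first exact: linearP.
rewrite /= bmap_comp; last exact: act_deg.
rewrite bmap_comp; last first.
  by move=> b c /= bj /tdif_deg; rewrite /= bj subrK.
apply/ffunP => c; rewrite !ffunE; apply: eq_bigr => b _.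
by rewrite -tdif_tact.
Qed.

Lemma tpow_dd_subproof (j : int) x :
  ghom_fun (insm (tpow_d_subproof j)) (ghom_fun (insm (tpow_d_subproof (j - 1))) x) = 0.
Proof.
rewrite /ghom_fun /smval /= bmap_comp; last first.
  by move=> b c /= bj /tdif_deg; rewrite /= bj subrK.
apply/ffunP => c; rewrite !ffunE big1 // => b _.
by rewrite (tdifK (val b) (val c)) mul0r.
Qed.

Definition tpow_gcochain : gcochain R 'S_p :=
  @GCochain R 'S_p tpow_gmod (fun j => insm (tpow_d_subproof j)) tpow_dd_subproof.
End TensorPowerComplex.

(* Z_(p), for p prime: the rationals whose reduced denominator is prime to p *)
Section Localization.
Variable p : nat.

Definition Zlocp : {pred rat} := fun x => coprime p `|denq x|%N.

Lemma Zlocp_quot (a b : int) : b != 0 -> coprime p `|b| -> a%:Q / b%:Q \in Zlocp.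
Proof.
move=> b0 pb; rewrite unfold_in /Zlocp; apply: coprime_dvdr pb.
have [k kE] : exists k : int, b = k * denq (a%:Q / b%:Q).
  have : a * denq (a%:Q / b%:Q) = numq (a%:Q / b%:Q) * b.
    apply: (@intr_inj rat); rewrite !intrM numqE.
    by rewrite mulrAC divfK ?intr_eq0.
  move=> e; have : (denq (a%:Q / b%:Q) %| numq (a%:Q / b%:Q) * b)%Z.
    by rewrite -e dvdz_mull.
  rewrite Gauss_dvdzr; last by rewrite coprimezE coprime_sym coprime_num_den.
  by case/dvdzP => k kE; exists k.
by apply/dvdnP; exists `|k|%N; rewrite -abszM -kE.
Qed.

Lemma Zlocp_closed : subring_closed Zlocp.
Proof.
have den0 (x : rat) : (denq x)%:Q != 0 by rewrite intr_eq0 denq_neq0.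
have E (x : rat) : x = (numq x)%:Q / (denq x)%:Q by rewrite divq_num_den.
split=> [|x y|x y]; first by rewrite unfold_in /Zlocp coprimen1.
  rewrite !unfold_in => px py.
  have -> : x - y = (numq x * denq y - numq y * denq x)%:Q / (denq x * denq y)%:Q.
    by rewrite {1}[x]E {1}[y]E intrM intrB !intrM; field; rewrite !den0.
  by apply: Zlocp_quot; rewrite ?mulf_neq0 ?denq_neq0 // abszM coprimeMr px.
rewrite !unfold_in => px py.
have -> : x * y = (numq x * numq y)%:Q / (denq x * denq y)%:Q.
  by rewrite {1}[x]E {1}[y]E !intrM; field; rewrite !den0.
by apply: Zlocp_quot; rewrite ?mulf_neq0 ?denq_neq0 // abszM coprimeMr px.
Qed.
HB.instance Definition _ := GRing.isSubringClosed.Build rat Zlocp Zlocp_closed.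

Definition Zloc := {x : rat | x \in Zlocp}.
HB.instance Definition _ := [isSub of Zloc for @sval rat (fun x => x \in Zlocp)].
HB.instance Definition _ := [Choice of Zloc by <:].
HB.instance Definition _ := [SubChoice_isSubComNzRing of Zloc by <:].
End Localization.

Section Cyclic.
Variables (R : comNzRingType) (a : R).
Definition principal : submodule R^o.
Proof.
apply: (@Submodule R R^o [set x | exists y, x = y * a]) => /=.
  by exists 0; rewrite mul0r.
move=> b _ _ [y ->] [z ->]; exists (b * y + z).
by rewrite mulrDl -mulrA.
Defined.
Definition cyclic_mod : lmodType R := qmod principal.
End Cyclic.

Definition D' (p n : nat) (k : int) : gcochain (Zloc p) 'S_p :=
  tpow_gcochain (Zloc p) p (Cnk n k).

(* Main.v *)
From HB Require Import structures.
From mathcomp Require Import all_boot all_order all_fingroup all_algebra.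
From mathcomp Require Import boolp classical_sets cardinality fsbigop.
From mathcomp Require Import generic_quotient zify ring.
Require Import Defs.

Set Implicit Arguments.
Unset Strict Implicit.
Unset Printing Implicit Defensive.

Import Order.TTheory GRing.Theory Num.Theory.
Local Open Scope ring_scope.

(** Write p for the prime and P l, for 0 <= l <= p, for the term of the complex
    D'(n,k) spanned by the tensors with exactly l factors in the upper degree k.
    These modules do not depend on n, and the differential is n times the
    differential delta of D'(1,k).  Three facts about them carry the proof.

    - The rows (P l, delta) are exact, because contracting the first tensor factor
      is a homotopy (row_dif_exact).  Applying Hom into them from free modules keeps
      them exact (hom_h_exact).
    - For 0 < l < p the stabilizer of a basis tensor is a product of two smaller
      symmetric groups, of order prime to p.  Averaging the projection to one basis
      tensor shows that P l has no cohomology in positive degrees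
      (relatively_projective, averaged_exact).
    - P 0 and P p are lines, one with the trivial action and one with the sign: for
      k = 0 the sign is at the bottom and the trivial action at the top, for k = 1
      it is the other way round.

    Dimension shifting along the exact row therefore gives
    H^(i+p-1)(P 0) = H^i(P p) for i > 0 (coh_top_bottom), while the degrees up to
    p - 1 are read off from invariants (coh_bottom_edge).  Using k = 0 and k = 1
    alternately computes the cohomology of the symmetric group with trivial and with
    sign coefficients in all degrees (column_orders): it is zero or cyclic of order p.

    On the page E_1 only the invariants, in row i = 0, carry a nonzero d_1.  It is n
    times the action of delta on orbit sums, hence multiplication by pn for k = 0 and
    by n for k = 1; the rest of E_2 is the cohomology just computed.

    For degree reasons only d_p, from column 0 to column p, could still be nonzero.
    A class in column 0 is followed through the columns by a zigzag (zigzag).  Each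
    step applies n delta, so the obstruction in column p is n^p times the one for
    n = 1.  As p divides n, one of the factors n is a multiple of p, and p kills the
    obstruction, modulo n delta of an invariant in degree 0 (lifts_bottom).  So every
    element of E_2 is represented by a cocycle, which is the collapse.  Finally, by
    parity at most one term of E_2 is nonzero in each total degree, so nothing can be
    extended (one_term_extension). *)

(** * Linear and equivariant maps out of free modules *)

Section LinearMaps.
Variable R : comNzRingType.

Definition linmap (U V : lmodType R) (f : U -> V) (lf : linear f) : {linear U -> V} :=
  HB.pack f (GRing.isLinear.Build R U V *:%R f lf).

Lemma finite_enum (K : choiceType) (A : set K) :
  finite_set A -> exists2 r : seq K, uniq r & forall k, A k -> k \in r.
Proof.
move=> /finite_seqP [r ->]; exists (undup r); first exact: undup_uniq.
by move=> k /=; rewrite mem_undup.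
Qed.

Section FiniteCombinations.
Variables (K : choiceType) (M : lmodType R) (phi : K -> M).

Definition lcomb (c : K -> R) : M := \sum_(k \in [set: K]) c k *: phi k.

Lemma lcombE (r : seq K) c : uniq r -> (forall k, c k <> 0 -> k \in r) ->
  lcomb c = \sum_(k <- r) c k *: phi k.
Proof.
move=> ur cr; rewrite /lcomb (fsbigE r _ ur) => [|//|k _ /negP kr].
  by apply: eq_bigl => k; rewrite in_setT.
by have [->|/cr] := pselect (c k = 0); rewrite ?scale0r.
Qed.

Lemma lcomb_linear a c c' :
  finite_set [set k | c k <> 0]%classic -> finite_set [set k | c' k <> 0]%classic ->
  finite_set [set k | a * c k + c' k <> 0]%classic /\
  lcomb (fun k => a * c k + c' k) = a *: lcomb c + lcomb c'.
Proof.
move=> fc fc'.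
have fU : finite_set ([set k | c k <> 0] `|` [set k | c' k <> 0])%classic.
  by rewrite finite_setU.
split.
  apply: sub_finite_set fU => k /= nz.
  have [c0|] := pselect (c k = 0); last by left.
  by right=> c'0; apply: nz; rewrite c0 c'0 mulr0 addr0.
have [r ur mem] := finite_enum fU.
rewrite !(@lcombE r) // => [|k nz|k nz|k nz].
- rewrite scaler_sumr -big_split /=; apply: eq_bigr => k _.
  by rewrite scalerDl scalerA.
- by apply: mem; right.
- by apply: mem; left.
apply: mem; have [c0|] := pselect (c k = 0); last by left.
by right=> c'0; apply: nz; rewrite c0 c'0 mulr0 addr0.
Qed.
End FiniteCombinations.

Lemma linear_lcomb (K : choiceType) (M N : lmodType R) (u : {linear M -> N})
    (phi : K -> M) c : finite_set [set k | c k <> 0]%classic ->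
  u (lcomb phi c) = lcomb (u \o phi) c.
Proof.
move=> /finite_enum [r ur mem]; rewrite !(lcombE _ ur mem) linear_sum; apply: eq_bigr => k _.
by rewrite linearZ.
Qed.
End LinearMaps.

Section FreeModules.
Variables (R : comNzRingType) (gT : finGroupType) (V : gmod R gT).

(** The translates of the basis elements form a basis over R, so linear maps out of V
    are determined by arbitrary values on them. *)
Lemma gfree_basis : gfree V -> exists (X : choiceType) (b : X -> V),
  (forall (M : lmodType R) (phi : gT * X -> M), exists u : {linear V -> M},
     forall g x, u (gact V g (b x)) = phi (g, x)) /\
  (forall (M : lmodType R) (u u' : {linear V -> M}),
     (forall g x, u (gact V g (b x)) = u' (gact V g (b x))) -> u =1 u').
Proof.
move=> [X [b fb]]; exists X, b.
pose e (k : gT * X) := gact V k.1 (b k.2).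
have /choice [co coP] : forall v, exists c : gT * X -> R,
    (finite_set [set k | c k <> 0]%classic /\ v = lcomb e c) /\
    forall c', finite_set [set k | c' k <> 0]%classic /\ v = lcomb e c' -> c = c'.
  by move=> v; have [c [? ?]] := fb v; exists c.
have coL a v w : co (a *: v + w) = (fun k => a * co v k + co w k).
  have [[fv ev] _] := coP v; have [[fw ew] _] := coP w.
  apply: (coP _).2; have [fin ->] := lcomb_linear e a fv fw.
  by rewrite -ev -ew.
split=> [M phi|M u u' uu' v].
  have uL : linear (fun v => lcomb phi (co v)).
    move=> a v w; rewrite coL; apply: (lcomb_linear _ _ _ _).2.
      exact: (coP v).1.1.
    exact: (coP w).1.1.
  exists (linmap uL) => g x; rewrite /=.
  have -> : co (gact V g (b x)) = (fun k => (k == (g, x))%:R).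
    apply: (coP _).2; split.
      apply: (@sub_finite_set _ _ [set (g, x)]%classic) => // k /=.
      by case: eqP.
    rewrite (@lcombE _ _ _ _ [:: (g, x)]) // ?big_seq1 ?eqxx ?scale1r // => k.
    by rewrite inE; case: eqP.
  rewrite (@lcombE _ _ _ _ [:: (g, x)]) // ?big_seq1 ?eqxx ?scale1r // => k.
  by rewrite inE; case: eqP.
have [[fv ev] _] := coP v; rewrite ev !linear_lcomb //.
by congr lcomb; apply/funext => -[g x]; exact: uu'.
Qed.

Lemma linear_lift (M N : lmodType R) (q : {linear V -> N}) (g : {linear M -> N}) :
  gfree V -> (forall v, exists m, g m = q v) ->
  exists u : {linear V -> M}, forall v, g (u v) = q v.
Proof.
move=> /gfree_basis [X [b [ext uni]]] /choice [s sP].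
have [u uE] := ext M (fun k => s (gact V k.1 (b k.2))).
exists u => v; rewrite -[LHS]/((g \o u) v); apply: uni => h x /=.
by rewrite uE sP.
Qed.

(** The lifting property of free modules.  The map g is only required to hit the values
    of q, so that the lemma applies to exact sequences as well as to surjections. *)
Lemma ghom_lift (M N : gmod R gT) (q : ghom V N) (g : ghom M N) :
  gfree V -> (forall v, exists m, ghom_fun g m = ghom_fun q v) ->
  exists u : ghom V M, ghom_comp g u = q.
Proof.
move=> /gfree_basis [X [b [ext uni]]] /choice [s sP].
have [u uE] := ext M (fun k => gact M k.1 (s (b k.2))).
have u_ghom : ghom_sub V M u.
  split=> [|h v]; first exact: linearP.
  rewrite -[LHS]/((u \o gact V h) v) -[RHS]/((gact M h \o u) v).
  by apply: uni => k x /=; rewrite -gact_mul !uE -gact_mul.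
exists (insm u_ghom); apply: ghomP => v; rewrite ghom_compE.
rewrite -[LHS]/((ghom_fun g \o u) v); apply: uni => h x /=.
by rewrite uE !ghom_act sP.
Qed.
End FreeModules.

(** * Resolutions: averaging, and cohomology in degree zero *)

Section Resolution.
Variables (R : comNzRingType) (gT : finGroupType) (W : gresolution R gT).

(** Over R alone the resolution is contractible.  All that is used of a contraction is
    that it inverts the differential on its image; the induction step lifts
    1 - s d, whose values are cycles. *)
Lemma resolution_section i : exists s : {linear W i -> W i.+1},
  forall w, ghom_fun (rd W i) (s (ghom_fun (rd W i) w)) = ghom_fun (rd W i) w.
Proof.
elim: i => [|i [s sP]].
  have [w1 w1E] := raug_surj W 1.
  have qL : linear (fun w : W 0 => w - (ghom_fun (raug W) w : R) *: w1).
    move=> a u v; rewrite linearP scalerDl -scalerA scalerBr.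
    by rewrite opprD addrACA.
  have [|u uP] := @linear_lift _ _ _ _ _ (linmap qL) (ghom_fun (rd W 0)) (@rfree _ _ W 0).
    move=> w /=; have [|w' ->] := (rexact0 (w - (ghom_fun (raug W) w : R) *: w1)).1.
      by rewrite linearB linearZ /= w1E /= -[_ *: _]/(_ * 1) mulr1 subrr.
    by exists w'.
  exists u => w; rewrite uP /=.
  have -> : ghom_fun (raug W) (ghom_fun (rd W 0) w) = 0 by apply/rexact0; exists w.
  by rewrite scale0r subr0.
have qL : linear (fun w : W i.+1 => w - s (ghom_fun (rd W i) w)).
  by move=> a u v; rewrite !linearP addrACA -scalerDr.
have [|u uP] := @linear_lift _ _ _ _ _ (linmap qL) (ghom_fun (rd W i.+1)) (@rfree _ _ W i.+1).
  move=> w /=; have [|w' ->] := (rexact (w - s (ghom_fun (rd W i) w))).1.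
    by rewrite linearB /= sP subrr.
  by exists w'.
exists u => w; rewrite uP /=.
have -> : ghom_fun (rd W i) (ghom_fun (rd W i.+1) w) = 0 by apply/rexact; exists w.
by rewrite linear0 subr0.
Qed.

Variable M : gmod R gT.

(** A transfer argument.  If w |-> f (s w) is a primitive of the cocycle f that is linear
    but not equivariant, then averaging its composite with theta over the group
    makes it equivariant and multiplies its coboundary by c. *)
Lemma averaged_exact (theta : {linear M -> M}) (c : R) :
    (forall m, \sum_(g : gT) gact M g (theta (gact M g^-1%g m)) = c *: m) ->
  forall i (f : ghom (W i.+1) M), ghom_pre M (rd W i.+1) f = 0 ->
  exists h : ghom (W i) M, ghom_pre M (rd W i) h = c *: f.
Proof.
move=> avg i f df; have [s sP] := resolution_section i.
have fs w : ghom_fun f (s (ghom_fun (rd W i) w)) = ghom_fun f w.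
  apply/eqP; rewrite -subr_eq0 -linearB.
  have [|w' ->] := (rexact (s (ghom_fun (rd W i) w) - w)).1.
    by rewrite linearB /= sP subrr.
  by rewrite /= -ghom_compE -[ghom_comp _ _]/(ghom_pre M (rd W i.+1) f) df.
pose h (w : W i) : M :=
  \sum_(g : gT) gact M g (theta (ghom_fun f (s (gact (W i) g^-1%g w)))).
have hG : ghom_sub (W i) M h.
  split=> [a u v|k w]; rewrite /h.
    rewrite scaler_sumr -big_split; apply: eq_bigr => g _.
    by rewrite !linearP.
  rewrite linear_sum (reindex_inj (mulIg k)) /=; apply: eq_bigr => g _.
  by rewrite -(gact_mul k) invMg mulKVg [LHS]gact_mul.
exists (insm hG); apply: ghomP => w; rewrite ghom_compE.
rewrite -[LHS]/(h (ghom_fun (rd W i) w)) -[RHS]/(c *: ghom_fun f w) -avg.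
by apply: eq_bigr => g _; rewrite -ghom_act fs ghom_act.
Qed.

(** Cohomology in degree 0 consists of the invariants: a cocycle vanishes on the kernel
    of the augmentation. *)
Lemma ghom_pre_aug0 (f : ghom (W 0) M) : ghom_pre M (rd W 0) f = 0 <->
  exists2 m : M, forall g, gact M g m = m &
    forall w, ghom_fun f w = (ghom_fun (raug W) w : R) *: m.
Proof.
split=> [df|[m mG fE]]; last first.
  apply: ghomP => w; rewrite [LHS]ghom_compE fE.
  have -> : ghom_fun (raug W) (ghom_fun (rd W 0) w) = 0 by apply/rexact0; exists w.
  by rewrite scale0r.
have f0 w : ghom_fun (raug W) w = 0 -> ghom_fun f w = 0.
  move=> /rexact0 [w' ->].
  by rewrite /= -ghom_compE -[ghom_comp _ _]/(ghom_pre M (rd W 0) f) df.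
have [w1 w1E] := raug_surj W 1.
exists (ghom_fun f w1) => [g|w].
  apply/eqP; rewrite -subr_eq0 -ghom_act -linearB; apply/eqP/f0.
  by rewrite linearB /= ghom_act subrr.
apply/eqP; rewrite -subr_eq0 -linearZ -linearB; apply/eqP/f0.
by rewrite linearB linearZ /= w1E -[_ *: _]/(_ * 1) mulr1 subrr.
Qed.

Lemma aug_ghom_subproof (m : M) : (forall g, gact M g m = m) ->
  ghom_sub (W 0) M (fun w => (ghom_fun (raug W) w : R) *: m).
Proof.
move=> mG; split=> [a u v|g u]; first by rewrite linearP scalerDl scalerA.
by rewrite ghom_act linearZ mG.
Qed.
Definition aug_ghom m mG : ghom (W 0) M := insm (@aug_ghom_subproof m mG).
End Resolution.

Section ExactRows.
Variables (R : comNzRingType) (gT : finGroupType) (V L M N : gmod R gT).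
Variables (f : ghom L M) (g : ghom M N).

Lemma ghom_post_exact : gfree V ->
    (forall m, ghom_fun g m = 0 -> exists l, m = ghom_fun f l) ->
  forall q : ghom V M, ghom_post V g q = 0 -> exists u, ghom_post V f u = q.
Proof.
move=> Vfree ex q gq; apply: ghom_lift => // v.
have [|l ->] := ex (ghom_fun q v); last by exists l.
by rewrite /= -ghom_compE -[ghom_comp _ _]/(ghom_post V g q) gq.
Qed.
End ExactRows.

(** * Coordinates on tensor powers and the permutation action *)

Section Coefficients.
Variables (R : comNzRingType) (C : zcomplex).

(** Extending the coordinates by zero to all basis elements avoids the subtype of basis
    elements of a given degree. *)
Definition coef j (x : base_change R C j) (f : zbas C) : R :=
  if insub f is Some b then x b else 0.

Lemma coef_out j (x : base_change R C j) f : zdeg f != j -> coef x f = 0.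
Proof. by move=> fj; rewrite /coef insubN. Qed.

Lemma coefE j (x : base_change R C j) b : coef x (val b) = x b.
Proof. by rewrite /coef valK. Qed.

Lemma coef_inj j (x y : base_change R C j) :
  (forall f, zdeg f = j -> coef x f = coef y f) -> x = y.
Proof. by move=> xy; apply/ffunP => b; rewrite -!coefE xy //; apply/eqP/(valP b). Qed.

Lemma coef0 j f : coef (0 : base_change R C j) f = 0.
Proof. by rewrite /coef; case: insub => [b|]; rewrite ?ffunE. Qed.

Lemma coefP j a (x y : base_change R C j) f : coef (a *: x + y) f = a * coef x f + coef y f.
Proof. by rewrite /coef; case: insub => [b|]; rewrite ?ffunE // mulr0 addr0. Qed.

Lemma coefZ j a (x : base_change R C j) f : coef (a *: x) f = a * coef x f.
Proof. by rewrite -[a *: x]addr0 coefP coef0 addr0. Qed.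

Lemma coefD j (x y : base_change R C j) f : coef (x + y) f = coef x f + coef y f.
Proof. by rewrite -[x]scale1r coefP scale1r mul1r. Qed.

Lemma coef_sum (I : finType) j (x : I -> base_change R C j) f :
  coef (\sum_i x i) f = \sum_i coef (x i) f.
Proof.
apply: (big_morph (fun x : base_change R C j => coef x f)) => [u v|].
  exact: coefD.
exact: coef0.
Qed.

Definition of_coef j (phi : zbas C -> R) : base_change R C j :=
  [ffun b => phi (val b)].

Lemma of_coefK j phi f : zdeg f = j -> coef (of_coef j phi) f = phi f.
Proof.
by move=> /eqP fj; rewrite /coef (insubT (fun f => zdeg f == j) fj) ffunE.
Qed.

Lemma coef_bmap A j k (x : base_change R C j) c : zdeg c = k ->
  coef (bmap R A j k x) c = \sum_f (A f c)%:~R * coef x f.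
Proof.
move=> /eqP ck; rewrite /coef (insubT (fun f => zdeg f == k) ck) ffunE /=.
rewrite [RHS](bigID (fun f => zdeg f == j)) /= [X in _ + X]big1 ?addr0; last first.
  by move=> f fj; rewrite insubN // mulr0.
rewrite [RHS](reindex_omap (val : {f : zbas C | zdeg f == j} -> zbas C) insub) /=.
  apply: eq_big => [b|b _]; first by rewrite valK eqxx andbT (valP b).
  by rewrite valK.
by move=> f fj; rewrite (insubT (fun f => zdeg f == j) fj).
Qed.

Lemma bmap_delta j (x : base_change R C j) : bmap R (fun a b => (b == a)%:R) j j x = x.
Proof.
apply: coef_inj => f fj; rewrite coef_bmap // (bigD1 f) //= eqxx mul1r.
by rewrite big1 ?addr0 // => g gf; rewrite eq_sym (negPf gf) mul0r.
Qed.
End Coefficients.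

Section PermutationAction.
Variables (R : comNzRingType) (p : nat) (C : zcomplex).
Local Notation T := {ffun 'I_p -> zbas C}.
Local Notation M := (tpow_gmod R p C).

Lemma coef_gact s j (x : M j) (f : T) :
  coef (C := tpow p C) (gact (M j) s x) (tact_bas s f) = (koszul s f)%:~R * coef x f.
Proof.
have [fj|fj] := eqVneq (tdeg f) j; last first.
  by rewrite !coef_out ?mulr0 //= tdeg_tact.
rewrite coef_bmap /= ?tdeg_tact // (bigD1 f) //= /tact eqxx mulr1.
rewrite big1 ?addr0 // => g gf; suff -> : tact_bas s f == tact_bas s g = false.
  by rewrite mulr0 mul0r.
apply/negP => /eqP /(congr1 (tact_bas s^-1%g)).
by rewrite -!tact_bas_mul mulgV !tact_bas_one => fg; rewrite fg eqxx in gf.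
Qed.

Lemma coef_fixed j (x : M j) : (forall s, gact (M j) s x = x) ->
  forall s f, coef (C := tpow p C) x (tact_bas s f) = (koszul s f)%:~R * coef x f.
Proof. by move=> xG s f; rewrite -coef_gact xG. Qed.

Section Projection.
Variables (f0 : T) (j : int) (u : R).
Definition basis_proj (x : M j) : M j :=
  of_coef (C := tpow p C) j (fun f => u * (f == f0)%:R * coef x f).
Lemma basis_proj_linear : linear basis_proj.
Proof.
move=> a x y; apply: coef_inj => f fj; rewrite coefP !of_coefK // coefP.
by rewrite mulrDr mulrCA.
Qed.

Lemma coef_basis_proj x f : tdeg f = j ->
  coef (C := tpow p C) (linmap basis_proj_linear x) f = u * (f == f0)%:R * coef x f.
Proof. exact: (@of_coefK _ (tpow p C) j (fun f => u * (f == f0)%:R * coef x f)). Qed.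

(** The conjugate of the projection to f0 by s is the projection to its translate: the two
    Koszul signs cancel.  So the sum counts the permutations that carry f to f0. *)
Lemma basis_proj_average (x : M j) :
  (forall f : T, tdeg f = j -> u * #|[set s : 'S_p | tact_bas s f == f0]|%:R = 1) ->
  \sum_(s : 'S_p) gact (M j) s (linmap basis_proj_linear (gact (M j) s^-1%g x)) = 1 *: x.
Proof.
move=> uN; apply: coef_inj => f fj; rewrite coef_sum scale1r.
rewrite -[RHS]mul1r -(uN f fj) -mulrA -sum1_card natr_sum mulr_suml mulr_sumr.
rewrite (reindex_inj invg_inj) [RHS]big_mkcond; apply: eq_bigr => s _; cbv beta.
have {1}-> : f = tact_bas s^-1%g (tact_bas s f).
  by rewrite -tact_bas_mul mulgV tact_bas_one.
rewrite coef_gact invgK coef_basis_proj ?tdeg_tact // coef_gact inE.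
case: eqP => [_|]; last by rewrite mulr0 mul0r mulr0.
rewrite mulr1 mul1r mulrCA; congr (_ * _); rewrite mulrA -intrM [X in X%:~R * _]mulrC.
by rewrite -koszul_mul mulgV koszul_one mul1r.
Qed.
End Projection.
End PermutationAction.

(** * Boolean tensors and the contraction of the rows *)

Section BooleanTensors.
Variables (p : nat) (k : int).
Local Notation T := {ffun 'I_p -> bool}.

Definition ntrue (f : T) : nat := #|[set i | f i]|.
(** The degree of the tensor all of whose p factors have degree k - 1. *)
Definition base : int := (k - 1) * p%:Z.

Lemma tdeg_ntrue n (f : T) : @tdeg p (Cnk n k) f = base + (ntrue f)%:Z.
Proof.
rewrite /tdeg /ntrue /base -sum1_card /=.
rewrite (eq_bigr (fun i => (k - 1) + (f i)%:R)) => [|i _]; last first.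
  by rewrite /= /Cnk_deg; case: (f i) => /=; lia.
rewrite big_split sumr_const card_ord -mulr_natr natz; congr (_ + _).
rewrite -natr_sum natz [in RHS]big_mkcond; congr Posz; apply: eq_bigr => i _.
by rewrite inE; case: (f i).
Qed.

Lemma tdif_Cnk n f g : @tdif p (Cnk n k) f g = n%:Z * @tdif p (Cnk 1 k) f g.
Proof.
rewrite /tdif mulr_sumr; apply: eq_bigr => i _; rewrite mulr_sumr.
apply: eq_bigr => b _ /=; rewrite -[tsign (C := Cnk n k) f i]/(tsign (C := Cnk 1 k) f i).
rewrite /Cnk_dif; case: ifP => _; last by rewrite !(mulr0, mul0r).
by rewrite mulr1 mulrA [n%:Z * _]mulrC.
Qed.

Local Notation C := (Cnk 1 k).
Local Notation sg := (@tsign p C).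

Lemma tdif_boolE f g :
  @tdif p C f g = \sum_i sg f i * (~~ f i)%:R * (g == @upd p C f i true)%:R.
Proof.
apply: eq_bigr => i _; rewrite big_bool /= /Cnk_dif andbF mulr0 mul0r addr0 andbT.
by case: (f i).
Qed.

Variable i0 : 'I_p.
Hypothesis i00 : val i0 = 0%N.

Definition contr (f g : T) : int := (f i0)%:R * (g == @upd p C f i0 false)%:R.

Lemma sum_contr f (F : T -> int) :
  \sum_g contr f g * F g = (f i0)%:R * F (@upd p C f i0 false).
Proof.
rewrite (bigD1 (@upd p C f i0 false)) //= /contr eqxx mulr1 big1 ?addr0 // => g /negPf ->.
by rewrite mulr0 mul0r.
Qed.

(** The differential of the first factor carries no sign and is inverted by the
    contraction; on the other factors the contraction anticommutes with the
    differential, as it changes the parity of the first factor. *)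
Lemma contr_homotopy f h :
  \sum_g @tdif p C f g * contr g h + \sum_g contr f g * @tdif p C g h = (h == f)%:R.
Proof.
have -> : \sum_g @tdif p C f g * contr g h = \sum_i sg f i * (~~ f i)%:R *
    contr (@upd p C f i true) h.
  rewrite (sum_tdif (C := C)); apply: eq_bigr => i _.
  rewrite big_bool /= /Cnk_dif andbF mulr0 mul0r addr0 andbT.
  by case: (f i).
rewrite sum_contr tdif_boolE /contr; have [fi0|fi0] := boolP (f i0); last first.
  rewrite mul0r addr0 (bigD1 i0) // (negPf fi0) (@upd_same p C) (@upd_upd p C).
  have -> : sg f i0 = 1 by rewrite /tsign big1 // => l; rewrite i00.
  have -> : @upd p C f i0 false = f.
    by apply/ffunP => l; rewrite ffunE; case: eqP => // ->; case: (f i0) fi0.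
  rewrite !mul1r /= big1 ?addr0 // => i ii0.
  by rewrite (@upd_other p C) 1?eq_sym // (negPf fi0) mul0r mulr0.
rewrite mul1r (bigD1 i0) //= fi0 !(mulr0, mul0r) add0r.
rewrite [X in _ + X](bigD1 i0) //= (@upd_same p C) (@upd_upd p C).
have -> : sg (@upd p C f i0 false) i0 = 1 by rewrite /tsign big1 // => l; rewrite i00.
have fE : @upd p C f i0 true = f.
  by apply/ffunP => l; rewrite ffunE; case: eqP => // ->.
rewrite fE !mul1r addrCA -big_split big1 ?addr0 // => i ii0 /=.
have lt0i : (i0 < i)%N by rewrite i00 lt0n -i00 val_eqE.
have -> : sg f i = - sg (@upd p C f i0 false) i.
  rewrite -{1}fE -(@upd_upd p C f i0 false true).
  by apply: (@tsign_upd_lt p C) => //; rewrite (@upd_same p C).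
have i0i : i0 != i by rewrite eq_sym.
rewrite (@upd_other p C f i) // (@upd_other p C f i0) // fi0 mul1r.
rewrite (@updC p C _ _ _ _ _ ii0) !mulNr.
exact: addNr.
Qed.
End BooleanTensors.

Section Rows.
Variables (R : comNzRingType) (p n : nat) (k : int).
Local Notation C := (Cnk n k).
Local Notation C1 := (Cnk 1 k).
Local Notation T := {ffun 'I_p -> bool}.

(** The column with l factors in the upper degree.  Indexing by l in nat gives the
    differential definitional source and target. *)
Definition tcol (l : nat) : gmod R 'S_p := tpow_gmod R p C (base p k + l%:Z).

Lemma row_dif_deg l (b c : T) : @tdeg p C b = base p k + l%:Z ->
  @tdif p C1 b c != 0 -> @tdeg p C c = base p k + l.+1%:Z.
Proof.
move=> bl /tdif_deg; rewrite -[X in X = _]/(@tdeg p C c) => ->.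
by rewrite -[X in X + _]/(@tdeg p C b) bl; lia.
Qed.

Lemma row_dif_subproof l : ghom_sub (tcol l) (tcol l.+1)
  (bmap R (C := tpow p C) (@tdif p C1) (base p k + l%:Z) (base p k + l.+1%:Z)).
Proof.
split=> [|s x]; first exact: linearP.
rewrite /= bmap_comp; last exact: act_deg.
rewrite bmap_comp; last exact: row_dif_deg.
apply/ffunP => c; rewrite !ffunE; apply: eq_bigr => b _; congr (_%:~R * _).
exact: (esym (@tdif_tact p C1 s (val b) (val c))).
Qed.
(** The differential of D'(n,k) is n times this map, which is the differential for
    n = 1 on the same modules. *)
Definition row_dif l : ghom (tcol l) (tcol l.+1) := insm (row_dif_subproof l).

Lemma tcol_coef_inj l (x y : tcol l) :
  (forall f : T, ntrue f = l -> coef (C := tpow p C) x f = coef (C := tpow p C) y f) -> x = y.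
Proof.
move=> xy; apply: coef_inj => f /=; rewrite tdeg_ntrue => fl; apply: xy; lia.
Qed.

Lemma row_dif_coef l (x : tcol l) (f : T) : ntrue f = l.+1 ->
  coef (C := tpow p C) (ghom_fun (row_dif l) x) f =
  \sum_(g : T) (@tdif p C1 g f)%:~R * coef (C := tpow p C) x g.
Proof.
move=> fl; rewrite -[LHS]/(coef (C := tpow p C) (bmap R _ _ (base p k + l.+1%:Z) x) f).
by apply: coef_bmap; rewrite /= tdeg_ntrue fl.
Qed.

Lemma row_difK l (x : tcol l) :
  ghom_fun (row_dif l.+1) (ghom_fun (row_dif l) x) = 0.
Proof.
rewrite /ghom_fun /smval /= bmap_comp; last first.
  exact: row_dif_deg.
apply/ffunP => c; rewrite !ffunE big1 // => b _.
by rewrite (@tdifK p C1 (val b) (val c)) mul0r.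
Qed.

Hypothesis p_gt0 : (0 < p)%N.

Lemma contr_deg l (b c : T) :
  @tdeg p C b = base p k + l.+1%:Z -> contr k (Ordinal p_gt0) b c != 0 ->
  @tdeg p C c = base p k + l%:Z.
Proof.
rewrite /contr => bl; have [->|] := eqVneq c (@upd p C b (Ordinal p_gt0) false);
  last by rewrite mulr0 eqxx.
case b0: (b _); last by rewrite mul0r eqxx.
by move=> _; rewrite tdeg_upd bl b0 /= /Cnk_deg; lia.
Qed.

Local Notation h l := (bmap R (C := tpow p C) (contr k (Ordinal p_gt0))
  (base p k + l.+1%:Z) (base p k + l%:Z)).

Lemma row_dif_inj (x : tcol 0) : ghom_fun (row_dif 0) x = 0 -> x = 0.
Proof.
move=> dx; have : h 0%N (ghom_fun (row_dif 0) x) = x.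
  rewrite bmap_comp; last exact: row_dif_deg.
  rewrite -[RHS]bmap_delta; apply/ffunP => c; rewrite !ffunE; apply: eq_bigr => b _.
  rewrite -[(val c == _)%:R](contr_homotopy (k := k) (i0 := Ordinal p_gt0)) //.
  congr ((_)%:~R * _); rewrite sum_contr.
  have -> : (val b) (Ordinal p_gt0) = false.
    have /eqP /= := valP b; rewrite tdeg_ntrue => /addrI [/eqP].
    by rewrite cards_eq0 => /eqP /setP /(_ (Ordinal p_gt0)); rewrite !inE.
  by rewrite mul0r [RHS]addr0.
by rewrite dx linear0.
Qed.

Lemma row_dif_exact l (x : tcol l.+1) :
  ghom_fun (row_dif l.+1) x = 0 -> exists y, x = ghom_fun (row_dif l) y.
Proof.
move=> dx; exists (h l x).
have : h l.+1 (ghom_fun (row_dif l.+1) x) + ghom_fun (row_dif l) (h l x) = x.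
  rewrite bmap_comp; last exact: row_dif_deg.
  rewrite -[ghom_fun (row_dif l) _]/(bmap R _ _ _ (h l x)) bmap_comp; last exact: contr_deg.
  rewrite -[RHS]bmap_delta; apply/ffunP => c; rewrite !ffunE -big_split; apply: eq_bigr => b _.
  rewrite -[(val c == _)%:R](contr_homotopy (k := k) (i0 := Ordinal p_gt0)) //.
  by rewrite intrD mulrDl.
by rewrite dx linear0 add0r.
Qed.

End Rows.

(** * Permutations acting on boolean tensors *)

Section Permutations.
Variables (p n : nat) (k : int).
Local Notation C := (Cnk n k).
Local Notation T := {ffun 'I_p -> bool}.
Local Notation "s ** f" := (@tact_bas p C s f) (at level 40).

Lemma ntrue_tact s (f : T) : ntrue (s ** f) = ntrue f.
Proof.
have := tdeg_tact (C := C) s f; rewrite !tdeg_ntrue => /addrI e.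
by apply/eqP; rewrite -eqz_nat e.
Qed.

(** Tensors with equally many upper factors list the same booleans in another order. *)
Lemma tact_transitive (f g : T) : ntrue f = ntrue g -> exists s, s ** f = g.
Proof.
move=> fg; have cT (h : T) : count_mem true [tuple h i | i < p] = ntrue h.
  rewrite count_map /ntrue cardE size_filter -enumT; apply: eq_count => i /=.
  by rewrite inE; case: (h i).
have cF (h : T) : count_mem false [tuple h i | i < p] = (p - ntrue h)%N.
  have := count_predC (pred1 true) [tuple h i | i < p].
  rewrite size_tuple cT => cE; rewrite -[X in (X - _)%N]cE addKn.
  by apply: eq_count; case.
have /tuple_permP [s sE] : perm_eq [tuple g i | i < p] [tuple f i | i < p].
  by apply/allP => -[] _ /=; rewrite ?cT ?cF fg eqxx.
exists s^-1%g; apply/ffunP => i; rewrite ffunE invgK.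
have := congr1 (fun t => nth false t i) sE.
rewrite !nth_mktuple /= => ->; by rewrite tnth_mktuple.
Qed.

Definition even_sign f := forall s : 'S_p, @koszul p C s f = 1.

Definition odd_entry (b : bool) := odd `|Cnk_deg k b|%N.

Lemma koszul_even (f : T) :
  (forall a b, a != b -> ~~ (odd_entry (f a) && odd_entry (f b))) ->
  even_sign f.
Proof.
move=> ev s; rewrite /koszul big1 // => -[a b] /andP [/= ab _].
have /ev : a != b by rewrite -val_eqE neq_ltn ab.
by rewrite -signr_odd oddM /odd_entry => /negPf ->.
Qed.

(** The only pair whose order is reversed by the transposition of the first two positions
    is that pair itself. *)
Lemma koszul_tperm01 (i0 i1 : 'I_p) (f : T) : val i0 = 0%N -> val i1 = 1%N ->
  odd_entry (f i0) -> odd_entry (f i1) -> @koszul p C (tperm i0 i1) f = -1.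
Proof.
move=> e0 e1 o0 o1; rewrite /koszul (bigD1 (i0, i1)) /=; last first.
  by rewrite tpermL tpermR e0 e1.
rewrite -signr_odd oddM -[odd `|_|%N]/(odd_entry (f i0)) o0.
rewrite -[odd `|_|%N]/(odd_entry (f i1)) o1 expr1 big1 ?mulr1 // => -[a b] /=.
move=> /andP [/andP [ab inv]]; rewrite xpair_eqE => ne; exfalso; move: ab inv ne.
have nv (x y : 'I_p) : x <> y -> x <> y :> nat by move=> ne /val_inj.
rewrite /= in e0 e1.
by case: tpermP => [->|->|/nv bi0 /nv bi1]; case: tpermP => [->|->|/nv ai0 /nv ai1];
  rewrite ?eqxx //; lia.
Qed.

Lemma tact_bas_moves (i0 i1 a b : 'I_p) : i0 != i1 -> a != b ->
  exists s : 'S_p, s a = i0 /\ s b = i1.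
Proof.
move=> i01 ab; exists (tperm a i0 * tperm (tperm a i0 b) i1)%g; rewrite !permM tpermL.
split; last by rewrite tpermL.
have ne : tperm a i0 b != i0.
  apply: contra ab => /eqP; rewrite -[in RHS](tpermL a i0) => /perm_inj ->.
  exact: eqxx.
by apply: tpermD => //; rewrite eq_sym.
Qed.

Definition stab_size (f0 f : T) : nat := #|[set s : 'S_p | s ** f == f0]|.

Lemma stab_size_const (f0 g : T) :
  ntrue g = ntrue f0 -> stab_size f0 g = stab_size f0 f0.
Proof.
move=> gf0; have [t <-] := tact_transitive (esym gf0).
rewrite /stab_size -[LHS](card_imset _ (@mulgI _ t)); apply: eq_card => u.
rewrite inE; apply/imsetP/idP => [[s]|uf0].
  by rewrite inE -tact_bas_mul => sf0 ->.
by exists (t^-1 * u)%g; rewrite ?mulKVg // inE -tact_bas_mul mulKVg.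
Qed.

(** The orbit of f0 has binomial(p, ntrue f0) elements, a multiple of p, whereas p divides
    p! only once. *)
Lemma stab_size_coprime (f0 f : T) : prime p -> (0 < ntrue f0 < p)%N ->
  ntrue f = ntrue f0 -> coprime p (stab_size f0 f).
Proof.
move=> p_prime f0p.
have sizeE := @stab_size_const f0.
move=> /sizeE ->.
(* count all permutations by the tensor that they carry to f0 *)
have total : ('C(p, ntrue f0) * stab_size f0 f0 = p`!)%N.
  rewrite -card_Sn -sum1_card.
  rewrite (partition_big (fun s : 'S_p => s^-1%g ** f0) (fun g => ntrue g == ntrue f0)) /=.
    rewrite -{1}[p]card_ord -card_draws -sum_nat_cond_const.
    rewrite [LHS](reindex (fun g : T => [set i | g i])) /=; last first.
      exists (fun A : {set 'I_p} => [ffun i => i \in A]) => [g _|A _].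
        by apply/ffunP => i; rewrite ffunE inE.
      by apply/setP => i; rewrite inE ffunE.
    apply: eq_big => [//|g /eqP gf0].
    rewrite -(sizeE g gf0) /stab_size -sum1_card; apply: eq_bigl => s.
    rewrite !inE; apply/eqP/eqP => <-; rewrite -tact_bas_mul.
      by rewrite mulgV tact_bas_one.
    by rewrite mulVg tact_bas_one.
  by move=> s _; rewrite ntrue_tact.
have [c cE] := dvdnP (prime_dvd_bin p_prime f0p).
have p0 := prime_gt0 p_prime; rewrite prime_coprime //.
have : (c * stab_size f0 f0 = p.-1`!)%N.
  apply/eqP; rewrite -(eqn_pmul2l p0) mulnA [(p * c)%N]mulnC -cE total.
  by rewrite -{1 2}(prednK p0) factS.
move=> cN; apply/negP => pN; have := Wilson (prime_gt1 p_prime).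
rewrite p_prime -cN -addn1 dvdn_addr ?dvdn_mull // dvdn1 => /esym/eqP p1.
by rewrite p1 in p_prime.
Qed.
End Permutations.

(** * Relative projectivity and invariants of the columns *)

Section Columns.
Variables (R : comNzRingType) (p n : nat) (k : int).
Local Notation C := (Cnk n k).
Local Notation C1 := (Cnk 1 k).
Local Notation T := {ffun 'I_p -> bool}.
Local Notation "s ** f" := (@tact_bas p C s f) (at level 40).
Local Notation P := (tcol R p n k).
Local Notation cf x f := (@coef R (tpow p C) _ x f).

Definition invariant l (x : P l) := forall s, gact (P l) s x = x.

Lemma invariant_coef l (x : P l) s (f : T) : invariant x ->
  cf x (s ** f) = (@koszul p C s f)%:~R * cf x f.
Proof. by move=> xG; apply: coef_fixed. Qed.

Definition first_true l : T := [ffun i : 'I_p => (i < l)%N].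

Lemma ntrue_first l : (l <= p)%N -> ntrue (first_true l) = l.
Proof.
move=> lp; have winj : injective (widen_ord lp) by move=> i j /(congr1 val) /= ij; apply: val_inj.
rewrite /ntrue -[RHS]card_ord -[RHS](card_imset _ winj).
rewrite -[RHS]cardsE; apply: eq_card => i; rewrite !inE ffunE.
apply/idP/imsetP => [il|[j _ ->]]; last by rewrite /= ltn_ord.
by exists (Ordinal il) => //; apply: val_inj.
Qed.

Lemma relatively_projective l : prime p ->
    (forall N, coprime p N -> exists u : R, u * N%:R = 1) -> (0 < l < p)%N ->
  exists theta : {linear P l -> P l}, forall x,
    \sum_(s : 'S_p) gact (P l) s (theta (gact (P l) s^-1%g x)) = 1 *: x.
Proof.
move=> p_prime unitP lp; set f0 := first_true l.
have f0l : ntrue f0 = l by rewrite ntrue_first // ltnW //; case/andP: lp.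
have f0p : (0 < ntrue f0 < p)%N by rewrite f0l.
have [u uN] := unitP _ (stab_size_coprime n k p_prime f0p erefl).
exists (linmap (basis_proj_linear (R := R) (C := C) (j := base p k + l%:Z) f0 u)) => x.
apply: basis_proj_average => f; rewrite tdeg_ntrue => fl.
have fl0 : ntrue f = ntrue f0 by rewrite f0l; lia.
by rewrite -[RHS]uN -(stab_size_const n k fl0).
Qed.

(** Move the two odd factors to the first two positions.  Exchanging them there fixes the
    tensor but reverses the sign of the coefficient. *)
Lemma odd_pair_invariant l (x : P l) (f : T) (a b : 'I_p) :
    (forall n (r : R), (0 < n)%N -> r *+ n = 0 -> r = 0) ->
    (forall b b', odd_entry k b -> odd_entry k b' -> b = b') -> invariant x ->
    a != b -> odd_entry k (f a) -> odd_entry k (f b) -> cf x f = 0.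
Proof.
move=> tf odd1 xG ab oa ob.
have p1 : (1 < p)%N.
  have := ltn_ord a; have := ltn_ord b.
  by move: ab; rewrite -val_eqE /= neq_ltn; case/orP; lia.
pose i0 := Ordinal (ltnW p1); pose i1 := Ordinal p1.
have [s [sa sb]] : exists s : 'S_p, s a = i0 /\ s b = i1 by exact: tact_bas_moves.
pose g := s ** f.
have gi0 : g i0 = f a by rewrite ffunE -sa permK.
have gi1 : g i1 = f b by rewrite ffunE -sb permK.
have gE : tperm i0 i1 ** g = g.
  apply/ffunP => i; rewrite ffunE tpermV.
  by case: tpermP => [->|->|] //; rewrite gi0 gi1; apply: odd1.
have := invariant_coef (tperm i0 i1) g xG.
rewrite gE (koszul_tperm01 n (i0 := i0) (i1 := i1)) ?gi0 ?gi1 // => e.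
have g0 : cf x g = 0.
  apply: (tf 2%N) => //; rewrite mulr2n {1}e mulN1r; exact: addNr.
have fE : f = s^-1%g ** g by rewrite /g -tact_bas_mul mulgV tact_bas_one.
by rewrite fE invariant_coef // g0 mulr0.
Qed.

Definition orbit_sum l : P l := of_coef (C := tpow p C) _ (fun=> 1).

Lemma coef_orbit_sum l (f : T) : ntrue f = l -> cf (orbit_sum l) f = 1.
Proof. by move=> fl; apply: of_coefK; rewrite /= tdeg_ntrue fl. Qed.

Section EvenColumn.
Variable l : nat.
Hypothesis ev : forall f : T, ntrue f = l -> @even_sign p n k f.

Lemma orbit_sum_invariant : invariant (orbit_sum l).
Proof.
move=> s; apply: tcol_coef_inj => f fl.
have {1}-> : f = s ** (s^-1%g ** f) by rewrite -tact_bas_mul mulVg tact_bas_one.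
rewrite coef_gact ev ?ntrue_tact // mul1r.
by rewrite !coef_orbit_sum // ntrue_tact.
Qed.

(** When no Koszul sign intervenes, the coefficients of an invariant are constant on the
    orbit, which is the whole column. *)
Lemma invariantE (x : P l) : (l <= p)%N -> invariant x -> exists r, x = r *: orbit_sum l.
Proof.
move=> lp xG; exists (cf x (first_true l)); apply: tcol_coef_inj => f fl.
rewrite coefZ coef_orbit_sum // mulr1.
have [|s <-] := tact_transitive n k (f := first_true l) (g := f).
  by rewrite ntrue_first.
by rewrite invariant_coef // ev ?ntrue_first // mul1r.
Qed.
End EvenColumn.

Lemma orbit_sum_free l (r : R) : (l <= p)%N -> r *: orbit_sum l = 0 -> r = 0.
Proof.
move=> lp /(congr1 (fun x : P l => cf x (first_true l))).
by rewrite coefZ coef_orbit_sum ?ntrue_first // mulr1 coef0.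
Qed.

(** Each tensor f of the next column arises from as many tensors as it has upper factors,
    namely by lowering one of them, always with sign 1. *)
Lemma row_dif_orbit_sum l :
    (forall (g : T) i j, ntrue g = l -> ~~ g i -> j != i -> degsign (C := C1) (g j) = 1) ->
  ghom_fun (row_dif R p n k l) (orbit_sum l) = l.+1%:R *: orbit_sum l.+1.
Proof.
move=> dsg; apply: tcol_coef_inj => f fl; rewrite row_dif_coef // coefZ.
rewrite coef_orbit_sum // mulr1.
transitivity ((\sum_(g : T) @tdif p C1 g f)%:~R : R).
  rewrite rmorph_sum; apply: eq_bigr => g _.
  have [->|nz] := eqVneq (tdif (p := p) (C := C1) g f) 0; first by rewrite mul0r.
  rewrite coef_orbit_sum ?mulr1 //.
  by have := tdif_deg nz; rewrite !tdeg_ntrue fl; lia.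
rewrite -fl -mulrz_nat; congr (_%:~R).
rewrite (eq_bigr (fun g : T => \sum_i (f i && (g == @upd p C1 f i false))%:R)); last first.
  move=> g _; rewrite tdif_boolE; apply: eq_bigr => i _.
  case: andP => [[fi /eqP gE]|]; last first.
    case gi: (g i); first by rewrite mulr0 mul0r.
    have [fE|_] := eqVneq f (@upd p C1 g i true); last by rewrite !mulr0.
    case; rewrite fE (@upd_same p C1) (@upd_upd p C1); split=> //; apply/eqP/ffunP => j.
    by rewrite ffunE; case: eqP => // ->.
  have gi : g i = false by rewrite gE (@upd_same p C1).
  have fE : f = @upd p C1 g i true.
    by rewrite gE (@upd_upd p C1); apply/ffunP => j; rewrite ffunE; case: eqP => // ->.
  have gl : ntrue g = l.
    have := tdeg_upd (C := C1) g i true; rewrite -fE gi !tdeg_ntrue fl /= /Cnk_deg; lia.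
  rewrite fE eqxx gi !mulr1 /tsign big1 // => j ji; apply: (dsg g i j).
  - exact: gl.
  - by rewrite gi.
  by rewrite -val_eqE neq_ltn ji.
rewrite exchange_big /ntrue -sum1_card natr_sum [RHS]big_mkcond; apply: eq_bigr => i _.
rewrite inE; case fi: (f i); last by rewrite big1.
by rewrite (bigD1 (@upd p C1 f i false)) //= eqxx big1 ?addr0 // => g /negPf ->.
Qed.
End Columns.

(** * Cyclic cohomology and dimension shifting *)

Section CyclicCohomology.
Variables (R : comNzRingType) (A : nat -> lmodType R).
Variable d : forall i, {linear A i -> A i.+1}.

Definition cob i : A i -> Prop :=
  match i with
  | 0 => fun x => x = 0
  | i'.+1 => fun x => exists y, x = d i' y
  end.

Lemma cob_lin i a (x y : A i) : cob x -> cob y -> cob (a *: x + y).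
Proof.
case: i x y => [|i] x y /=; first by move=> -> ->; rewrite scaler0 addr0.
by move=> [u ->] [v ->]; exists (a *: u + v); rewrite linearP.
Qed.

Lemma cob0 i : cob (0 : A i).
Proof. by case: i => [|i] //=; exists 0; rewrite linear0. Qed.

Lemma cobZ i a (x : A i) : cob x -> cob (a *: x).
Proof. by move=> cx; rewrite -[_ *: _]addr0; apply: cob_lin => //; exact: cob0. Qed.

Lemma cobD i (x y : A i) : cob x -> cob y -> cob (x + y).
Proof. by rewrite -[x in x + y]scale1r; exact: cob_lin. Qed.

(** The cohomology in degree i is cyclic, with a generator whose annihilator is (c).
    The case c = 1 says that the cohomology vanishes, see cyclic_coh1. *)
Definition cyclic_coh i c := exists z : A i,
  [/\ d i z = 0, forall x, d i x = 0 -> exists r, cob (x - r *: z)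
    & forall r : R, cob (r *: z) <-> exists y, r = y * c].

Lemma cyclic_coh1 i : (forall x : A i, d i x = 0 -> cob x) <-> cyclic_coh i 1.
Proof.
split=> [ex|[z [_ gen ann]] x /gen [r]].
  exists 0; split=> [|x dx|r]; first exact: linear0.
    by exists 0; rewrite scaler0 subr0; exact: ex.
  by split=> _; [exists r; rewrite mulr1|rewrite scaler0; exact: cob0].
have /(ann r) rz : exists y, r = y * 1 by exists r; rewrite mulr1.
by move=> /cobD /(_ rz); rewrite subrK.
Qed.

Lemma cyclic_coh_ann i c : cyclic_coh i c -> forall x : A i, d i x = 0 -> cob (c *: x).
Proof.
move=> [z [_ gen ann]] x /gen [r xr].
rewrite -(subrK (r *: z) x) scalerDr; apply: cobD; first exact: cobZ.
by rewrite scalerA; apply/ann; exists r; rewrite mulrC.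
Qed.
Lemma cyclic_coh_torsion i a c : c = a \/ c = 1 -> cyclic_coh i.+1 c ->
  forall x : A i.+1, d i.+1 x = 0 -> exists y, a *: x = d i y.
Proof.
move=> ac /cyclic_coh_ann cx x /cx; case: ac => -> // [y yx].
by exists (a *: y); rewrite linearZ /= -yx scale1r.
Qed.
End CyclicCohomology.

(** The abstract form of the modules Hom (W i, P l): d comes from the resolution W, and h from
    the exact complex P. *)
Section Grid.
Variables (R : comNzRingType) (A : nat -> nat -> lmodType R).
Variables (d : forall i l, {linear A i l -> A i.+1 l}).
Variables (h : forall i l, {linear A i l -> A i l.+1}).
Hypothesis dd : forall i l (x : A i l), d i.+1 l (d i l x) = 0.
Hypothesis hh : forall i l (x : A i l), h i l.+1 (h i l x) = 0.
Hypothesis dh : forall i l (x : A i l), d i l.+1 (h i l x) = h i.+1 l (d i l x).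
Hypothesis h_inj : forall i (x : A i 0), h i 0 x = 0 -> x = 0.
Hypothesis h_exact : forall i l (x : A i l.+1), h i l.+1 x = 0 -> exists y, x = h i l y.

Notation coh l i c := (@cyclic_coh R (A^~ l) (d^~ l) i c).

(** Coboundaries in the subcomplex of column l formed by the kernels of h.  By exactness
    of the rows this subcomplex is also the image of column l - 1, so it links
    consecutive columns. *)
Definition kcob i l : A i l -> Prop :=
  match i with
  | 0 => fun x => x = 0
  | i'.+1 => fun x => exists2 y, h i' l y = 0 & x = d i' l y
  end.

Definition kernel_coh i l c := exists z : A i l,
  [/\ d i l z = 0, h i l z = 0,
      forall x, d i l x = 0 -> h i l x = 0 -> exists r, kcob (x - r *: z)
    & forall r : R, kcob (r *: z) <-> exists y, r = y * c].

(** The connecting isomorphism of 0 -> ker h -> column l -> ker h -> 0 for an acyclic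
    column l: the generator z = h w is sent to d w. *)
Lemma kernel_coh_shift i l c :
    (forall x : A i.+2 l, d i.+2 l x = 0 -> exists y, x = d i.+1 l y) ->
    (forall x : A i.+1 l, d i.+1 l x = 0 -> exists y, x = d i l y) ->
  kernel_coh i.+1 l.+1 c -> kernel_coh i.+2 l c.
Proof.
move=> ex2 ex1 [z [dz hz gen ann]]; have [w zE] := h_exact hz.
exists (d _ _ w); split=> [||x dx hx|r].
- exact: dd.
- by rewrite -dh -zE.
- have [u xE] := ex2 x dx; subst x.
  have [||r [y hy /eqP]] := gen (h _ _ u).
  + by rewrite dh.
  + exact: hh.
  have [y' yE] := h_exact hy; rewrite zE yE dh subr_eq => /eqP hu.
  exists r; exists (u - r *: w - d _ _ y').
    by rewrite !linearB linearZ /= hu addrK subrr.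
  by rewrite !linearB /= dd subr0 [in RHS]linearZ.
split=> [[y hy ryE]|/(ann r) [y hy /= rz]].
  apply/ann; have [|q qE] := ex1 (r *: w - y).
    by rewrite linearB linearZ /= ryE subrr.
  exists (h _ _ q); first exact: hh.
  by rewrite dh -qE linearB linearZ /= -zE hy subr0.
have [y' yE] := h_exact hy; exists (r *: w - d _ _ y').
  by rewrite linearB linearZ /= -zE rz yE dh subrr.
by rewrite linearB linearZ /= dd subr0.
Qed.

(** In degree 0 the column l has invariants, so the connecting map is only surjective,
    with kernel the image under h of the cocycles of degree 0. *)
Lemma kernel_coh_shift0 l c (z : A 0 l.+1) :
    (forall x : A 1 l, d 1 l x = 0 -> exists y, x = d 0 l y) ->
    d 0 l.+1 z = 0 -> h 0 l.+1 z = 0 ->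
    (forall x : A 0 l.+1, d 0 l.+1 x = 0 -> h 0 l.+1 x = 0 -> exists r, x = r *: z) ->
    (forall r, (exists2 v : A 0 l, d 0 l v = 0 & h 0 l v = r *: z) <->
       exists y, r = y * c) ->
  kernel_coh 1 l c.
Proof.
move=> ex1 dz hz gen ann; have [w zE] := h_exact hz.
exists (d _ _ w); split=> [||x dx hx|r].
- exact: dd.
- by rewrite -dh -zE.
- have [u xE] := ex1 x dx; subst x.
  have [||r hu] := gen (h _ _ u).
  + by rewrite dh.
  + exact: hh.
  exists r; exists (u - r *: w); last by rewrite linearB [in RHS]linearZ.
  by rewrite linearB linearZ /= hu -zE subrr.
split=> [[y hy ryE]|/(ann r) [v dv rz]].
  apply/ann; exists (r *: w - y); first by rewrite linearB linearZ /= ryE subrr.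
  by rewrite linearB linearZ /= -zE hy subr0.
exists (r *: w - v); first by rewrite linearB linearZ /= -zE rz subrr.
by rewrite linearB linearZ /= dv subr0.
Qed.

(** By injectivity of h at the beginning of the rows, column 0 is isomorphic to the
    kernels in column 1. *)
Lemma kernel_coh_bottom i c : kernel_coh i 1 c -> coh 0 i c.
Proof.
move=> [z [dz hz gen ann]]; have [w zE] := h_exact hz.
have kE (x : A i 0) : kcob (h i 0 x) <-> cob (d^~ 0%N) x.
  case: i x {z dz hz gen ann w zE} => [|i] x /=.
    by split=> [/h_inj|->]; rewrite ?linear0.
  split=> [[y hy]|[y ->]]; last by exists (h _ _ y); [exact: hh|rewrite dh].
  have [y' ->] := h_exact hy; rewrite dh => /eqP; rewrite -subr_eq0 -linearB.
  move=> /eqP /h_inj /eqP; rewrite subr_eq0 => /eqP ->.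
  by exists y'.
exists w; split=> [|x dx|r].
- by apply: h_inj; rewrite -dh -zE.
- have [||r] := gen (h _ _ x); [by rewrite dh dx linear0|exact: hh|].
  by move=> kx; exists r; apply/kE; rewrite linearB linearZ /= -zE.
by rewrite -kE linearZ /= -zE.
Qed.

Variable p : nat.
Hypothesis top0 : forall i (x : A i p.+1), x = 0.
Hypothesis acyclic : forall i l, (0 < l < p)%N ->
  forall x : A i.+1 l, d i.+1 l x = 0 -> exists y, x = d i l y.

Lemma kernel_coh_descend i l c : (l < p)%N -> kernel_coh i.+1 l.+1 c ->
  coh 0 (i.+1 + l)%N c.
Proof.
elim: l i => [|l IHl] i lp H; first by rewrite addn0; exact: kernel_coh_bottom.
rewrite addnS -addSn; apply: IHl; first exact: ltnW.
by apply: kernel_coh_shift => //; apply: acyclic; rewrite /= lp.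
Qed.

Lemma coh_top_bottom i c : (0 < p)%N -> coh p i.+1 c -> coh 0 (i.+1 + p.-1)%N c.
Proof.
move=> p0 [z [dz gen ann]]; apply: kernel_coh_descend; rewrite ?prednK //.
have ht j (x : A j p) : h j p x = 0 by exact: top0.
exists z; split=> // [x dx _|r].
  by have [r [y e]] := gen x dx; exists r; exists y.
by rewrite -ann; split=> [[y _ ->]|[y ->]]; exists y.
Qed.

Lemma coh_bottom_edge i c (z : A 0 i.+2) : (i.+1 < p)%N ->
    d 0 i.+2 z = 0 -> h 0 i.+2 z = 0 ->
    (forall x : A 0 i.+2, d 0 i.+2 x = 0 -> h 0 i.+2 x = 0 -> exists r, x = r *: z) ->
    (forall r, (exists2 v : A 0 i.+1, d 0 i.+1 v = 0 & h 0 i.+1 v = r *: z) <->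
       exists y, r = y * c) ->
  coh 0 i.+1 c.
Proof.
move=> ip dz hz gen ann; rewrite -[i.+1]/(1 + i)%N.
apply: kernel_coh_descend; first exact: ltnW.
by apply: (@kernel_coh_shift0 _ _ z) => //; apply: acyclic.
Qed.

Lemma coh_bottom_low i : (i.+1 < p)%N ->
    (forall x : A 0 i.+2, d 0 i.+2 x = 0 -> h 0 i.+2 x = 0 -> x = 0) ->
  coh 0 i.+1 1.
Proof.
move=> ip inv0; apply: (@coh_bottom_edge _ _ 0); rewrite ?linear0 //.
  by move=> x dx hx; exists 0; rewrite scale0r; exact: inv0.
move=> r; split=> _; first by exists r; rewrite mulr1.
by exists 0; rewrite ?linear0 ?scaler0.
Qed.
End Grid.

(** * Relations, quotients and subquotients *)

Section Quotients.
Variable R : comNzRingType.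

(** Maps between subquotients are most easily given by a relation between representatives;
    this packages such a relation as a linear bijection. *)
Lemma linear_of_relation (U V : lmodType R) (Rel : U -> V -> Prop) :
    (forall a u u' v v', Rel u v -> Rel u' v' -> Rel (a *: u + u') (a *: v + v')) ->
    (forall u, exists v, Rel u v) -> (forall v, exists u, Rel u v) ->
    (forall v, Rel 0 v -> v = 0) -> (forall u, Rel u 0 -> u = 0) ->
  exists2 f : {linear U -> V}, bijective f & forall u, Rel u (f u).
Proof.
move=> lin /choice [f fP] /choice [g gP] func inj.
have relB u u' v v' : Rel u v -> Rel u' v' -> Rel (u - u') (v - v').
  move=> uv uv'; rewrite [u - _]addrC [v - _]addrC -scaleN1r -[- v']scaleN1r.
  exact: lin.
have uniq u v v' : Rel u v -> Rel u v' -> v = v'.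
  by move=> uv uv'; apply: subr0_eq; apply: func; rewrite -(subrr u); apply: relB.
have fL : linear f by move=> a u v; apply: (uniq (a *: u + v)); [exact: fP|exact: lin].
exists (linmap fL); last exact: fP.
exists g => [u|v] /=; last by apply: uniq (gP v); exact: fP.
by apply: subr0_eq; apply: inj; rewrite -(subrr (f u)); apply: relB.
Qed.

Lemma qclass_eq0 (V : lmodType R) (S : submodule V) x : qclass S x = 0 <-> S x.
Proof. by rewrite -(linear0 (qclass S)) qclass_eq subr0. Qed.

Section Subquotient.
Variables (V : lmodType R) (Z B : submodule V).

Lemma subq_repr (q : subq Z B) : exists2 z, Z z & represents q z.
Proof.
exists (smval (repr q)); first exact: smvalP.
exists (smvalP (repr q)); rewrite -[LHS]qclass_repr; congr qclass.
exact: val_inj.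
Qed.

Lemma represents_class z : Z z -> exists q : subq Z B, represents q z.
Proof. by move=> Zz; exists (qclass _ (insm Zz)); exists Zz. Qed.

Lemma represents_cycle (q : subq Z B) z : represents q z -> Z z.
Proof. by case. Qed.

Lemma represents_lin a (q q' : subq Z B) z z' :
  represents q z -> represents q' z' -> represents (a *: q + q') (a *: z + z').
Proof.
move=> [Zz ->] [Zz' ->]; exists (smset_lin a Zz Zz').
by rewrite -linearP; congr qclass; apply: val_inj.
Qed.

Lemma represents0 z : Z z -> represents (0 : subq Z B) z <-> B z.
Proof.
move=> Zz; split=> [[Zz' /esym /qclass_eq0]|Bz] //.
by exists Zz; apply/esym/qclass_eq0.
Qed.

Lemma represents_change (q : subq Z B) x y :
  represents q x -> Z y -> B (x - y) -> represents q y.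
Proof. by move=> [Zx ->] Zy Bxy; exists Zy; apply/qclass_eq. Qed.

Lemma represents_eq (q q' : subq Z B) z : represents q z -> represents q' z -> q = q'.
Proof.
move=> qz q'z; apply: subr0_eq.
have := represents_lin (-1) q'z qz; rewrite !scaleN1r addNr addrC => -[Z0 ->].
by apply/qclass_eq0; exact: smset0.
Qed.

Lemma subq_trivial : (forall q : subq Z B, q = 0) <-> (forall z, Z z -> B z).
Proof.
split=> [triv z Zz|ZB q]; last first.
  by have [z Zz qz] := subq_repr q; apply: represents_eq qz _; apply/represents0/ZB.
by have [q] := represents_class Zz; rewrite (triv q) => /(represents0 Zz).
Qed.

Lemma subq_cyclic z c : Z z -> (forall x, Z x -> exists r, B (x - r *: z)) ->
    (forall r : R, B (r *: z) <-> exists y, r = y * c) ->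
  lisom (subq Z B) (cyclic_mod c).
Proof.
move=> Zz gen ann.
pose Rel (q : subq Z B) (s : cyclic_mod c) :=
  exists r : R^o, represents q (r *: z) /\ s = qclass (principal c) r.
have rel r : exists q : subq Z B, represents q (r *: z).
  by apply: represents_class; exact: smsetZ.
have [|||||f fb _] := @linear_of_relation _ _ Rel.
- move=> a q q' _ _ [r [qr ->]] [r' [qr' ->]]; exists (a *: r + r'); split.
    by rewrite scalerDl -scalerA; exact: represents_lin.
  by rewrite linearP.
- move=> q; have [x Zx qx] := subq_repr q; have [r xr] := gen x Zx.
  exists (qclass (principal c) r); exists r; split=> //.
  by apply: represents_change qx _ xr; exact: smsetZ.
- move=> s; have [q qr] := rel (repr s); exists q, (repr s); split=> //.
  by rewrite qclass_repr.
- by move=> _ [r [/represents0 /ann rc ->]]; apply/qclass_eq0/rc/smsetZ.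
- move=> q [r [qr /esym/qclass_eq0 rc]]; apply: represents_eq qr _.
  by apply/represents0; [exact: smsetZ|apply/ann].
by exists f.
Qed.
End Subquotient.
End Quotients.

(** * Collapse and extensions from liftable cycles *)

Section SpectralSequence.
Variables (R : comNzRingType) (E : bicomplex R).

Lemma tot_ext (x y : tot E) : (forall i j, coord x (i, j) = coord y (i, j)) -> x = y.
Proof.
by move=> xy; apply: val_inj; apply: functional_extensionality_dep => -[i j]; exact: xy.
Qed.

Lemma totfilW s s' (x : tot E) : s' <= s -> totfil E s x -> totfil E s' x.
Proof. by move=> ss xs i j js; apply: xs; apply: lt_le_trans js ss. Qed.

(** Every x in Z_2^j has the same leading term as some cocycle.  This is the collapse at
    E_2 in terms of representatives. *)
Definition liftable := forall j m (x : tot E), zcycles E 2 j m x ->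
  exists v, [/\ totdeg E m v, totfil E (j + 1) v & totd E (x - v) = 0].

Hypothesis lift : liftable.

(** If D (x - v) = 0 with v one step deeper in the filtration, then D x = D v is a
    boundary on the page in question. *)
Lemma liftable_collapses : collapses_at E 2.
Proof.
move=> r i j q r2; rewrite -[q]qclass_repr.
rewrite [LHS]subq_map_class; last exact: dpage_bound.
apply/qclass_eq0.
change (zbounds E r%:Z (j + r%:Z) (i - r%:Z + 1 + (j + r%:Z)) (totd E (smval (repr q)))).
have [] := smvalP (repr q); move: (smval _) => x xm xj xr.
have [|v [vm vj /eqP]] := lift (j := j) (m := i + j) (x := x).
  by split=> //; apply: totfilW xr; lia.
rewrite linearB subr_eq0 => /eqP dxv.
exists 0, v; split; [exact: smset0| |by rewrite add0r].
split.
- by rewrite dpage_degE addrK.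
- by apply: totfilW vj; lia.
by rewrite -dxv; apply: totfilW xr; lia.
Qed.

Variables (b t : int).
Hypothesis bounded : forall i j (x : E i j), ~ (b <= j <= t) -> x = 0.

Lemma totfil_all (x : tot E) : totfil E b x.
Proof. by move=> i j jb; apply: bounded => /=; lia. Qed.

Lemma totfil_none s (x : tot E) : t < s -> totfil E s x -> x = 0.
Proof.
move=> ts xs; apply: tot_ext => i j; have [/xs ->//|js] := ltP j s.
by apply: bounded => /=; lia.
Qed.

(** A total degree m in which the second page has at most one nonzero term, the one in
    filtration j0. *)
Section OneTerm.
Variables (m j0 : int).
Hypothesis other : forall j, j <> j0 -> forall x : page E 2 (m - j) j, x = 0.

Lemma cocycle_step j z : j <> j0 -> cocycles E m z -> totfil E j z ->
  exists u v, [/\ cocycles E m u, totfil E (j + 1) u, totdeg E (m - 1) v & z = u + totd E v].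
Proof.
move=> /other /subq_trivial; rewrite subrK => ZB [zm dz] zj.
have [|u [v [[um uj _] [vm _ _] zE]]] := ZB z.
  by split=> //; rewrite dz; exact: smset0.
exists u, v; split=> //; split=> //.
by have := dz; rewrite zE linearD totdK addr0.
Qed.

(** Below j0 the leading term of a cocycle is a boundary, which can be subtracted. *)
Lemma cocycle_push z : cocycles E m z -> exists u v,
  [/\ cocycles E m u, totfil E j0 u, totdeg E (m - 1) v & z = u + totd E v].
Proof.
suff H n : forall z, cocycles E m z -> totfil E (j0 - n%:Z) z -> exists u v,
    [/\ cocycles E m u, totfil E j0 u, totdeg E (m - 1) v & z = u + totd E v].
  by move=> zc; apply: (H (absz (j0 - b)%R)) => //; apply: totfilW (totfil_all z); lia.
elim: n => [|n IHn] {}z zc zj.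
  exists z, 0; split=> //; first by apply: totfilW zj; lia.
  by rewrite linear0 addr0.
have [|u [v [uc uj vm ->]]] := cocycle_step (j := j0 - n.+1%:Z) _ zc zj; first lia.
have [|u' [v' [uc' uj' vm' ->]]] := IHn u uc; first by apply: totfilW uj; lia.
exists u', (v' + v); split=> //; first exact: smsetD.
by rewrite linearD addrA.
Qed.

(** Above j0 all leading terms are boundaries, and the filtration ends. *)
Lemma cocycle_exact j z : j0 < j -> cocycles E m z -> totfil E j z ->
  exists2 v, totdeg E (m - 1) v & z = totd E v.
Proof.
move=> jj0; suff H n : forall j z, j0 < j -> t < j + n%:Z -> cocycles E m z -> totfil E j z ->
    exists2 v, totdeg E (m - 1) v & z = totd E v.
  by apply: (H (absz (t - j + 1)%R) j z) => //; lia.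
elim: n => [|n IHn] {jj0}j {}z jj0 tj zc zj.
  exists 0; first exact: smset0.
  by rewrite linear0; apply: totfil_none zj; lia.
have [|u [v [uc uj vm ->]]] := cocycle_step (j := j) _ zc zj; first lia.
have [|||v' vm' ->] := IHn (j + 1) u _ _ uc; [lia|lia|by []|].
by exists (v' + v); [exact: smsetD|rewrite linearD].
Qed.

(** A primitive w of z may start far below filtration j0 - 1, but then its leading terms
    belong to Z_2 and liftability removes them one after the other. *)
Lemma cocycle_bound z : cocycles E m z -> totfil E j0 z ->
  (zbounds E 2 j0 m z <-> exists2 v, totdeg E (m - 1) v & z = totd E v).
Proof.
move=> zc zj; split=> [[u [v [[um uj _] [vm _ _] zE]]]|[w wm zE]].
  have [||v' vm' uE] := cocycle_exact (j := j0 + 1) (z := u) _ _ uj; first lia.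
    split=> //; have [_] := zc; by rewrite zE linearD totdK addr0.
  by exists (v' + v); [exact: smsetD|rewrite linearD -uE].
suff H n : forall w, totdeg E (m - 1) w -> z = totd E w -> totfil E (j0 - 1 - n%:Z) w ->
    exists w', [/\ totdeg E (m - 1) w', z = totd E w' & totfil E (j0 - 1) w'].
  have [|w' [wm' zE' wj']] := H (absz (j0 - 1 - b)%R) w wm zE.
    by apply: totfilW (totfil_all w); lia.
  exists 0, w'; split; [exact: smset0| |by rewrite add0r].
  split=> //; first by apply: totfilW wj'; lia.
  by rewrite -zE'; apply: totfilW zj; lia.
elim: n => [|n IHn] {wm zE}w wm zE wj.
  by exists w; split=> //; apply: totfilW wj; lia.
have [|v [vm vj /eqP]] := lift (j := j0 - 1 - n.+1%:Z) (m := m - 1) (x := w).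
  by split=> //; rewrite -zE; apply: totfilW zj; lia.
rewrite linearB -zE subr_eq0 => /eqP zE'.
by apply: (IHn v) => //; apply: totfilW vj; lia.
Qed.

(** The isomorphism sends the class in the single nonzero term to the cohomology class of
    any cocycle of filtration j0 representing it. *)
Lemma one_term_extension :
  exists phi : {linear dsum (fun j : int => page E 2 (m - j) j) -> totcoh E m},
    bijective phi /\
    forall j (e : dsum (fun j : int => page E 2 (m - j) j)),
      (forall k, k != j -> coord e k = 0) ->
      exists z : tot E,
        [/\ totfil E j z, represents (coord e j) z & represents (phi e) z].
Proof.
pose P j := page E 2 (m - j) j.
pose Rel (e : dsum P) (c : totcoh E m) := exists z,
  [/\ totfil E j0 z, represents (coord e j0) z & represents c z].
have e_ext (e e' : dsum P) : coord e j0 = coord e' j0 -> e = e'.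
  move=> ee'; apply: val_inj; apply: functional_extensionality_dep => j.
  have [->//|/eqP jj0] := eqVneq j j0.
  by rewrite [LHS](other jj0) [RHS](other jj0).
have page_cocycle (q : P j0) : exists z, [/\ cocycles E m z, totfil E j0 z & represents q z].
  have [x Zx qx] := subq_repr q; have [xm xj _] := Zx.
  have [v [vm vj dxv]] := lift Zx; have xvj : totfil E j0 (x - v).
    by apply: smsetB => //; apply: totfilW vj; lia.
  exists (x - v); split=> //.
    by split=> //; move: xm vm; rewrite subrK => xm vm; exact: smsetB.
  apply: represents_change qx _ _.
    by split=> //; [exact: smsetB|rewrite dxv; exact: smset0].
  have -> : x - (x - v) = v by rewrite opprB addrC subrK.
  exists v, 0; split; [|exact: smset0|by rewrite linear0 addr0].
  split=> //; have -> : totd E v = totd E x.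
    by apply/eqP; rewrite eq_sym -subr_eq0 -linearB dxv.
  by have [_ _ xr] := Zx; apply: totfilW xr; lia.
have page_z z : cocycles E m z -> totfil E j0 z -> zcycles E 2 j0 (m - j0 + j0) z.
  by move=> [zm dz] zj; split; rewrite ?subrK ?dz //; exact: smset0.
have e_of (q : P j0) : exists e : dsum P, coord e j0 = q.
  have fin : fin_supp P (dfwith (fun=> 0) q).
    apply: (@sub_finite_set _ _ [set j0]%classic) => //= j.
    have [jj nz|jj] := eqVneq j0 j; last by rewrite /= dfwith_out.
    exact: esym jj.
  by exists (insm fin); rewrite /coord /smval /= dfwith_in.
have [|||||phi phib phiP] := @linear_of_relation _ _ _ Rel.
- move=> a e e' c c' [z [zj ez cz]] [z' [zj' ez' cz']]; exists (a *: z + z').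
  by split; [exact: smset_lin|exact: represents_lin..].
- move=> e; have [z [zc zj ez]] := page_cocycle (coord e j0).
  by have [c cz] := represents_class (coboundaries E m) zc; exists c, z.
- move=> c; have [x xc cx] := subq_repr c.
  have [z [v [zc zj vm xE]]] := cocycle_push xc.
  have [q qz] := represents_class (zbounds E 2 j0 (m - j0 + j0)) (page_z z zc zj).
  have [e eq] := e_of q; exists e, z; split; rewrite ?eq //.
  by apply: represents_change cx zc _; exists v; rewrite ?xE // addrC addKr.
- move=> c [z [zj e0 cz]]; have zc := represents_cycle cz.
  apply: represents_eq cz _; apply/represents0 => //.
  apply/(cocycle_bound zc zj).
  have := (represents0 (zbounds E 2 j0 (m - j0 + j0)) (represents_cycle e0)).1 e0.
  by rewrite subrK.
- move=> e [z [zj ez /[dup] c0 /represents_cycle zc]]; apply: e_ext.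
  apply: represents_eq ez _; apply/represents0; first exact: page_z.
  by rewrite subrK; apply/(cocycle_bound zc zj)/(represents0 (coboundaries E m) zc).
exists phi; split=> // j e ej; have [jj0|/eqP jj0] := eqVneq j j0.
  by subst j; exact: phiP.
have -> : e = 0 by apply: e_ext; rewrite ej // eq_sym; apply/eqP.
exists 0; rewrite linear0; split; first exact: smset0.
  by apply/represents0; exact: smset0.
by apply/represents0; exact: smset0.
Qed.
End OneTerm.

Lemma one_term_no_extension_problems :
  (forall m, exists j0, forall j, j <> j0 -> forall x : page E 2 (m - j) j, x = 0) ->
  no_extension_problems E 2.
Proof. by move=> one m; have [j0 other] := one m; exact: one_term_extension other. Qed.
End SpectralSequence.

(** * Pages read off from leading coordinates *)

Section Bicomplex.
Variables (R : comNzRingType) (E : bicomplex R).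

Lemma totd_coord0 (x : tot E) j :
  coord (totd E x) (0%N, j) = bd' E 0 j (coord x (0%N, j - 1)).
Proof. by rewrite -[LHS]/(0 + 1 *: _) scale1r add0r. Qed.

Lemma totd_coordS (x : tot E) i j : coord (totd E x) (i.+1, j) =
  bd E i j (coord x (i, j)) + (-1) ^+ i.+1 *: bd' E i.+1 j (coord x (i.+1, j - 1)).
Proof. by []. Qed.

Lemma totfil_next i j (x : tot E) : totdeg E (i%:Z + j) x -> totfil E j x ->
  coord x (i, j) = 0 -> totfil E (j + 1) x.
Proof.
move=> xm xj x0 i' j' jj; have [/xj ->//|j'j] := ltP j' j.
have -> : j' = j by lia.
by have [->//|ne] := eqVneq i' i; apply: xm; apply: contra ne => /eqP; lia.
Qed.

Variable b : int.
Local Notation A i l := (E i (b + l%:Z)).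

Section Inclusion.
Variables (i l : nat).

Lemma inc_fin (a : A i l) : fin_supp (fun ij : nat * int => E ij.1 ij.2)
  (dfwith (T := fun ij : nat * int => E ij.1 ij.2) (fun=> 0) (i := (i, b + l%:Z)) a).
Proof.
apply: (@sub_finite_set _ _ [set (i, b + l%:Z)]%classic) => // ij.
have [jj nz|jj] := eqVneq (i, b + l%:Z) ij; last by rewrite /= dfwith_out.
exact: esym jj.
Qed.

Definition inc (a : A i l) : tot E := insm (inc_fin a).

Lemma coord_inc a : coord (inc a) (i, b + l%:Z) = a.
Proof. by rewrite /coord /smval /= dfwith_in. Qed.

Lemma coord_inc_out a i' j' : (i, b + l%:Z) != (i', j') -> coord (inc a) (i', j') = 0.
Proof. by move=> ne; rewrite /coord /smval /= dfwith_out. Qed.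

Lemma inc_linear : linear inc.
Proof.
move=> c a a'; apply: val_inj; apply: functional_extensionality_dep => -[i' j'].
rewrite -[LHS]/(coord (inc (c *: a + a')) (i', j')).
rewrite -[RHS]/(c *: coord (inc a) (i', j') + coord (inc a') (i', j')).
have [[<- <-]|ne] := eqVneq (i, b + l%:Z) (i', j'); first by rewrite !coord_inc.
by rewrite !coord_inc_out // scaler0 addr0.
Qed.
HB.instance Definition _ := GRing.isLinear.Build R (A i l) (tot E) *:%R inc inc_linear.

Lemma inc_deg a : totdeg E (i%:Z + (b + l%:Z)) (inc a).
Proof.
by move=> i' j' ij; apply: coord_inc_out; apply: contra ij => /eqP [-> <-].
Qed.

Lemma inc_fil a : totfil E (b + l%:Z) (inc a).
Proof.
by move=> i' j' jl; apply: coord_inc_out; apply/eqP => -[_ jE]; rewrite jE ltxx in jl.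
Qed.
End Inclusion.

Variables (nu : R) (h : forall i l, {linear A i l -> A i l.+1}).
Hypothesis hE : forall i l (x : tot E),
  bd' E i (b + l.+1%:Z) (coord x (i, b + l.+1%:Z - 1)) = nu *: h i l (coord x (i, b + l%:Z)).
Local Notation d i l := (bd E i (b + l%:Z)).

Lemma totd_inc i l (a : A i l) :
  totd E (inc a) = inc (d i l a) + ((-1) ^+ i * nu) *: inc (h i l a).
Proof.
have vert i' j' : (-1) ^+ i' *: bd' E i' j' (coord (inc a) (i', j' - 1)) =
    ((-1) ^+ i * nu) *: coord (inc (h i l a)) (i', j').
  have [[<- <-]|ne] := eqVneq (i, b + l.+1%:Z) (i', j').
    by rewrite hE !coord_inc scalerA.
  rewrite coord_inc_out ?linear0 ?scaler0; last first.
    by apply: contra ne => /eqP [-> jE]; apply/eqP; congr pair; lia.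
  by rewrite coord_inc_out // scaler0.
apply: tot_ext => i' j'.
rewrite -[RHS]/(coord (inc (d i l a)) (i', j') +
  ((-1) ^+ i * nu) *: coord (inc (h i l a)) (i', j')) -vert.
case: i' => [|i']; first by rewrite totd_coord0 expr0 scale1r [X in _ = X + _]coord_inc_out ?add0r.
rewrite totd_coordS; congr (_ + _).
have [[<- <-]|ne] := eqVneq (i, b + l%:Z) (i', j'); first by rewrite !coord_inc.
by rewrite !coord_inc_out ?linear0.
Qed.

(** The elements of bidegree (i, b + l) that are leading terms of boundaries D y allowed in
    B_2. *)
Definition achieved i l (a : A i l) := exists y, [/\ totdeg E (i%:Z + (b + l%:Z) - 1) y,
  totfil E (b + l%:Z - 1) y, totfil E (b + l%:Z) (totd E y)
  & coord (totd E y) (i, b + l%:Z) = a].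

Local Notation cobc l := (@cob R (fun i => A i l) (fun i => d i l) _).

Lemma achievedD i l (a a' : A i l) : achieved a -> achieved a' -> achieved (a + a').
Proof.
move=> [y [ym yj dy ya]] [y' [ym' yj' dy' ya']]; exists (y + y').
by split; rewrite ?linearD; try exact: smsetD; rewrite -ya -ya'.
Qed.

Lemma cob_achieved i l (a : A i l) : cobc l a -> achieved a.
Proof.
case: i a => [|i] a /= => [->|[c ->]].
  exists 0; split; rewrite ?linear0; try exact: smset0.
  by [].
exists (inc c); rewrite totd_inc; split.
- have -> : i.+1%:Z + (b + l%:Z) - 1 = i%:Z + (b + l%:Z) by lia.
  exact: inc_deg.
- by apply: totfilW (inc_fil c); lia.
- apply: smsetD; first exact: inc_fil.
  by apply: smsetZ; apply: totfilW (inc_fil _); lia.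
rewrite -[LHS]/(coord (inc (d i l c)) (i.+1, b + l%:Z) +
  ((-1) ^+ i * nu) *: coord (inc (h i l c)) (i.+1, b + l%:Z)).
rewrite coord_inc coord_inc_out ?scaler0 ?addr0 //.
by apply/eqP => -[]; lia.
Qed.

Lemma vert_achieved i l (v : A i l) : d i l v = 0 -> achieved (nu *: h i l v).
Proof.
move=> dv; have dE : totd E ((-1) ^+ i *: inc v) = nu *: inc (h i l v).
  by rewrite linearZ /= totd_inc dv linear0 add0r scalerA mulrA -expr2 sqrr_sign mul1r.
exists ((-1) ^+ i *: inc v); rewrite dE; split.
- have -> : i%:Z + (b + l.+1%:Z) - 1 = i%:Z + (b + l%:Z) by lia.
  by apply: smsetZ; exact: inc_deg.
- by apply: smsetZ; apply: totfilW (inc_fil v); lia.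
- by apply: smsetZ; exact: inc_fil.
by rewrite -[LHS]/(nu *: coord (inc _) _) coord_inc.
Qed.

(** The leading terms of elements of Z_2: a is a cocycle of the column, and the next
    differential sends it to a coboundary. *)
Definition lead_cycle i l (a : A i l) := d i l a = 0 /\ cobc l.+1 (nu *: h i l a).

Lemma zcycles_lead i l (x : tot E) : zcycles E 2 (b + l%:Z) (i%:Z + (b + l%:Z)) x ->
  lead_cycle (coord x (i, b + l%:Z)).
Proof.
move=> [xm xj xr]; split.
  have := xr i.+1 (b + l%:Z); rewrite totd_coordS [coord x (i.+1, _)]xj ?linear0 ?scaler0 ?addr0.
    by apply; lia.
  by lia.
have := xr i (b + l.+1%:Z); case: i {xm} => [|i] /=.
  by rewrite totd_coord0 hE; apply; lia.
rewrite totd_coordS hE => e; exists ((-1) ^+ i *: coord x (i, b + l.+1%:Z)).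
have {e} /eqP := e ltac:(lia); rewrite addr_eq0 => /eqP dc.
rewrite [RHS]linearZ /= dc.
by rewrite scalerN !scalerA exprS mulN1r mulrN -expr2 sqrr_sign mulN1r scaleNr opprK.
Qed.

(** The leading terms of elements of B_2: coboundaries of the column plus the image of d_1. *)
Definition lead_bound i l : A i l -> Prop :=
  match l with
  | 0 => fun a => cobc 0 a
  | l'.+1 => fun a => exists2 v : A i l', d i l' v = 0 & cobc l'.+1 (a - nu *: h i l' v)
  end.

Lemma lead_bound_cob i l (a : A i l) : cobc l a -> lead_bound a.
Proof.
case: l a => [|l] a //= ca; exists 0; first exact: linear0.
by rewrite linear0 scaler0 subr0.
Qed.

Hypothesis below : forall i j (x : E i j), j < b -> x = 0.

(** Membership in B_2 depends on the leading term alone, since elements of Z_2 with leading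
    term 0 belong to Z_1 of the next filtration step. *)
Lemma zbounds_lead i l (x : tot E) : zcycles E 2 (b + l%:Z) (i%:Z + (b + l%:Z)) x ->
  (zbounds E 2 (b + l%:Z) (i%:Z + (b + l%:Z)) x <-> lead_bound (coord x (i, b + l%:Z))).
Proof.
move=> [xm xj xr]; split=> [[u [v [[_ uj _] [vm vj vr] xE]]]|xb].
  have -> : coord x (i, b + l%:Z) = coord (totd E v) (i, b + l%:Z).
    rewrite xE -[LHS]/(coord u _ + coord (totd E v) _) uj ?add0r //; lia.
  case: l {x xm xj xr xE u uj} v vm vj vr => [|l] v vm vj vr /=.
    have v0 i' : bd' E i' (b + 0%:Z) (coord v (i', b + 0%:Z - 1)) = 0.
      by rewrite (below (coord v _)) ?linear0 //=; lia.
    case: i vm => [|i] vm /=; first by rewrite totd_coord0 v0.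
    by exists (coord v (i, b + 0%:Z)); rewrite totd_coordS v0 scaler0 [LHS]addr0.
  have dv i' : d i' l (coord v (i', b + l%:Z)) = 0.
    have := vr i'.+1 (b + l%:Z); rewrite totd_coordS.
    by rewrite (vj i'.+1) ?linear0 ?scaler0 ?addr0; [apply; lia|lia].
  exists ((-1) ^+ i *: coord v (i, b + l%:Z)); first by rewrite linearZ /= dv scaler0.
  rewrite (linearZ_LR (h i l)) /=; case: i vm => [|i] vm.
    by rewrite totd_coord0 hE expr0 scale1r subrr.
  exists (coord v (i, b + l.+1%:Z)); rewrite totd_coordS hE scalerA mulrC -scalerA.
  by rewrite scalerA mulrC -scalerA addrK.
have : achieved (coord x (i, b + l%:Z)).
  case: l x {xm xj xr} xb => [|l] x /= xb; first exact: cob_achieved.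
  have [v dv /cob_achieved ca] := xb.
  by have := achievedD ca (vert_achieved dv); rewrite subrK.
move=> [y [ym yj dy yE]]; exists (x - totd E y), y; split; last by rewrite subrK.
  have xym : totdeg E (i%:Z + (b + l%:Z)) (x - totd E y).
    by apply: smsetB => //; have := totd_deg ym; rewrite subrK.
  split=> //.
    apply: totfil_next xym _ _; first exact: smsetB.
    by rewrite -[LHS]/(coord x _ - coord (totd E y) _) yE subrr.
  by rewrite linearB totdK subr0; apply: totfilW xr; lia.
by split=> //; [apply: totfilW yj; lia|apply: totfilW dy; lia].
Qed.

Section Pages.
Variables i l : nat.
Hypothesis lead_lift : forall a : A i l, lead_cycle a ->
  exists z, [/\ cocycles E (i%:Z + (b + l%:Z)) z, totfil E (b + l%:Z) z
               & coord z (i, b + l%:Z) = a].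

Lemma lead_zcycles a : lead_cycle a -> exists2 z,
  zcycles E 2 (b + l%:Z) (i%:Z + (b + l%:Z)) z & coord z (i, b + l%:Z) = a.
Proof.
move=> /lead_lift [z [[zm dz] zj za]]; exists z => //.
by split=> //; rewrite dz; exact: smset0.
Qed.

Lemma page_trivial : (forall a : A i l, lead_cycle a -> lead_bound a) ->
  forall q : page E 2 i (b + l%:Z), q = 0.
Proof.
move=> triv; apply/subq_trivial => z zz; apply/zbounds_lead => //.
by apply: triv; exact: zcycles_lead.
Qed.

Lemma page_cyclic c (a0 : A i l) : lead_cycle a0 ->
    (forall a, lead_cycle a -> exists r, lead_bound (a - r *: a0)) ->
    (forall r : R, lead_bound (r *: a0) <-> exists y, r = y * c) ->
  lisom (page E 2 i (b + l%:Z)) (cyclic_mod c).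
Proof.
move=> /lead_zcycles [z zz za] gen ann.
apply: (subq_cyclic (z := z)) => // [x xz|r].
  have [r xr] := gen _ (zcycles_lead xz); exists r; apply/zbounds_lead.
    by apply: smsetB => //; exact: smsetZ.
  by rewrite -[coord _ _]/(coord x _ - r *: coord z _) za.
rewrite -ann -za; apply: zbounds_lead; exact: smsetZ.
Qed.
End Pages.

Lemma page_negative (i j : int) : i < 0 -> forall q : page E 2 i j, q = 0.
Proof.
move=> i0; apply/subq_trivial => z [zm zj _].
have -> : z = 0; last exact: smset0.
apply: tot_ext => i' j'; have [/zj ->//|jj] := ltP j' j.
by apply: zm; apply/eqP; lia.
Qed.

Lemma page_outside (i j : int) : (forall i (x : E i j), x = 0) ->
  forall q : page E 2 i j, q = 0.
Proof.
move=> j0; apply/subq_trivial => z [zm zj zr].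
exists z, 0; split; [|exact: smset0|by rewrite linear0 addr0].
split=> //; last by apply: totfilW zr; lia.
move=> i' j' jj; have [/zj ->//|j'j] := ltP j' j.
by have -> : j' = j by [lia|]; exact: j0.
Qed.
End Bicomplex.

(** * Grids in which every leading cycle lifts *)

Section GridSequence.
Variables (R : comNzRingType) (E : bicomplex R) (b : int) (q : nat).
Local Notation p := q.+1.
Local Notation A i l := (E i (b + l%:Z)).
Local Notation d i l := (bd E i (b + l%:Z)).
Variables (nu : R) (h : forall i l, {linear A i l -> A i l.+1}).

(** What the computation of the spectral sequence uses of D': a strip of p + 1 columns, the
    inner ones acyclic in positive degrees, and a vertical differential nu h with nu
    divisible by p, where p kills the cohomology of the top column modulo the image
    of the invariants. *)
Record koszul_grid := KoszulGrid {
  kg_nu : exists nu0, nu = p%:R * nu0;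
  kg_q : (1 < q)%N;
  kg_bounded : forall i j (x : E i j), ~ (b <= j <= b + p%:Z) -> x = 0;
  kg_vertical : forall i l (x : tot E), bd' E i (b + l.+1%:Z)
    (coord x (i, b + l.+1%:Z - 1)) = nu *: h i l (coord x (i, b + l%:Z));
  kg_hh : forall i l (x : A i l), h i l.+1 (h i l x) = 0;
  kg_dh : forall i l (x : A i l), d i l.+1 (h i l x) = h i.+1 l (d i l x);
  kg_acyclic : forall i l, (0 < l < p)%N ->
    forall x : A i.+1 l, d i.+1 l x = 0 -> exists y, x = d i l y;
  kg_torsion : forall i (x : A i.+1 p), d i.+1 p x = 0 ->
    exists y, p%:R *: x = d i p y;
  kg_inj : forall l, (1 < l < p)%N ->
    forall x : A 0 l, d 0 l x = 0 -> h 0 l x = 0 -> x = 0;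
  kg_top : forall x : A 0 p, d 0 p x = 0 ->
    exists2 v : A 0 q, d 0 q v = 0 & p%:R *: x = h 0 q v
}.

Hypothesis G : koszul_grid.
Let q_gt1 := kg_q G.
Let bounded := kg_bounded G.
Let hE := kg_vertical G.
Let hh := kg_hh G.
Let dh := kg_dh G.
Let acyclic := kg_acyclic G.
Let top_torsion := kg_torsion G.
Let inv_inj := kg_inj G.
Let inv_top := kg_top G.

Local Notation inc := (@inc R E b _ _).

Let below i j (x : E i j) : j < b -> x = 0.
Proof. by move=> jb; apply: bounded; lia. Qed.

Let top0 i (x : A i p.+1) : x = 0.
Proof. by apply: bounded => /=; lia. Qed.

Definition lifts i l (a : A i l) := exists z, [/\ cocycles E (i%:Z + (b + l%:Z)) z,
  totfil E (b + l%:Z) z & coord z (i, b + l%:Z) = a].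

Lemma lifts_cob i l (c : A i l) : lifts (d i l c).
Proof.
exists (totd E (inc c)); split.
- split; last exact: totdK.
  have -> : i.+1%:Z + (b + l%:Z) = i%:Z + (b + l%:Z) + 1 by lia.
  by apply: totd_deg; exact: inc_deg.
- rewrite (totd_inc hE); apply: smsetD; first exact: inc_fil.
  by apply: smsetZ; apply: totfilW (inc_fil _); lia.
rewrite totd_coordS coord_inc coord_inc_out ?linear0 ?scaler0 ?[LHS]addr0 //.
by apply/eqP => -[]; lia.
Qed.

Lemma lifts_single i l (a : A i l) : d i l a = 0 -> nu *: h i l a = 0 -> lifts a.
Proof.
move=> da ha; exists (inc a); split; [split| exact: inc_fil|exact: coord_inc].
  exact: inc_deg.
have h0 : nu *: inc (h i l a) = 0 by rewrite -linearZ /= ha linear0.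
by rewrite (totd_inc hE) da linear0 add0r -scalerA h0 scaler0.
Qed.

(** Stage l of the zigzag: x has leading term a, and D x consists of a single obstruction in
    column l + 1, divisible by nu ^+ l.+1.  The zigzag may stop early with a cocycle, when
    it meets row 0. *)
Lemma zigzag i (a : A i.+1 0) l : d i.+1 0 a = 0 -> (l < p)%N ->
  lifts a \/ exists i' x (o : A i' l.+1), [/\ i.+1 = (i' + l)%N,
    totdeg E (i.+1%:Z + (b + 0%:Z)) x /\ coord x (i.+1, b + 0%:Z) = a,
    d i' l.+1 o = 0, h i' l.+1 o = 0 & totd E x = nu ^+ l.+1 *: inc o].
Proof.
move=> da; elim: l => [|l IHl] lp.
  right; exists i.+1, (inc a), ((-1) ^+ i.+1 *: h _ _ a); split=> //.
  - by rewrite addn0.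
  - by split; [exact: inc_deg|exact: coord_inc].
  - by rewrite linearZ /= dh da linear0 scaler0.
  - by rewrite linearZ /= hh scaler0.
  by rewrite (totd_inc hE) da linear0 add0r linearZ /= scalerA mulrC.
have [|[i' [x [o [iE [xm xa] eo ho dx]]]]] := IHl (ltnW lp); first by left.
(* row 0 is reached with l = i.+1 > 0, so o lies in a column beyond column 1 *)
case: i' o iE eo ho dx => [|i'] o iE eo ho dx.
  left; exists x; split=> //; last first.
    by move=> i1 j1 jb; apply: below => /=; lia.
  have o0 : o = 0 by apply: inv_inj eo ho; lia.
  by split=> //; rewrite dx o0 linear0 scaler0.
right; have [|c oE] := acyclic (i := i') (l := l.+1) _ eo; first by rewrite lp.
exists i', (x - nu ^+ l.+1 *: inc c), (- (-1) ^+ i' *: h _ _ c); split.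
- by rewrite iE addSnnS.
- split.
    apply: smsetB => //; apply: smsetZ.
    have -> : i.+1%:Z + (b + 0%:Z) = i'%:Z + (b + l.+1%:Z) by lia.
    exact: inc_deg.
  rewrite -[LHS]/(coord x _ - nu ^+ l.+1 *: coord (inc c) _) xa coord_inc_out.
    by rewrite scaler0 [LHS]subr0.
  by apply/eqP => -[_]; lia.
- by rewrite linearZ /= dh -oE ho scaler0.
- by rewrite linearZ /= hh scaler0.
rewrite linearB linearZ /= (totd_inc hE) dx -oE scalerDr opprD addrA subrr add0r.
by rewrite [in RHS]linearZ /= !scalerA -scaleNr !exprSr; congr (_ *: _); ring.
Qed.

(** After the last stage the obstruction nu ^+ p o lies in the top column.  With
    nu = p nu0, one factor p turns o into a coboundary d c or, in row 0, into h v for a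
    cocycle v; the correction of x is then a multiple of c or of v. *)
Lemma lifts_bottom i (a : A i 0) : lead_cycle nu h a -> lifts a.
Proof.
case: i a => [|i] a [da hda]; first exact: lifts_single.
have [nu0 nuE] := kg_nu G.
have [//|[i' [x [o [iE [xm xa] eo _ dx]]]]] := zigzag da (ltnSn q).
have fix_x (y : tot E) : totdeg E (i.+1%:Z + (b + 0%:Z)) y ->
    coord y (i.+1, b + 0%:Z) = 0 -> totd E x = totd E y -> lifts a.
  move=> ym y0 dxy; exists (x - y); split.
  - by split; [exact: smsetB|rewrite linearB dxy subrr].
  - by move=> i1 j1 jb; apply: below => /=; lia.
  by rewrite -[LHS]/(coord x _ - coord y _) xa y0 [LHS]subr0.
case: i' o iE eo dx => [|i'] o iE eo dx.
  have [v dv hv] := inv_top eo.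
  apply: (fix_x (nu ^+ q.-1 *: (nu0 *: inc v))).
  - do 2!apply: smsetZ; have -> : i.+1%:Z + (b + 0%:Z) = 0%:Z + (b + q%:Z) by lia.
    exact: inc_deg.
  - rewrite -[LHS]/(nu ^+ q.-1 *: (nu0 *: coord (inc v) _)) coord_inc_out ?scaler0 //.
  have dv' : totd E (inc v) = (nu * p%:R) *: inc o.
    rewrite (totd_inc hE) dv linear0 add0r expr0 mul1r -hv (linearZ_LR (inc)) /=.
    by rewrite scalerA.
  rewrite dx !(linearZ_LR (totd E)) /= dv' !scalerA; congr (_ *: _).
  have -> : nu ^+ q.+1 = nu ^+ q.-1 * nu * nu by rewrite -exprSr prednK ?exprSr //; lia.
  by rewrite [X in _ * X]nuE; ring.
have [c oc] := top_torsion eo.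
apply: (fix_x (nu ^+ q *: (nu0 *: inc c))).
- do 2!apply: smsetZ; have -> : i.+1%:Z + (b + 0%:Z) = i'%:Z + (b + p%:Z) by lia.
  exact: inc_deg.
- rewrite -[LHS]/(nu ^+ q *: (nu0 *: coord (inc c) _)) coord_inc_out ?scaler0 //.
  by apply/eqP => -[]; lia.
have dc : totd E (inc c) = p%:R *: inc o.
  rewrite (totd_inc hE) (top0 (h _ _ c)) linear0 scaler0 addr0 -oc.
  by rewrite (linearZ_LR (inc)).
rewrite dx !(linearZ_LR (totd E)) /= dc !scalerA; congr (_ *: _).
by rewrite exprSr [X in _ * X]nuE; ring.
Qed.

Lemma leads_lift i l (a : A i l) : (l <= p)%N -> lead_cycle nu h a -> lifts a.
Proof.
case: l a => [|l] a lp; first exact: lifts_bottom.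
move=> [da hda]; case: i a da hda => [|i] a da hda; first exact: lifts_single.
have [lp'|pl] := ltnP l.+1 p.
  by have [|c ->] := acyclic _ da; [rewrite lp'|exact: lifts_cob].
apply: lifts_single => //.
have lq : l = q by lia.
by subst l; rewrite (top0 (h _ _ a)) scaler0.
Qed.

Lemma grid_liftable : liftable E.
Proof.
move=> j m x [xm xj xr].
have same : totfil E (j + 1) x -> exists v,
    [/\ totdeg E m v, totfil E (j + 1) v & totd E (x - v) = 0].
  by move=> xj1; exists x; rewrite subrr linear0.
have [mj|jm] := ltP m j.
  apply: same => i' j' jj; have [/xj ->//|j'j] := ltP j' j.
  by apply: xm; apply/eqP; lia.
have [i mE] : exists i : nat, m = i%:Z + j by exists (absz (m - j)%R); lia.
subst m; have [jb|jb] := boolP (b <= j <= b + p%:Z); last first.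
  by apply: same; apply: totfil_next xm xj _; apply: bounded; apply/negP.
have [l jE] : exists l : nat, j = b + l%:Z by exists (absz (j - b)%R); lia.
subst j; have lp : (l <= p)%N by lia.
have [|z [[zm dz] zj za]] := leads_lift (a := coord x (i, b + l%:Z)) lp.
  by apply: (zcycles_lead hE).
exists (x - z); split; first exact: smsetB.
  apply: (totfil_next (i := i)); [exact: smsetB|exact: smsetB|].
  by rewrite -[LHS]/(coord x _ - coord z _) za subrr.
by rewrite opprB addrC subrK dz.
Qed.

Notation coh l i c := (@cyclic_coh R (fun j => A j l%N) (fun j => d j l%N) i c).

Lemma page_middle i l : (0 < l < p)%N -> forall x : page E 2 i.+1 (b + l%:Z), x = 0.
Proof.
move=> lp; apply: (page_trivial hE) => // a [da _].
by apply: lead_bound_cob; apply: acyclic.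
Qed.

Lemma page_bottom i c : coh 0 i.+1 c ->
  lisom (page E 2 i.+1 (b + 0%:Z)) (cyclic_mod c).
Proof.
move=> [z [dz gen ann]].
have lift (a : A i.+1 0) := @leads_lift i.+1 0%N a (leq0n p).
apply: (page_cyclic hE below lift (a0 := z)) => [|a [da _]|r].
- have hz : d i.+1 1%N (h _ _ z) = 0 by rewrite dh dz linear0.
  split=> //=; have [|y ->] := acyclic _ hz; first by lia.
  by exists (nu *: y); rewrite linearZ.
- exact: gen.
exact: ann.
Qed.

Lemma page_bottom0 i : coh 0 i.+1 1 -> forall x : page E 2 i.+1 (b + 0%:Z), x = 0.
Proof.
move=> /cyclic_coh1 ex; apply: (page_trivial hE) => // a [da _].
exact: ex.
Qed.

Lemma top_bound i (a : A i.+1 p) : lead_bound nu h a <->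
  @cob R (fun i => A i p) (fun i => d i p) i.+1 a.
Proof.
split=> [[v dv [y ay]]|]; last exact: lead_bound_cob.
have [|w vE] := acyclic (i := i) (l := q) _ dv; first by rewrite /=; lia.
exists (y + nu *: h _ _ w); rewrite linearD linearZ /= dh -vE -ay.
by rewrite subrK.
Qed.

Lemma page_top i c : coh p i.+1 c ->
  lisom (page E 2 i.+1 (b + p%:Z)) (cyclic_mod c).
Proof.
move=> [z [dz gen ann]].
have lift (a : A i.+1 p) := @leads_lift i.+1 p a (leqnn p).
apply: (page_cyclic hE below lift (a0 := z)) => [|a [da _]|r].
- split=> //; rewrite (top0 (h _ _ z)) scaler0.
  exact: cob0.
- have [r ar] := gen a da; exists r; exact/top_bound.
by rewrite top_bound.
Qed.

Lemma page_top0 i : coh p i.+1 1 -> forall x : page E 2 i.+1 (b + p%:Z), x = 0.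
Proof.
move=> /cyclic_coh1 ex; apply: (page_trivial hE) => // a [da _].
by apply/top_bound; exact: ex.
Qed.

Lemma page_row0_trivial l : (forall a : A 0 l, d 0 l a = 0 -> nu *: h 0 l a = 0 -> a = 0) ->
  forall x : page E 2 0%N (b + l%:Z), x = 0.
Proof.
move=> triv; apply: (page_trivial hE) => // a [da ha].
by rewrite (triv a da ha); apply: lead_bound_cob; exact: cob0.
Qed.

Lemma page_row0_cyclic l (z : A 0 l.+1) c : (l < p)%N -> d 0 l.+1 z = 0 ->
    nu *: h 0 l.+1 z = 0 ->
    (forall x : A 0 l.+1, d 0 l.+1 x = 0 -> exists r, x = r *: z) ->
    (forall r, (exists2 v : A 0 l, d 0 l v = 0 & r *: z = nu *: h 0 l v) <->
       exists y, r = y * c) ->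
  lisom (page E 2 0%N (b + l.+1%:Z)) (cyclic_mod c).
Proof.
move=> lp dz hz gen ann.
have lift (a : A 0 l.+1) := @leads_lift 0%N l.+1 a lp.
apply: (page_cyclic hE below lift (a0 := z)) => [|a [/gen [r ->] _]|r] //.
  exists r; apply: lead_bound_cob; rewrite subrr; exact: cob0.
rewrite -ann; split=> -[v dv /=].
  by move=> /subr0_eq; exists v.
by move=> rz; exists v; rewrite // rz subrr.
Qed.

Lemma koszul_grid_of_torsion_klapses : collapses_at E 2.
Proof. exact: liftable_collapses grid_liftable. Qed.

Lemma grid_no_extension_problems :
  (forall m, exists j0, forall j, j <> j0 -> forall x : page E 2 (m - j) j, x = 0) ->
  no_extension_problems E 2.
Proof. exact: (one_term_no_extension_problems grid_liftable bounded). Qed.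

Lemma page_range (i j : int) : (forall (i' l : nat), i = i'%:Z -> j = b + l%:Z ->
    (l <= p)%N -> forall x : page E 2 i'%:Z (b + l%:Z), x = 0) ->
  forall x : page E 2 i j, x = 0.
Proof.
move=> range; have [i0|i0] := ltP i 0; first exact: page_negative.
have [jb|/negP jb] := boolP (b <= j <= b + p%:Z); last first.
  by apply: page_outside => i' x; exact: bounded.
have [i' iE] : exists i' : nat, i = i'%:Z by exists (absz i); lia.
have [l jE] : exists l : nat, j = b + l%:Z by exists (absz (j - b)%R); lia.
by subst i j; apply: range => //; lia.
Qed.
End GridSequence.

(** * The bicomplex of equivariant maps as a grid *)

Section HomGrid.
Variables (R : comNzRingType) (p n : nat) (k : int).
Variable W : gresolution R 'S_p.
Local Notation C := (Cnk n k).
Local Notation P := (tcol R p n k).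
Local Notation T := {ffun 'I_p -> bool}.
Local Notation A i l := (ghom (W i) (P l)).
Local Notation d i l := (ghom_pre (P l) (rd W i)).
Local Notation h i l := (ghom_post (W i) (row_dif R p n k l)).
Local Notation E := (hom_bicomplex W (tpow_gcochain R p C)).

Lemma ntrue_le (f : T) : (ntrue f <= p)%N.
Proof. by rewrite -[X in (_ <= X)%N]card_ord; exact: max_card. Qed.

Lemma hom_bounded i j (x : E i j) : ~ (base p k <= j <= base p k + p%:Z) -> x = 0.
Proof.
move=> jb; apply: ghomP => w; apply: (@coef_inj R (tpow p C)) => f /= fj.
by case: jb; rewrite -fj tdeg_ntrue; have := ntrue_le f; lia.
Qed.

(** The source of this differential has index b + l.+1 - 1, which is equal but not
    convertible to b + l. *)
Lemma hom_vertical i l (x : tot E) :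
  bd' E i (base p k + l.+1%:Z) (coord x (i, base p k + l.+1%:Z - 1)) =
  n%:R *: h i l (coord x (i, base p k + l%:Z)).
Proof.
have jE : base p k + l.+1%:Z - 1 = base p k + l%:Z by lia.
apply: ghomP => w.
rewrite -[LHS]/(bmap R (C := tpow p C) (@tdif p C) (base p k + l.+1%:Z - 1)
  (base p k + l.+1%:Z) (ghom_fun (coord x (i, base p k + l.+1%:Z - 1)) w)) jE.
rewrite -[RHS]/(n%:R *: bmap R (C := tpow p C) (@tdif p (Cnk 1 k)) (base p k + l%:Z)
  (base p k + l.+1%:Z) (ghom_fun (coord x (i, base p k + l%:Z)) w)).
apply: (@coef_inj R (tpow p C)) => f fl; rewrite coefZ !coef_bmap // mulr_sumr.
by apply: eq_bigr => g _; rewrite [tdif g f]tdif_Cnk intrM -mulrA.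
Qed.

Lemma hom_hh i l (x : A i l) : h i l.+1 (h i l x) = 0.
Proof. by apply: ghomP => w; exact: row_difK. Qed.

Lemma hom_dh i l (x : A i l) : d i l.+1 (h i l x) = h i.+1 l (d i l x).
Proof. exact: ghomP. Qed.

Lemma hom_dd i l (x : A i l) : d i.+1 l (d i l x) = 0.
Proof. exact: (@bdd R E i (base p k + l%:Z) x). Qed.

Hypothesis p_gt0 : (0 < p)%N.

Lemma hom_h_inj i (x : A i 0) : h i 0 x = 0 -> x = 0.
Proof.
move=> hx; apply: ghomP => w; apply: row_dif_inj => //.
by rewrite -ghom_compE -[ghom_comp _ _]/(h i 0%N x) hx.
Qed.

Lemma hom_h_exact i l (x : A i l.+1) : h i l.+1 x = 0 -> exists y, x = h i l y.
Proof.
move=> hx; have [| |y <-] := ghom_post_exact (f := row_dif R p n k l) _ _ hx.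
- exact: rfree.
- by move=> m; exact: row_dif_exact.
by exists y.
Qed.

Lemma hom_acyclic : prime p ->
    (forall N, coprime p N -> exists u : R, u * N%:R = 1) ->
  forall i l, (0 < l < p)%N -> forall x : A i.+1 l, d i.+1 l x = 0 -> exists y, x = d i l y.
Proof.
move=> p_prime unitP i l lp x dx.
have [theta avg] := relatively_projective n k p_prime unitP lp.
by have [y] := averaged_exact avg dx; rewrite scale1r => <-; exists y.
Qed.

Lemma hom_above i l (x : A i l) : (p < l)%N -> x = 0.
Proof. by move=> pl; apply: (@hom_bounded i (base p k + l%:Z)); lia. Qed.

Lemma hom_torsion_free i l (x : A i l) r :
    (forall r (a : R), (0 < r)%N -> a *+ r = 0 -> a = 0) -> (0 < r)%N ->
  r%:R *: x = 0 -> x = 0.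
Proof.
move=> tf r0 rx; apply: ghomP => w; apply: tcol_coef_inj => f _; rewrite coef0.
apply: (tf r) => //; have := congr1 (fun g : A i l => coef (C := tpow p C) (ghom_fun g w) f) rx.
rewrite -[LHS]/(coef (C := tpow p C) (r%:R *: ghom_fun x w) f) coefZ mulr_natl => ->.
exact: coef0.
Qed.

Lemma hom_cocycle0 l (x : A 0 l) : d 0 l x = 0 ->
  exists m (mG : invariant m), x = aug_ghom W mG.
Proof.
by move=> /ghom_pre_aug0 [m mG xE]; exists m, mG; apply: ghomP.
Qed.

Lemma aug_cocycle l (m : P l) (mG : invariant m) : d 0 l (aug_ghom W mG) = 0.
Proof. by apply/ghom_pre_aug0; exists m. Qed.

Lemma hom_cocycle0_odd l (x : A 0 l) :
    (forall r (a : R), (0 < r)%N -> a *+ r = 0 -> a = 0) ->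
    (forall b b', odd_entry k b -> odd_entry k b' -> b = b') ->
    (forall f : T, ntrue f = l -> exists a b,
       [/\ a != b, odd_entry k (f a) & odd_entry k (f b)]) ->
  d 0 l x = 0 -> x = 0.
Proof.
move=> tf odd1 two /hom_cocycle0 [m [mG ->]].
suff m0 : m = 0 by apply: ghomP => w; rewrite -[LHS]/((_ : R) *: m) m0 scaler0.
apply: tcol_coef_inj => f /two [a [b [ab oa ob]]]; rewrite coef0.
exact: odd_pair_invariant oa ob.
Qed.

Section Even.
Variable l : nat.
Hypothesis ev : forall f : T, ntrue f = l -> @even_sign p n k f.
Hypothesis lp : (l <= p)%N.

(** The invariant orbit sum as a generator of the cohomology in degree 0. *)
Definition orbit_cocycle : A 0 l := aug_ghom W (orbit_sum_invariant R ev).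

Lemma orbit_cocycleP : d 0 l orbit_cocycle = 0.
Proof. exact: aug_cocycle. Qed.

Lemma orbit_cocycle_gen (x : A 0 l) : d 0 l x = 0 -> exists r, x = r *: orbit_cocycle.
Proof.
move=> /hom_cocycle0 [m [mG ->]]; have [r mE] := invariantE ev lp mG.
exists r; apply: ghomP => w.
rewrite -[LHS]/((ghom_fun (raug W) w : R) *: m).
rewrite -[RHS]/(r *: ((ghom_fun (raug W) w : R) *: orbit_sum R p n k l)).
by rewrite mE !scalerA mulrC.
Qed.

Lemma orbit_cocycle_free (r : R) : r *: orbit_cocycle = 0 -> r = 0.
Proof.
move=> r0; have [w wE] := raug_surj W 1.
apply: (orbit_sum_free (n := n) (k := k) lp).
have := congr1 (fun f : A 0 l => ghom_fun f w) r0.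
rewrite -[LHS]/(r *: ((ghom_fun (raug W) w : R) *: orbit_sum R p n k l)) wE.
by rewrite scale1r.
Qed.
End Even.

Lemma h_orbit_cocycle l (ev : forall f : T, ntrue f = l -> @even_sign p n k f)
    (ev' : forall f : T, ntrue f = l.+1 -> @even_sign p n k f) :
    (forall (g : T) i j, ntrue g = l -> ~~ g i -> j != i ->
       degsign (C := Cnk 1 k) (g j) = 1) ->
  h 0 l (orbit_cocycle ev) = l.+1%:R *: orbit_cocycle ev'.
Proof.
move=> dsg; apply: ghomP => w; rewrite ghom_compE.
rewrite -[ghom_fun (orbit_cocycle ev) w]/((ghom_fun (raug W) w : R) *: orbit_sum R p n k l).
rewrite linearZ /= row_dif_orbit_sum //.
rewrite -[RHS]/(l.+1%:R *: ((ghom_fun (raug W) w : R) *: orbit_sum R p n k l.+1)).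
by rewrite !scalerA mulrC.
Qed.
End HomGrid.

(** * Lines on which the symmetric group acts by a character *)

Lemma cyclic_coh_transport (R : comNzRingType) (A B : nat -> lmodType R)
    (dA : forall i, {linear A i -> A i.+1}) (dB : forall i, {linear B i -> B i.+1})
    (f : forall i, {linear A i -> B i}) (g : forall i, {linear B i -> A i}) :
    (forall i, cancel (f i) (g i)) -> (forall i, cancel (g i) (f i)) ->
    (forall i x, f i.+1 (dA i x) = dB i (f i x)) ->
  forall i c, cyclic_coh dA i c -> cyclic_coh dB i c.
Proof.
move=> fK gK fd i c [z [dz gen ann]].
have gd j x : g j.+1 (dB j x) = dA j (g j x) by rewrite -{1}[x]gK -fd fK.
have fcob j x : cob dA x -> cob dB (f j x).
  by case: j x => [|j] x /=; [move=> ->; rewrite linear0|case=> y ->; exists (f j y); rewrite fd].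
have gcob j x : cob dB x -> cob dA (g j x).
  by case: j x => [|j] x /=; [move=> ->; rewrite linear0|case=> y ->; exists (g j y); rewrite gd].
exists (f i z); split=> [|x dx|r].
- by rewrite -fd dz linear0.
- have [|r xr] := gen (g i x); first by rewrite -gd dx linear0.
  by exists r; have := fcob _ _ xr; rewrite linearB linearZ /= gK.
rewrite -ann; split=> [/gcob|/fcob]; rewrite linearZ //=.
by rewrite fK.
Qed.

(** The end columns are lines spanned by a constant tensor, and the Koszul sign of a
    constant tensor depends only on the absolute degree of its factors.  This identifies
    the bottom column for k = 0 with the top one for k = 1, and conversely. *)
Section Lines.
Variables (R : comNzRingType) (p n : nat).
Local Notation T := {ffun 'I_p -> bool}.

Definition line_level (b : bool) : nat := if b then p else 0.
Definition line_tensor (b : bool) : T := [ffun=> b].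

Lemma ntrue_line b : ntrue (line_tensor b) = line_level b.
Proof.
rewrite /ntrue; case: b; last by apply: eq_card0 => i; rewrite !inE ffunE.
by rewrite -[RHS]card_ord; apply: eq_card => i; rewrite !inE ffunE.
Qed.

Lemma line_tensorE b (f : T) : ntrue f = line_level b -> f = line_tensor b.
Proof.
move=> fb; apply/ffunP => i; rewrite ffunE; case: b fb => /= fb.
  have /setP /(_ i) : [set i | f i] = [set: 'I_p].
    by apply/eqP; rewrite eqEcard finset.subsetT cardsT card_ord [X in (_ <= X)%N]fb /=.
  by rewrite !inE.
have /setP /(_ i) : [set i | f i] = finset.set0 by apply/cards0_eq.
by rewrite !inE.
Qed.

Lemma koszul_line k k' b b' s : `|Cnk_deg k b|%N = `|Cnk_deg k' b'|%N ->
  @koszul p (Cnk n k) s (line_tensor b) = @koszul p (Cnk n k') s (line_tensor b').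
Proof. by move=> bb'; apply: eq_bigr => ab _; rewrite !ffunE /= bb'. Qed.

Section Map.
Variables (k k' : int) (b b' : bool).
Hypothesis bb' : `|Cnk_deg k b|%N = `|Cnk_deg k' b'|%N.
Local Notation P := (tcol R p n k (line_level b)).
Local Notation P' := (tcol R p n k' (line_level b')).
Local Notation cf j x f := (@coef R (tpow p (Cnk n j)) _ x f).

Definition line_fun (x : P) : P' :=
  of_coef (C := tpow p (Cnk n k')) _ (fun=> cf k x (line_tensor b)).

Lemma coef_line x : cf k' (line_fun x) (line_tensor b') = cf k x (line_tensor b).
Proof. by rewrite of_coefK //= tdeg_ntrue ntrue_line. Qed.

Lemma line_ghom : ghom_sub P P' line_fun.
Proof.
have fix_line j c s : @tact_bas p (Cnk n j) s (line_tensor c) = line_tensor c.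
  by apply/ffunP => i; rewrite !ffunE.
split=> [a x y|s x]; apply: tcol_coef_inj => f /line_tensorE ->.
  by rewrite coefP !coef_line coefP.
rewrite coef_line -{1}(fix_line k b s) -[X in _ = cf k' _ X](fix_line k' b' s).
by rewrite !coef_gact coef_line (koszul_line s bb').
Qed.
Definition line_map : ghom P P' := insm line_ghom.
End Map.

Lemma line_mapK k k' b b' (bb' : `|Cnk_deg k b|%N = `|Cnk_deg k' b'|%N) x :
  ghom_fun (line_map (esym bb')) (ghom_fun (line_map bb') x) = x.
Proof.
apply: tcol_coef_inj => f /line_tensorE ->.
rewrite -[LHS]/(@coef R (tpow p (Cnk n k)) _ (line_fun k b (line_fun k' b' x)) _).
by rewrite !coef_line.
Qed.

Lemma coh_line (W : gresolution R 'S_p) k k' b b' i c :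
    `|Cnk_deg k b|%N = `|Cnk_deg k' b'|%N ->
  @cyclic_coh R (fun i => ghom (W i) (tcol R p n k (line_level b)))
    (fun i => ghom_pre _ (rd W i)) i c ->
  @cyclic_coh R (fun i => ghom (W i) (tcol R p n k' (line_level b')))
    (fun i => ghom_pre _ (rd W i)) i c.
Proof.
move=> bb'; apply: (cyclic_coh_transport
  (f := fun i => ghom_post (W i) (line_map bb'))
  (g := fun i => ghom_post (W i) (line_map (esym bb')))).
- by move=> j x; apply: ghomP => w; exact: line_mapK.
- by move=> j x; apply: ghomP => w; exact: (line_mapK (esym bb')).
by move=> j x; exact: ghomP.
Qed.
End Lines.

Section Parity.
Variables (p n : nat) (k : int).
Local Notation T := {ffun 'I_p -> bool}.

Definition odd_set (f : T) := [set i | odd_entry k (f i)].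

Lemma odd_set_even f : (#|odd_set f| <= 1)%N -> @even_sign p n k f.
Proof.
move=> /card_le1_eqP f1; apply: koszul_even => a b; apply: contra => /andP [oa ob].
by apply/eqP; apply: f1; rewrite inE.
Qed.

Lemma odd_set_pair f : (1 < #|odd_set f|)%N ->
  exists a b, [/\ a != b, odd_entry k (f a) & odd_entry k (f b)].
Proof. by move=> /card_gt1P [a [b [+ + ab]]]; rewrite !inE; exists a, b. Qed.
End Parity.

Lemma odd_set1 p (f : {ffun 'I_p -> bool}) : #|odd_set 1 f| = ntrue f.
Proof. by apply: eq_card => i; rewrite !inE; case: (f i). Qed.

Lemma odd_set0 p (f : {ffun 'I_p -> bool}) : #|odd_set 0 f| = (p - ntrue f)%N.
Proof.
have <- : #|~: [set i | f i]| = #|odd_set 0 f|.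
  by apply: eq_card => i; rewrite !inE; case: (f i).
have := cardsC [set i | f i]; rewrite card_ord /ntrue => cE.
by rewrite -[X in (X - _)%N]cE addKn.
Qed.

(** * Cohomology with trivial and with sign coefficients *)

Section Orders.
Variables (R : comNzRingType) (q : nat).
Local Notation p := q.+1.

(** The order of the cohomology in positive degree i with sign coefficients, and below with
    trivial coefficients, where q = p - 1; 1 stands for the zero module. *)
Definition sign_order i : R := if (i %% (2 * q) == q)%N then p%:R else 1.
Definition trivial_order i : R := if (2 * q %| i)%N then p%:R else 1.

Hypothesis q_gt0 : (0 < q)%N.

Let q_mod : (q %% (2 * q) = q)%N.
Proof. by rewrite modn_small //; lia. Qed.

Lemma trivial_order_shift i : trivial_order (i + q) = sign_order i.
Proof.
rewrite /trivial_order /sign_order /dvdn; congr (if _ then _ else _).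
by have := eqn_modDr q i q (2 * q); rewrite addnn -mul2n modnn q_mod.
Qed.

Lemma sign_order_shift i : sign_order (i + q) = trivial_order i.
Proof.
rewrite /trivial_order /sign_order /dvdn; congr (if _ then _ else _).
by have := eqn_modDr q i 0 (2 * q); rewrite add0n mod0n q_mod.
Qed.

Lemma trivial_orderE i : trivial_order ((2 * i + 2) * q) = p%:R.
Proof. by rewrite /trivial_order -mulnSr mulnAC dvdn_mulr. Qed.

Lemma trivial_order1 i : (0 < i)%N -> (forall i', i <> ((2 * i' + 2) * q)%N) -> trivial_order i = 1.
Proof.
move=> i0 ne; rewrite /trivial_order; case: dvdnP => // -[[|c] cE].
  by rewrite cE in i0.
by case: (ne c); rewrite cE; lia.
Qed.

Lemma sign_orderE i : sign_order ((2 * i + 1) * q) = p%:R.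
Proof.
rewrite /sign_order mulnDl mul1n mulnAC [(_ * i)%N]mulnC modnMDl modn_small ?eqxx //.
by lia.
Qed.

Lemma sign_order1 i : (forall i', i <> ((2 * i' + 1) * q)%N) -> sign_order i = 1.
Proof.
move=> ne; rewrite /sign_order; case: eqP => // e.
by case: (ne (i %/ (2 * q))%N); rewrite {1}(divn_eq i (2 * q)) e; lia.
Qed.

End Orders.

Section Instances.
Variables (R : comNzRingType) (q n : nat).
Local Notation p := q.+1.
Variable W : gresolution R 'S_p.
Local Notation T := {ffun 'I_p -> bool}.
Local Notation A k i l := (ghom (W i) (tcol R p n k l)).
Local Notation d k i l := (ghom_pre (tcol R p n k l) (rd W i)).
Local Notation h k i l := (ghom_post (W i) (row_dif R p n k l)).

Definition column_coh k l i c :=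
  @cyclic_coh R (fun j => A k j l) (fun j => d k j l) i c.

Lemma even_sign_k0 l : (q <= l)%N -> forall f : T, ntrue f = l -> @even_sign p n 0 f.
Proof. by move=> ql f fl; apply: odd_set_even; rewrite odd_set0 fl leq_subLR addn1. Qed.

Lemma even_sign_k1 l : (l <= 1)%N -> forall f : T, ntrue f = l -> @even_sign p n 1 f.
Proof. by move=> ql f fl; apply: odd_set_even; rewrite odd_set1 fl. Qed.

Local Notation z0 lq := (orbit_cocycle W (even_sign_k0 lq)).
Local Notation z1 lq := (orbit_cocycle W (even_sign_k1 lq)).

(** With at most one odd factor left, all signs in the differential are 1. *)
Lemma h_orbit_k0 l (ql : (q <= l)%N) (ql' : (q <= l.+1)%N) :
  h 0 0 l (z0 ql) = l.+1%:R *: z0 ql'.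
Proof.
apply: h_orbit_cocycle => // g i j gq gi ji.
have gj : g j = true.
  apply/negPn/negP => gj; have : (1 < #|odd_set 0 g|)%N.
    by apply/card_gt1P; exists i, j; rewrite !inE /odd_entry; split=> //;
      [case: (g i) gi|case: (g j) gj|rewrite eq_sym].
  by rewrite odd_set0 gq; lia.
by rewrite gj.
Qed.

Lemma h_orbit_k1 : h 1 0 0 (z1 (leq0n 1)) = z1 (leqnn 1).
Proof.
rewrite -[RHS]scale1r; apply: h_orbit_cocycle => // g i j g0 _ _.
have := g0; rewrite -[RHS]/(line_level p false) => /line_tensorE ->.
by rewrite ffunE.
Qed.
Hypothesis tf : forall r (a : R), (0 < r)%N -> a *+ r = 0 -> a = 0.

Lemma cocycle0_k0 l (x : A 0 0 l) : (l < q)%N -> d 0 0 l x = 0 -> x = 0.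
Proof.
move=> lq; apply: hom_cocycle0_odd => //; first by move=> [] [].
by move=> f fl; apply: odd_set_pair; rewrite odd_set0 fl; lia.
Qed.

Lemma cocycle0_k1 l (x : A 1 0 l) : (1 < l)%N -> d 1 0 l x = 0 -> x = 0.
Proof.
move=> lq; apply: hom_cocycle0_odd => //; first by move=> [] [].
by move=> f fl; apply: odd_set_pair; rewrite odd_set1 fl.
Qed.

(** Only the orbit sum in column q is invariant, and delta sends it to p times the one in
    column p. *)
Lemma cocycle0_k0_inj l (x : A 0 0 l) : (l < p)%N ->
  d 0 0 l x = 0 -> h 0 0 l x = 0 -> x = 0.
Proof.
move=> lp dx hx; have [lq|ql] := ltnP l q; first exact: cocycle0_k0 dx.
have [r xE] := orbit_cocycle_gen (even_sign_k0 ql) (ltnW lp) dx.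
have : (r * l.+1%:R) *: z0 (leqW ql) = 0.
  by rewrite -scalerA -(h_orbit_k0 ql) -linearZ -xE.
move=> /(orbit_cocycle_free lp); rewrite mulr_natr => /tf r0.
by rewrite xE r0 ?scale0r.
Qed.

Hypothesis p_prime : prime p.
Hypothesis q_gt1 : (1 < q)%N.
Hypothesis unitP : forall N, coprime p N -> exists u : R, u * N%:R = 1.

Lemma koszul_grid_of_torsion_k0 : (exists nu0 : R, n%:R = p%:R * nu0) ->
  (forall i (x : A 0 i.+1 p), d 0 i.+1 p x = 0 -> exists y, p%:R *: x = d 0 i p y) ->
  koszul_grid (E := hom_bicomplex W (tpow_gcochain R p (Cnk n 0))) (b := base p 0)
    q n%:R (fun i l => h 0 i l).
Proof.
move=> pn tors; split=> //.
- exact: hom_bounded.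
- exact: hom_vertical.
- exact: hom_hh.
- exact: hom_dh.
- exact: hom_acyclic.
- by move=> l /andP [l1 lp] x; exact: cocycle0_k0_inj.
move=> x /(orbit_cocycle_gen (even_sign_k0 (leqnSn q)) (leqnn p)) [r ->].
exists (r *: z0 (leqnn q)); first by rewrite linearZ /= orbit_cocycleP scaler0.
by rewrite (linearZ_LR (h 0 0%N q)) h_orbit_k0 !scalerA mulrC.
Qed.

Lemma koszul_grid_of_torsion_k1 : (exists nu0 : R, n%:R = p%:R * nu0) ->
  (forall i (x : A 1 i.+1 p), d 1 i.+1 p x = 0 -> exists y, p%:R *: x = d 1 i p y) ->
  koszul_grid (E := hom_bicomplex W (tpow_gcochain R p (Cnk n 1))) (b := base p 1)
    q n%:R (fun i l => h 1 i l).
Proof.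
move=> pn tors; split=> //.
- exact: hom_bounded.
- exact: hom_vertical.
- exact: hom_hh.
- exact: hom_dh.
- exact: hom_acyclic.
- by move=> l /andP [l1 lp] x dx _; exact: cocycle0_k1 dx.
move=> x dx; exists 0; first exact: linear0.
by rewrite (cocycle0_k1 _ dx) ?linear0 ?scaler0 // ltnW.
Qed.

Lemma column_coh_line k k' b b' i c : `|Cnk_deg k b|%N = `|Cnk_deg k' b'|%N ->
  column_coh k (line_level p b) i c -> column_coh k' (line_level p b') i c.
Proof. exact: coh_line. Qed.

Lemma coh_high k i c : column_coh k p i.+1 c -> column_coh k 0 (i.+1 + q)%N c.
Proof.
apply: (@coh_top_bottom R (fun i l => A k i l) (fun i l => d k i l) (fun i l => h k i l)) => //.
- exact: hom_dd.
- exact: hom_hh.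
- exact: hom_dh.
- exact: hom_h_inj.
- exact: hom_h_exact.
- by move=> j x; exact: hom_above.
- exact: hom_acyclic.
Qed.

Lemma coh_low k i : (i.+1 < p)%N ->
  (forall x : A k 0 i.+2, d k 0 i.+2 x = 0 -> h k 0 i.+2 x = 0 -> x = 0) ->
  column_coh k 0 i.+1 1.
Proof.
move=> ip inv0.
apply: (@coh_bottom_low R (fun i l => A k i l) (fun i l => d k i l) (fun i l => h k i l)
  _ _ _ _ _ p) => //.
- exact: hom_dd.
- exact: hom_hh.
- exact: hom_dh.
- exact: hom_h_inj.
- exact: hom_h_exact.
exact: hom_acyclic.
Qed.

(** The first nonzero group with sign coefficients is the cokernel of p, the map
    induced by delta on the invariants of the last two columns. *)
Lemma coh_sign_edge i : q = i.+1 -> column_coh 0 0 i.+1 p%:R.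
Proof.
move=> qi; have ql : (q <= i.+1)%N by rewrite qi.
have ql' : (q <= i.+2)%N by apply: leqW.
have -> : p%:R = i.+2%:R :> R by rewrite qi.
apply: (@coh_bottom_edge R (fun i l => A 0 i l) (fun i l => d 0 i l) (fun i l => h 0 i l)
  _ _ _ _ _ p _ _ _ (z0 ql')) => //.
- exact: hom_dd.
- exact: hom_hh.
- exact: hom_dh.
- exact: hom_h_inj.
- exact: hom_h_exact.
- exact: hom_acyclic.
- by rewrite -qi.
- exact: orbit_cocycleP.
- by apply: hom_above; rewrite qi.
- by move=> x dx _; apply: orbit_cocycle_gen dx; rewrite qi.
move=> r; split=> [[v dv hv]|[y ->]].
  have [s vE] : exists s, v = s *: z0 ql by apply: orbit_cocycle_gen dv; rewrite qi.
  exists s; apply: subr0_eq; apply: (orbit_cocycle_free (ev := even_sign_k0 ql') (W := W)).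
    by rewrite qi.
  rewrite scalerBl -hv vE (linearZ_LR (h 0 0%N i.+1)) (h_orbit_k0 ql ql') scalerA.
  exact: subrr.
exists (y *: z0 ql); first by rewrite linearZ /= orbit_cocycleP scaler0.
by rewrite (linearZ_LR (h 0 0%N i.+1)) (h_orbit_k0 ql ql') scalerA.
Qed.

(** Both families at once, by induction: shifting by q = p - 1 degrees exchanges them. *)
Lemma column_orders i :
  column_coh 1 0 i.+1 (trivial_order R q i.+1) /\
  column_coh 0 0 i.+1 (sign_order R q i.+1).
Proof.
elim/ltn_ind: i => i IH.
have [ilow|ihigh] := ltnP i q.
  split.
    have -> : trivial_order R q i.+1 = 1.
      rewrite /trivial_order; case: dvdnP => // -[k kE].
      have : (0 < k)%N by lia.
      by nia.
    by apply: coh_low => // x dx _; exact: cocycle0_k1 dx.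
  have [iq|qi] := eqVneq i.+1 q.
    have -> : sign_order R q i.+1 = p%:R.
      by rewrite /sign_order iq modn_small ?eqxx //; lia.
    exact/coh_sign_edge/esym.
  have -> : sign_order R q i.+1 = 1.
    by rewrite /sign_order modn_small ?(negPf qi) //; lia.
  by apply: coh_low => // x; apply: cocycle0_k0_inj; lia.
have [j iE] : exists j, i = (j + q)%N by exists (i - q)%N; lia.
have [jT jS] := IH j ltac:(lia); subst i; rewrite -addSn; split.
  rewrite trivial_order_shift ?(ltnW q_gt1) //; apply: coh_high; rewrite -[p]/(line_level p true).
  exact: (column_coh_line (k := 0) (b := false)).
rewrite sign_order_shift ?(ltnW q_gt1) //; apply: coh_high; rewrite -[p]/(line_level p true).
exact: (column_coh_line (k := 1) (b := false)).
Qed.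
End Instances.

(** * The second pages for k = 0 and k = 1 *)

Section Pages.
Variables (R : comNzRingType) (q n : nat).
Local Notation p := q.+1.
Variable W : gresolution R 'S_p.
Hypothesis p_prime : prime p.
Hypothesis q_gt1 : (1 < q)%N.
Hypothesis q_even : ~~ odd q.
Hypothesis n_gt0 : (0 < n)%N.
Hypothesis n_dvd : exists nu0 : R, n%:R = p%:R * nu0.
Hypothesis unitP : forall N, coprime p N -> exists u : R, u * N%:R = 1.
Hypothesis tf : forall r (a : R), (0 < r)%N -> a *+ r = 0 -> a = 0.
Local Notation A k i l := (ghom (W i) (tcol R p n k l)).
Local Notation d k i l := (ghom_pre (tcol R p n k l) (rd W i)).
Local Notation h k i l := (ghom_post (W i) (row_dif R p n k l)).
Local Notation E k := (hom_bicomplex W (tpow_gcochain R p (Cnk n k))).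
Local Notation z0 lq := (orbit_cocycle W (even_sign_k0 n lq)).
Local Notation z1 lq := (orbit_cocycle W (even_sign_k1 n lq)).
Local Notation T i := (trivial_order R q i).
Local Notation S i := (sign_order R q i).

Lemma coh_trivial k b i : `|Cnk_deg k b|%N = 0%N ->
  column_coh n W k (line_level p b) i.+1 (T i.+1).
Proof.
move=> kb; have [cT _] := column_orders n W tf p_prime q_gt1 unitP i.
exact: (column_coh_line (k := 1) (b := false)).
Qed.

Lemma coh_sign k b i : `|Cnk_deg k b|%N = 1%N ->
  column_coh n W k (line_level p b) i.+1 (S i.+1).
Proof.
move=> kb; have [_ cS] := column_orders n W tf p_prime q_gt1 unitP i.
exact: (column_coh_line (k := 0) (b := false)).
Qed.

Lemma order_torsion k i c (x : A k i.+1 p) : c = p%:R \/ c = 1 ->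
  column_coh n W k p i.+1 c -> d k i.+1 p x = 0 -> exists y, p%:R *: x = d k i p y.
Proof.
by move=> c1 cx; exact: (cyclic_coh_torsion c1 cx).
Qed.

Lemma koszul_grid_k0 : koszul_grid (E := E 0) (b := base p 0) q n%:R (fun i l => h 0 i l).
Proof.
apply: koszul_grid_of_torsion_k0 => // i x; apply: (@order_torsion 0 i (T i.+1)).
  by rewrite /trivial_order; case: ifP; [left|right].
exact: (coh_trivial (k := 0) (b := true)).
Qed.

Lemma koszul_grid_k1 : koszul_grid (E := E 1) (b := base p 1) q n%:R (fun i l => h 1 i l).
Proof.
apply: koszul_grid_of_torsion_k1 => // i x; apply: (@order_torsion 1 i (S i.+1)).
  by rewrite /sign_order; case: ifP; [left|right].
exact: (coh_sign (k := 1) (b := true)).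
Qed.

Lemma base_k0 : base p 0 = - p%:Z. Proof. by rewrite /base; lia. Qed.
Lemma base_k1 : base p 1 = 0. Proof. by rewrite /base subrr mul0r. Qed.

(** The invariants of the last two columns are generated by orbit sums, and d_1 maps one
    generator to pn times the other. *)
Lemma page_k0_origin : lisom (page (E 0) 2 0 0) (cyclic_mod ((p * n)%:R : R)).
Proof.
have -> : page (E 0) 2 0 0 = page (E 0) 2 0%N (base p 0 + p%:Z) by rewrite base_k0 addNr.
apply: (page_row0_cyclic koszul_grid_k0 (z := z0 (leqnSn q)) (ltnSn q)).
- exact: orbit_cocycleP.
- by rewrite [h 0 _ _ _]hom_above ?scaler0.
- by move=> x dx; exact: orbit_cocycle_gen dx.
move=> r; split=> [[v dv rv]|[y ->]].
  have [s vE] : exists s, v = s *: z0 (leqnn q) by exact: orbit_cocycle_gen dv.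
  exists s; apply: subr0_eq.
  apply: (orbit_cocycle_free (ev := even_sign_k0 n (leqnSn q)) (W := W)) => //.
  rewrite scalerBl rv vE (linearZ_LR (h 0 0%N q)) (h_orbit_k0 n W (leqnn q) (leqnSn q)) !scalerA.
  by apply/eqP; rewrite subr_eq0; apply/eqP; congr (_ *: _); rewrite natrM; ring.
exists (y *: z0 (leqnn q)); first by rewrite linearZ /= orbit_cocycleP scaler0.
rewrite (linearZ_LR (h 0 0%N q)) (h_orbit_k0 n W (leqnn q) (leqnSn q)) !scalerA natrM.
by congr (_ *: _); ring.
Qed.

Lemma page_k0_zero (i j : int) : ~ (i = 0 /\ j = 0) ->
    (forall i' : nat, ~ (j = 0 /\ i = ((2 * i' + 2) * q)%N%:Z) /\
                      ~ (j = - p%:Z /\ i = ((2 * i' + 1) * q)%N%:Z)) ->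
  forall x : page (E 0) 2 i j, x = 0.
Proof.
move=> ne0 ne; apply: (page_range koszul_grid_k0) => -[|i'] l iE jE lp.
  have lq : (l < p)%N.
    rewrite ltn_neqAle lp andbT; apply/eqP => lE; case: ne0.
    by rewrite iE jE lE base_k0 addNr.
  apply: (page_row0_trivial koszul_grid_k0) => a da.
  by move=> /(hom_torsion_free tf n_gt0); exact: (cocycle0_k0_inj tf lq da).
have [l0|l0] := posnP l.
  subst l; apply: (page_bottom0 koszul_grid_k0).
  rewrite -(@sign_order1 R q (ltnW q_gt1) i'.+1); first exact: (coh_sign (k := 0) (b := false)).
  by move=> i1 e; have [_ []] := ne i1; rewrite iE jE e base_k0 addr0.
have [lq|ql] := ltnP l p.
  by apply: (page_middle koszul_grid_k0); rewrite l0.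
have lE : l = p by lia.
subst l; apply: (page_top0 koszul_grid_k0).
rewrite -(@trivial_order1 R q (ltnW q_gt1) i'.+1) //;
    first exact: (coh_trivial (k := 0) (b := true)).
by move=> i1 e; have [[]] := ne i1; rewrite iE jE e base_k0 addNr.
Qed.

Lemma page_k0_trivial m : lisom (page (E 0) 2 m.+1 0) (cyclic_mod (T m.+1)).
Proof.
have -> : page (E 0) 2 m.+1 0 = page (E 0) 2 m.+1 (base p 0 + p%:Z) by rewrite base_k0 addNr.
exact: (page_top koszul_grid_k0 (coh_trivial (k := 0) (b := true) m erefl)).
Qed.

Lemma page_k0_sign m : lisom (page (E 0) 2 m.+1 (- p%:Z)) (cyclic_mod (S m.+1)).
Proof.
have -> : page (E 0) 2 m.+1 (- p%:Z) = page (E 0) 2 m.+1 (base p 0 + 0%:Z).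
  by rewrite base_k0 addr0.
exact: (page_bottom koszul_grid_k0 (coh_sign (k := 0) (b := false) m erefl)).
Qed.

(** The invariants of the first two columns are generated by orbit sums, and d_1 maps one
    generator to n times the other. *)
Lemma page_k1_origin : lisom (page (E 1) 2 0 1) (cyclic_mod (n%:R : R)).
Proof.
have -> : page (E 1) 2 0 1 = page (E 1) 2 0%N (base p 1 + 1%:Z) by rewrite base_k1 add0r.
apply: (page_row0_cyclic koszul_grid_k1 (z := z1 (leqnn 1)) (ltn0Sn q)).
- exact: orbit_cocycleP.
- have -> : h 1 0%N 1%N (z1 (leqnn 1)) = 0; last exact: scaler0.
  by rewrite -(h_orbit_k1 n W); exact: hom_hh.
- by move=> x dx; exact: orbit_cocycle_gen dx.
move=> r; split=> [[v dv rv]|[y ->]].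
  have [s vE] : exists s, v = s *: z1 (leq0n 1) by exact: orbit_cocycle_gen dv.
  exists s; apply: subr0_eq.
  apply: (orbit_cocycle_free (ev := even_sign_k1 n (leqnn 1)) (W := W)) => //.
  rewrite scalerBl rv vE (linearZ_LR (h 1 0%N 0%N)) (h_orbit_k1 n W) !scalerA.
  by rewrite mulrC subrr.
exists (y *: z1 (leq0n 1)); first by rewrite linearZ /= orbit_cocycleP scaler0.
by rewrite (linearZ_LR (h 1 0%N 0%N)) (h_orbit_k1 n W) !scalerA mulrC.
Qed.

Lemma page_k1_zero (i j : int) : ~ (i = 0 /\ j = 1) ->
    (forall i' : nat, ~ (j = 0 /\ i = ((2 * i' + 2) * q)%N%:Z) /\
                      ~ (j = p%:Z /\ i = ((2 * i' + 1) * q)%N%:Z)) ->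
  forall x : page (E 1) 2 i j, x = 0.
Proof.
move=> ne0 ne; apply: (page_range koszul_grid_k1) => -[|i'] l iE jE lp.
  apply: (page_row0_trivial koszul_grid_k1) => a da /(hom_torsion_free tf n_gt0) ha.
  case: l a jE lp da ha => [|[|l]] a jE lp da ha; first exact: hom_h_inj ha.
    by case: ne0; rewrite iE jE base_k1 add0r.
  exact: cocycle0_k1 da.
have [l0|l0] := posnP l.
  subst l; apply: (page_bottom0 koszul_grid_k1).
  rewrite -(@trivial_order1 R q (ltnW q_gt1) i'.+1) //;
    first exact: (coh_trivial (k := 1) (b := false)).
  by move=> i1 e; have [[]] := ne i1; rewrite iE jE e base_k1 addr0.
have [lq|ql] := ltnP l p.
  by apply: (page_middle koszul_grid_k1); rewrite l0.
have lE : l = p by lia.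
subst l; apply: (page_top0 koszul_grid_k1).
rewrite -(@sign_order1 R q (ltnW q_gt1) i'.+1); first exact: (coh_sign (k := 1) (b := true)).
by move=> i1 e; have [_ []] := ne i1; rewrite iE jE e base_k1 add0r.
Qed.

Lemma page_k1_trivial m : lisom (page (E 1) 2 m.+1 0) (cyclic_mod (T m.+1)).
Proof.
have -> : page (E 1) 2 m.+1 0 = page (E 1) 2 m.+1 (base p 1 + 0%:Z) by rewrite base_k1 addr0.
exact: (page_bottom koszul_grid_k1 (coh_trivial (k := 1) (b := false) m erefl)).
Qed.

Lemma page_k1_sign m : lisom (page (E 1) 2 m.+1 p%:Z) (cyclic_mod (S m.+1)).
Proof.
have -> : page (E 1) 2 m.+1 p%:Z = page (E 1) 2 m.+1 (base p 1 + p%:Z) by rewrite base_k1 add0r.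
exact: (page_top koszul_grid_k1 (coh_sign (k := 1) (b := true) m erefl)).
Qed.

Let parity (m : int) : exists m' : int, m = 2 * m' \/ m = 2 * m' + 1.
Proof. by exists (m %/ 2)%Z; lia. Qed.

Let q_half : exists s : nat, q = (2 * s)%N.
Proof. by exists q./2; have := odd_double_half q; lia. Qed.

(** As q is even, the terms in column 0 have odd total degree and those in column p even
    total degree. *)
Lemma no_extension_k0 : no_extension_problems (E 0) 2.
Proof.
apply: (grid_no_extension_problems koszul_grid_k0) => m; have [s qs] := q_half.
have odd_sign i' : ((2 * i' + 1) * q = 2 * ((2 * i' + 1) * s))%N by rewrite qs; ring.
have odd_triv i' : ((2 * i' + 2) * q = 2 * ((2 * i' + 2) * s))%N by rewrite qs; ring.
have [m' [mE|mE]] := parity m.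
  exists 0 => j j0; apply: page_k0_zero; first lia.
  move=> i'; split; first lia.
  by rewrite odd_sign; move: ((_ * s)%N) => t; lia.
exists (- p%:Z) => j jp; apply: page_k0_zero; first lia.
move=> i'; split; last lia.
by rewrite odd_triv; move: ((_ * s)%N) => t; lia.
Qed.

(** As q is even, the terms in column 0 have even total degree and those in column p odd
    total degree; the latter exceeds 1, the total degree of the term in column 1. *)
Lemma no_extension_k1 : no_extension_problems (E 1) 2.
Proof.
apply: (grid_no_extension_problems koszul_grid_k1) => m; have [s qs] := q_half.
have odd_sign i' : ((2 * i' + 1) * q = 2 * ((2 * i' + 1) * s))%N by rewrite qs; ring.
have odd_triv i' : ((2 * i' + 2) * q = 2 * ((2 * i' + 2) * s))%N by rewrite qs; ring.
have [m' [mE|mE]] := parity m.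
  exists 0 => j j0; apply: page_k1_zero; first lia.
  move=> i'; split; first lia.
  by rewrite odd_sign; move: ((_ * s)%N) => t; lia.
have [m1|m1] := eqVneq m 1.
  exists 1 => j j1; apply: page_k1_zero; first lia.
  move=> i'; split; first by rewrite odd_triv; move: ((_ * s)%N) => t; lia.
  by rewrite odd_sign; move: ((_ * s)%N) => t; lia.
exists p%:Z => j jp; apply: page_k1_zero; first lia.
move=> i'; split; last lia.
by rewrite odd_triv; move: ((_ * s)%N) => t; lia.
Qed.
End Pages.

(** * The localized integers, and the collapse theorem *)

Lemma Zloc_unit p N : prime p -> coprime p N -> exists u : Zloc p, u * N%:R = 1.
Proof.
move=> p_prime pN.
have N0 : N%:Z != 0.
  by apply/eqP => -[N0]; move: pN; rewrite N0 /coprime gcdn0 => /eqP p1; rewrite p1 in p_prime.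
have uP : 1%:Q / N%:Z%:Q \in Zlocp p by apply: Zlocp_quot.
exists (exist (fun x : rat => x \in Zlocp p) _ uP); apply: val_inj; rewrite rmorphM rmorph_nat /=.
by rewrite div1r mulVf // intr_eq0.
Qed.

Lemma Zloc_torsion_free p r (a : Zloc p) : (0 < r)%N -> a *+ r = 0 -> a = 0.
Proof.
move=> r0 /(congr1 val); rewrite raddfMn /= => /eqP; rewrite mulrn_eq0.
by rewrite eqn0Ngt r0 /= => /eqP a0; apply: val_inj.
Qed.

Theorem theorem7p1 (p n e : nat) (p_prime : prime p) (p_odd : odd p)
    (e_gt0 : (0 < e)%N) (nE : n = (p ^ e)%N)
    (W : gresolution (Zloc p) 'S_p) :
  let E := hom_bicomplex W (D' p n 0) in
  let E' := hom_bicomplex W (D' p n 1) in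
  ([/\ collapses_at E 2, no_extension_problems E 2,
       lisom (page E 2 0 0) (cyclic_mod ((p * n)%:R : Zloc p)),
       forall i' : nat,
         lisom (page E 2 ((2 * i' + 2) * (p - 1))%N%:Z 0)
               (cyclic_mod (p%:R : Zloc p)) /\
         lisom (page E 2 ((2 * i' + 1) * (p - 1))%N%:Z (- p%:Z))
               (cyclic_mod (p%:R : Zloc p))
     & forall i j : int,
         ~ (i = 0 /\ j = 0) ->
         (forall i' : nat,
            ~ (j = 0 /\ i = ((2 * i' + 2) * (p - 1))%N%:Z) /\
            ~ (j = - p%:Z /\ i = ((2 * i' + 1) * (p - 1))%N%:Z)) ->
         forall x : page E 2 i j, x = 0]) /\
  ([/\ collapses_at E' 2, no_extension_problems E' 2,
       lisom (page E' 2 0 1) (cyclic_mod (n%:R : Zloc p)),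
       forall i' : nat,
         lisom (page E' 2 ((2 * i' + 2) * (p - 1))%N%:Z 0)
               (cyclic_mod (p%:R : Zloc p)) /\
         lisom (page E' 2 ((2 * i' + 1) * (p - 1))%N%:Z p%:Z)
               (cyclic_mod (p%:R : Zloc p))
     & forall i j : int,
         ~ (i = 0 /\ j = 1) ->
         (forall i' : nat,
            ~ (j = 0 /\ i = ((2 * i' + 2) * (p - 1))%N%:Z) /\
            ~ (j = p%:Z /\ i = ((2 * i' + 1) * (p - 1))%N%:Z)) ->
         forall x : page E' 2 i j, x = 0]).
Proof.
case: p p_prime p_odd nE W => [//|q] p_prime p_odd nE W E E'; rewrite !subSS !subn0.
have q_gt1 : (1 < q)%N by case: q p_prime p_odd {nE W E E'} => [|[|q]].
have n_gt0 : (0 < n)%N by rewrite nE expn_gt0.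
have n_dvd : exists nu0 : Zloc q.+1, n%:R = q.+1%:R * nu0.
  by exists (q.+1 ^ e.-1)%:R; rewrite nE -natrM -expnS prednK.
have unitP N : coprime q.+1 N -> exists u : Zloc q.+1, u * N%:R = 1 by exact: Zloc_unit.
have tf r (a : Zloc q.+1) : (0 < r)%N -> a *+ r = 0 -> a = 0.
  exact: Zloc_torsion_free.
have pos i' : exists m, ((2 * i' + 2) * q)%N = m.+1.
  by exists ((2 * i' + 2) * q).-1; rewrite prednK //; lia.
have pos' i' : exists m, ((2 * i' + 1) * q)%N = m.+1.
  by exists ((2 * i' + 1) * q).-1; rewrite prednK //; lia.
split; split.
- exact: koszul_grid_of_torsion_klapses (koszul_grid_k0 W p_prime q_gt1 n_dvd unitP tf).
- exact: no_extension_k0.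
- exact: page_k0_origin.
- move=> i'; split.
    rewrite -(trivial_orderE _ q i'); have [m mE] := pos i'.
    by rewrite mE; exact: page_k0_trivial.
  rewrite -(sign_orderE _ (ltnW q_gt1) i'); have [m mE] := pos' i'.
  by rewrite mE; exact: page_k0_sign.
- exact: page_k0_zero.
- exact: koszul_grid_of_torsion_klapses (koszul_grid_k1 W p_prime q_gt1 n_dvd unitP tf).
- exact: no_extension_k1.
- exact: page_k1_origin.
- move=> i'; split.
    rewrite -(trivial_orderE _ q i'); have [m mE] := pos i'.
    by rewrite mE; exact: page_k1_trivial.
  rewrite -(sign_orderE _ (ltnW q_gt1) i'); have [m mE] := pos' i'.
  by rewrite mE; exact: page_k1_sign.
exact: page_k1_zero.
Qed.
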